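(* Let $u,v\in C^2(B^{4n})$ and $0<r<1$. Then $$\int_{B_r^{4n}}(u\triangle v-v\triangle u)\,d\widetilde{V}=2\int_{S^{4n-1}}\left(uR^{0'}v-vR^{1'}u\right)(r\zeta)\,\frac{r^{4n-2}\,d\sigma(\zeta)}{(1-r^2)^{2n}},$$ where $d\widetilde V(\mathbf{q})=(1-|\mathbf{q}|^2)^{-2n-2}dV(\mathbf{q})$, $dV$ is Lebesgue measure on $\mathbb{R}^{4n}$, and $\sigma$ is the ${\rm Sp}(n){\rm Sp}(1)$-invariant measure on $S^{4n-1}$ satisfying $\sigma(S^{4n-1})=1$.
   Context: $\mathbb{H}$ is the quaternion algebra, $\mathbb{H}^n\cong\mathbb{R}^{4n}$ is the space of quaternionic $(n\times1)$ column vectors, $\mathbf{a}^*=\bar{\mathbf{a}}^t$, $|\mathbf{q}|^2=\mathbf{q}^*\mathbf{q}$, $B^{4n}=\{|\mathbf{q}|<1\}$, $B_r^{4n}=\{|\mathbf{q}|<r\}$, $S^{4n-1}=\partial B^{4n}$. ${\rm Sp}(n)$ is the group of quaternionic $n\times n$ matrices $U$ with $UU^*=I_n$, ${\rm Sp}(1)$ is the group of unit quaternions, and ${\rm Sp}(n){\rm Sp}(1)$ acts on $\mathbb{H}^n$ by the maps $\mathbf{q}\mapsto U\mathbf{q}p^*$, $U\in{\rm Sp}(n)$, $p\in{\rm Sp}(1)$. For $\mathbf{a}\in B^{4n}$ put $s_{\mathbf{a}}=(1-|\mathbf{a}|^2)^{1/2}$, $\mathbf{A}=(1-s_{\mathbf{a}})|\mathbf{a}|^{-2}\mathbf{a}\mathbf{a}^*+s_{\mathbf{a}}I_n$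 (with $\mathbf{A}=I_n$ if $\mathbf{a}=\mathbf{0}$), and $\varphi_{\mathbf{a}}(\mathbf{q})=(\mathbf{a}-\mathbf{A}\mathbf{q})(1-\mathbf{a}^*\mathbf{q})^{-1}$. The quaternionic Möbius invariant Laplacian is $(\triangle f)(\mathbf{a})=\triangle_0(f\circ\varphi_{\mathbf{a}})(\mathbf{0})$ for $f\in C^2(B^{4n})$, where $\triangle_0$ is the standard Laplacian on $\mathbb{R}^{4n}$. Write $\mathbf{q}=(q_1,\dots,q_n)^t$ with $q_l=x_{4l-4}+x_{4l-3}\mathbf{i}+x_{4l-2}\mathbf{j}+x_{4l-1}\mathbf{k}$. For $l=1,\dots,n$ define complex-valued functions $z_l^{0'}=x_{4l-4}+\mathbf{i}x_{4l-3}$, $z_l^{1'}=-x_{4l-2}-\mathbf{i}x_{4l-1}$, $z_{n+l}^{0'}=x_{4l-2}-\mathbf{i}x_{4l-1}$, $z_{n+l}^{1'}=x_{4l-4}-\mathbf{i}x_{4l-3}$, and complex vector fields $\nabla_l^{0'}=\frac12(\partial_{x_{4l-4}}-\mathbf{i}\partial_{x_{4l-3}})$, $\nabla_l^{1'}=\frac12(-\partial_{x_{4l-2}}+\mathbf{i}\partial_{x_{4l-1}})$, $\nabla_{n+l}^{0'}=\frac12(\partial_{x_{4l-2}}+\mathbf{i}\partial_{x_{4l-1}})$, $\nabla_{n+l}^{1'}=\frac12(\partial_{x_{4l-4}}+\mathbf{i}\partial_{x_{4l-3}})$, so that $\nabla_A^{A'}z_B^{B'}=\delta_{AB}\delta^{A'B'}$.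 Then $R^{A'}=\sum_{A=1}^{2n}z_A^{A'}\nabla_A^{A'}$ for $A'=0',1'$.
   Formalization: The printed formula lacks the factor |S^{4n-1}| = 4n|B^{4n}| on the right-hand side (it fails for u = 1, v = |q|^2 as r tends to 0, since dV is Lebesgue measure and σ has mass 1); the formal statement inserts this constant. *)

(* Defs.v *)
From HB Require Import structures.
From mathcomp Require Import all_boot all_order all_algebra.
From mathcomp Require Import complex.
From mathcomp Require Import all_classical all_reals all_analysis.
From mathcomp Require Import ring lra.

Set Implicit Arguments.
Unset Strict Implicit.
Unset Printing Implicit Defensive.

Import Order.TTheory GRing.Theory Num.Theory.
Import numFieldNormedType.Exports.

Local Open Scope classical_set_scope.
Local Open Scope ring_scope.

(** * The quaternion algebra *)

Record quat (R : Type) := Quat { qre : R; qi : R; qj : R; qk : R }.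

Section quat_choice.
Variable R : Type.
Definition quat_tuple (q : quat R) := (qre q, qi q, qj q, qk q).
Definition tuple_quat (t : R * R * R * R) :=
  Quat t.1.1.1 t.1.1.2 t.1.2 t.2.
Lemma quat_tupleK : cancel quat_tuple tuple_quat. Proof. by case. Qed.
End quat_choice.

HB.instance Definition _ (R : eqType) :=
  Equality.copy (quat R) (can_type (@quat_tupleK R)).
HB.instance Definition _ (R : choiceType) :=
  Choice.copy (quat R) (can_type (@quat_tupleK R)).

Section quat_ring.
Variable R : comNzRingType.
Implicit Types p q s : quat R.

Definition qzero : quat R := Quat 0 0 0 0.
Definition qone : quat R := Quat 1 0 0 0.
Definition qopp p := Quat (- qre p) (- qi p) (- qj p) (- qk p).
Definition qadd p q :=
  Quat (qre p + qre q) (qi p + qi q) (qj p + qj q) (qk p + qk q).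
Definition qmul p q := Quat
  (qre p * qre q - qi p * qi q - qj p * qj q - qk p * qk q)
  (qre p * qi q + qi p * qre q + qj p * qk q - qk p * qj q)
  (qre p * qj q - qi p * qk q + qj p * qre q + qk p * qi q)
  (qre p * qk q + qi p * qj q - qj p * qi q + qk p * qre q).

Fact qaddA : associative qadd.
Proof. by case=> ? ? ? ? [? ? ? ?] [? ? ? ?]; congr Quat; rewrite /= addrA. Qed.
Fact qaddC : commutative qadd.
Proof. by case=> ? ? ? ? [? ? ? ?]; congr Quat; rewrite /= addrC. Qed.
Fact qadd0 : left_id qzero qadd.
Proof. by case=> ? ? ? ?; congr Quat; rewrite /= add0r. Qed.
Fact qaddN : left_inverse qzero qopp qadd.
Proof. by case=> ? ? ? ?; congr Quat; rewrite /= addNr. Qed.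
HB.instance Definition _ := GRing.isZmodule.Build (quat R)
  qaddA qaddC qadd0 qaddN.

Fact qmulA : associative qmul.
Proof. by case=> ? ? ? ? [? ? ? ?] [? ? ? ?]; congr Quat => /=; ring. Qed.
Fact qmul1 : left_id qone qmul.
Proof. by case=> ? ? ? ?; congr Quat => /=; ring. Qed.
Fact qmulr1 : right_id qone qmul.
Proof. by case=> ? ? ? ?; congr Quat => /=; ring. Qed.
Fact qmulDl : left_distributive qmul qadd.
Proof. by case=> ? ? ? ? [? ? ? ?] [? ? ? ?]; congr Quat => /=; ring. Qed.
Fact qmulDr : right_distributive qmul qadd.
Proof. by case=> ? ? ? ? [? ? ? ?] [? ? ? ?]; congr Quat => /=; ring. Qed.
Fact qone_neq0 : qone != 0.
Proof. by apply/eqP => -[] /eqP; rewrite oner_eq0. Qed.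
HB.instance Definition _ := GRing.Zmodule_isNzRing.Build (quat R)
  qmulA qmul1 qmulr1 qmulDl qmulDr qone_neq0.

Definition qconj q := Quat (qre q) (- qi q) (- qj q) (- qk q).
Definition qreal (x : R) : quat R := Quat x 0 0 0.

End quat_ring.

Section quat_inverse.
Variable R : realFieldType.
Implicit Types p q : quat R.

Definition qsqr q : R := qre q ^+ 2 + qi q ^+ 2 + qj q ^+ 2 + qk q ^+ 2.
Definition qinv q : quat R := qreal (qsqr q)^-1 * qconj q.

Fact qsqr_neq0 q : q != 0 -> qsqr q != 0.
Proof.
apply: contra_neq; case: q => a b c d; rewrite /qsqr /= => h.
by congr Quat; nra.
Qed.
Fact qmulV : {in [pred q | q != 0], left_inverse 1 qinv *%R}.
Proof.
move=> q; rewrite inE => /qsqr_neq0 q0.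
by case: q q0 => a b c d; rewrite /qinv /qsqr /= => h; congr Quat => /=; field.
Qed.
Fact qmulrV : {in [pred q | q != 0], right_inverse 1 qinv *%R}.
Proof.
move=> q; rewrite inE => /qsqr_neq0 q0.
by case: q q0 => a b c d; rewrite /qinv /qsqr /= => h; congr Quat => /=; field.
Qed.
Fact qunitP p q : q * p = 1 /\ p * q = 1 -> [pred q | q != 0] p.
Proof.
case=> h _; apply/eqP => p0; move: h; rewrite p0 mulr0 => /esym/eqP.
by rewrite oner_eq0.
Qed.
Fact qinv_out : {in [predC [pred q | q != 0]], qinv =1 id}.
Proof.
move=> q; rewrite !inE negbK => /eqP ->.
by rewrite /qinv /qsqr; congr Quat => /=; ring.
Qed.
HB.instance Definition _ :=
  GRing.NzRing_hasMulInverse.Build (quat R) qmulV qmulrV qunitP qinv_out.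
End quat_inverse.

(** * Lebesgue measure on R^m

    R^m is the space of row vectors, with the sigma-algebra generated by the
    coordinates (the Borel sigma-algebra, R being second countable). *)

Section measurable_rV.
Variables (R : realType) (m : nat).

Definition rV_coord (i : 'I_m) (x : 'rV[R]_m) : R := x ord0 i.

Let rV_set0 : g_sigma_preimage rV_coord set0.
Proof. exact: sigma_algebra0. Qed.
Let rV_setC A : g_sigma_preimage rV_coord A -> g_sigma_preimage rV_coord (~` A).
Proof. exact: sigma_algebraC. Qed.
Let rV_bigcup (F : _^nat) : (forall i, g_sigma_preimage rV_coord (F i)) ->
  g_sigma_preimage rV_coord (\bigcup_i (F i)).
Proof. exact: sigma_algebra_bigcup. Qed.

HB.instance Definition _ := @isMeasurable.Build default_measure_display
  'rV[R]_m (g_sigma_preimage rV_coord) rV_set0 rV_setC rV_bigcup.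

Lemma measurable_rV_coord (i : 'I_m) : measurable_fun [set: 'rV[R]_m] (rV_coord i).
Proof.
move=> _ Y mY; rewrite setTI; apply: sub_sigma_algebra => /=.
rewrite -bigcup_seq/=; exists i => /=; first by rewrite mem_index_enum.
by exists Y => //; rewrite setTI.
Qed.

Lemma measurable_fun_rV d (T : measurableType d) (f : T -> 'rV[R]_m) :
  (forall i, measurable_fun [set: T] (rV_coord i \o f)) ->
  measurable_fun [set: T] f.
Proof.
move=> mf _ A mA; rewrite setTI.
have : preimage_set_system [set: T] f (g_sigma_preimage rV_coord) (f @^-1` A).
  by exists A => //; rewrite setTI.
rewrite -g_sigma_preimage_comp; apply: smallest_sub.
  exact: sigma_algebra_measurable.
rewrite -bigcup_seq; apply: bigcup_sub => i _ B [C mC <-].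
exact: mf.
Qed.
End measurable_rV.

Section lebesgue_rV.
Variable R : realType.

Definition cons_rV m (p : R * 'rV[R]_m) : 'rV[R]_m.+1 :=
  \row_i (if unlift ord0 i is Some j then p.2 ord0 j else p.1).

Lemma measurable_cons_rV m : measurable_fun [set: R * 'rV[R]_m] (@cons_rV m).
Proof.
apply: measurable_fun_rV => i.
case: (unliftP ord0 i) => [j|] ->.
  rewrite (_ : _ \o _ = rV_coord j \o snd).
    by apply: measurableT_comp => //; exact: measurable_rV_coord.
  by apply/funext => p; rewrite /rV_coord /= mxE liftK.
rewrite (_ : _ \o _ = fst); first exact: measurable_fst.
by apply/funext => p; rewrite /rV_coord /= mxE unlift_none.
Qed.

Definition behead_rV m (x : 'rV[R]_m.+1) : R * 'rV[R]_m :=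
  (x ord0 ord0, \row_j x ord0 (lift ord0 j)).

Lemma measurable_behead_rV m : measurable_fun [set: 'rV[R]_m.+1] (@behead_rV m).
Proof.
apply/measurable_fun_pair; first exact: (@measurable_rV_coord R m.+1 ord0).
apply: measurable_fun_rV => i.
rewrite (_ : _ \o _ = rV_coord (lift ord0 i)); first exact: measurable_rV_coord.
by apply/funext => p; rewrite /rV_coord /= mxE.
Qed.

Lemma cons_rVK m : cancel (@cons_rV m) (@behead_rV m).
Proof.
case=> a x; rewrite /behead_rV mxE unlift_none /=; congr (_, _).
by apply/rowP => j; rewrite !mxE liftK.
Qed.

Lemma behead_rVK m : cancel (@behead_rV m) (@cons_rV m).
Proof.
move=> x; apply/rowP => i; rewrite mxE.
by case: unliftP => [j|] -> //=; rewrite mxE.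
Qed.

Section step.
Variables (m : nat) (mu : {sigma_finite_measure set 'rV[R]_m -> \bar R}).

Definition lebesgue_step : set 'rV[R]_m.+1 -> \bar R :=
  pushforward (lebesgue_measure \x mu)%E (@cons_rV m).

Let mf := @measurable_cons_rV m.

Let lebesgue_step0 : lebesgue_step set0 = 0%E.
Proof. exact: measure0. Qed.
Let lebesgue_step_ge0 A : (0 <= lebesgue_step A)%E.
Proof. exact: measure_ge0. Qed.
Let lebesgue_step_sigma_additive : semi_sigma_additive lebesgue_step.
Proof. exact: measure_semi_sigma_additive. Qed.
HB.instance Definition _ := isMeasure.Build _ _ _ lebesgue_step
  lebesgue_step0 lebesgue_step_ge0 lebesgue_step_sigma_additive.

Let lebesgue_step_sigma_finite : sigma_finite setT lebesgue_step.
Proof.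
have [F FT Foo] : sigma_finite setT (lebesgue_measure \x mu)%E.
  have /sigma_finiteP[F [TF ndF Foo]] := sigma_finiteT (@lebesgue_measure R).
  have /sigma_finiteP[G [TG ndG Goo]] := sigma_finiteT mu.
  exists (fun k => F k `*` G k).
    rewrite -setXTT TF TG predeqE => -[x y]; split.
      move=> [/= [k _ Fkx] [l _ Gly]]; exists (maxn k l) => //; split.
      - by move: x Fkx; exact/subsetPset/ndF/leq_maxl.
      - by move: y Gly; exact/subsetPset/ndG/leq_maxr.
    by move=> [k _ []/= ? ?]; split; exists k.
  move=> k; have [mF Fk] := Foo k; have [mG Gk] := Goo k.
  split; first exact: measurableX.
  by rewrite product_measure1E// lte_mul_pinfty// ge0_fin_numE.
exists (fun k => @behead_rV m @^-1` F k).
  by rewrite -preimage_bigcup -FT preimage_setT.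
move=> k; have [mF Fk] := Foo k; split.
  by rewrite -[X in measurable X]setTI; exact: measurable_behead_rV.
rewrite /lebesgue_step /pushforward -comp_preimage.
rewrite (_ : _ \o _ = id) ?preimage_id//.
by apply/funext => p; exact: cons_rVK.
Qed.
HB.instance Definition _ :=
  Measure_isSigmaFinite.Build _ _ _ lebesgue_step lebesgue_step_sigma_finite.
End step.

Fixpoint lebesgue_rV (m : nat) : {sigma_finite_measure set 'rV[R]_m -> \bar R} :=
  if m is m'.+1 then lebesgue_step (lebesgue_rV m') else \d_(0 : 'rV[R]_0).

Lemma lebesgue_rV_box m (A : 'I_m -> set R) : (forall i, measurable (A i)) ->
  lebesgue_rV m [set x | forall i, A i (x ord0 i)] =
  (\prod_(i < m) lebesgue_measure (A i))%E.
Proof.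
elim: m A => [|m IH] A mA.
  rewrite big_ord0 /= diracE mem_set// => -[]//.
have mB : measurable [set x : 'rV[R]_m | forall i, A (lift ord0 i) (x ord0 i)].
  rewrite (_ : mkset _ =
    \bigcap_(i in [set: 'I_m]) (@rV_coord R m i @^-1` A (lift ord0 i))).
    apply: fin_bigcap_measurable => // i _.
    by rewrite -[X in measurable X]setTI; apply: measurable_rV_coord.
  by apply/seteqP; split=> x /= h i; [move=> _; apply: h | apply: (h i)].
rewrite big_ord_recl -IH//.
transitivity ((lebesgue_measure \x lebesgue_rV m)%E (A ord0 `*`
    [set x : 'rV[R]_m | forall i, A (lift ord0 i) (x ord0 i)])); last first.
  by rewrite product_measure1E//; exact: mA.
rewrite /= /lebesgue_step /pushforward; congr (product_measure1 _ _ _).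
apply/seteqP; split=> -[a x] /=.
  move=> h; split=> [|i]; first by have := h ord0; rewrite mxE unlift_none.
  by have := h (lift ord0 i); rewrite mxE liftK.
by move=> [h0 h] i; rewrite mxE; case: unliftP => [j|] ->.
Qed.
End lebesgue_rV.

(** * Differential and integral calculus on R^m *)

Section calculus.
Variables (R : realType) (m : nat).
Implicit Types (D : set 'rV[R]_m) (f : 'rV[R]_m -> R) (F : 'rV[R]_m -> R[i]).

Definition partial (k : 'I_m) f : 'rV[R]_m -> R :=
  fun x => 'D_(delta_mx ord0 k) f x.

(* Meant for open D: continuity at a point of D is then continuity within D. *)
Fixpoint Ck_on (j : nat) D f : Prop :=
  (forall x, D x -> {for x, continuous f}) /\
  if j is j'.+1 then
    forall k, (forall x, D x -> derivable f x (delta_mx ord0 k)) /\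
              Ck_on j' D (partial k f)
  else True.

Definition cpartial (k : 'I_m) F : 'rV[R]_m -> R[i] :=
  fun x => Complex (partial k (fun y => complex.Re (F y)) x)
                   (partial k (fun y => complex.Im (F y)) x).

Definition cC2_on D F : Prop :=
  Ck_on 2 D (fun x => complex.Re (F x)) /\ Ck_on 2 D (fun x => complex.Im (F x)).

Definition laplacian F : 'rV[R]_m -> R[i] :=
  fun x => \sum_(k < m) cpartial k (cpartial k F) x.

Definition cintegral (mu : {measure set 'rV[R]_m -> \bar R}) D F : R[i] :=
  Complex (\int[mu]_(x in D) complex.Re (F x)) (\int[mu]_(x in D) complex.Im (F x)).

End calculus.

(** * Quaternionic n-space *)

Section quaternionic_space.
Variables (R : realType) (n : nat).
Local Notation R4n := 'rV[R]_(n * 4).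
Local Notation Hn := 'cV[quat R]_n.

Definition adj p q (A : 'M[quat R]_(p, q)) : 'M[quat R]_(q, p) :=
  map_mx (@qconj R) A^T.

Definition hsqnorm (q : Hn) : R := qre ((adj q *m q) ord0 ord0).
Definition hnorm (q : Hn) : R := Num.sqrt (hsqnorm q).

Definition rscale (q : Hn) (p : quat R) : Hn := map_mx (fun x => x * p) q.

(* With l counted from 0, [ix l k] is the position of the k-th real component
   of the l-th quaternion coordinate, that is, 4 * l + k. *)
Definition ix (l : 'I_n) (k : nat) : 'I_(n * 4) := mxvec_index l (inord k : 'I_4).
Definition xc (x : R4n) (l : 'I_n) (k : nat) : R := x ord0 (ix l k).

Definition toH (x : R4n) : Hn :=
  \col_l Quat (xc x l 0%N) (xc x l 1%N) (xc x l 2%N) (xc x l 3%N).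
Definition ofH (q : Hn) : R4n :=
  mxvec (\matrix_(l < n, k < 4)
    [:: qre (q l ord0); qi (q l ord0); qj (q l ord0); qk (q l ord0)]`_k).

Lemma toHK : cancel toH ofH.
Proof.
move=> x; rewrite -[RHS]vec_mxK; congr mxvec; apply/matrixP => l k.
rewrite !mxE /= /xc /ix.
by case: k => -[|[|[|[|//]]]] h; rewrite /=;
  congr (x _ (mxvec_index _ _)); apply/val_inj; rewrite /= inordK.
Qed.

Lemma ofHK : cancel ofH toH.
Proof.
move=> q; apply/colP => l; rewrite mxE /xc /ix /ofH !mxvecE !mxE !inordK//=.
by case: (q l ord0).
Qed.

Definition qball (r : R) : set R4n := [set x | hnorm (toH x) < r].
Definition qsphere : set R4n := [set x | hnorm (toH x) = 1].

Definition Sp (p : nat) : set 'M[quat R]_p := [set U | U *m adj U = 1%:M].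
Definition Sp1 : set (quat R) := [set p | p * qconj p = 1].
Definition SpSp1_act (U : 'M[quat R]_n) (p : quat R) (x : R4n) : R4n :=
  ofH (rscale (U *m toH x) (qconj p)).

(* Only the restriction of mu to the sphere is constrained. *)
Definition SpSp1_invariant (mu : {measure set R4n -> \bar R}) : Prop :=
  forall U p, @Sp n U -> Sp1 p ->
  forall A, measurable A -> A `<=` qsphere -> mu (SpSp1_act U p @^-1` A) = mu A.

(* The total mass of the surface measure of S^{4n-1}, namely
   4n * |B^{4n}| = 2 pi^{2n} / (2n - 1)!.  For sigma normalized by
   sigma (S^{4n-1}) = 1, polar coordinates read
   dV = sphere_area * rho^{4n-1} d rho d sigma. *)
Definition sphere_area : R :=
  (4 * n)%:R * fine (lebesgue_rV R (n * 4) (qball 1)).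

(** ** Moebius transformations and the invariant Laplacian *)

Definition mobius_mx (a : Hn) : 'M[quat R]_n :=
  let s := Num.sqrt (1 - hsqnorm a) in
  if a == 0 then 1%:M
  else qreal ((1 - s) / hsqnorm a) *: (a *m adj a) + (qreal s)%:M.

Definition mobius (a q : Hn) : Hn :=
  rscale (a - mobius_mx a *m q) (1 - (adj a *m q) ord0 ord0)^-1.

Definition mobius_laplacian (f : R4n -> R[i]) (a : R4n) : R[i] :=
  laplacian (fun x => f (ofH (mobius (toH a) (toH x)))) 0.

(** ** The vector fields R^{0'} and R^{1'}

    The primed index is a boolean, [false] standing for 0' and [true] for 1';
    the left and right halves of ['I_(n + n)] are the indices l and n + l. *)

Definition zcoord (A' : bool) (A : 'I_(n + n)) (x : R4n) : R[i] :=
  match fintype.split A, A' with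
  | inl l, false => Complex (xc x l 0%N) (xc x l 1%N)
  | inl l, true  => Complex (- xc x l 2%N) (- xc x l 3%N)
  | inr l, false => Complex (xc x l 2%N) (- xc x l 3%N)
  | inr l, true  => Complex (xc x l 0%N) (- xc x l 1%N)
  end.

Definition nabla (A' : bool) (A : 'I_(n + n)) (f : R4n -> R[i]) (x : R4n) : R[i] :=
  let d l k := cpartial (ix l k) f x in
  let i := Complex 0 1 in
  match fintype.split A, A' with
  | inl l, false => 2^-1 * (d l 0%N - i * d l 1%N)
  | inl l, true  => 2^-1 * (- d l 2%N + i * d l 3%N)
  | inr l, false => 2^-1 * (d l 2%N + i * d l 3%N)
  | inr l, true  => 2^-1 * (d l 0%N + i * d l 1%N)
  end.

Definition Rfield (A' : bool) (f : R4n -> R[i]) (x : R4n) : R[i] :=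
  \sum_(A < n + n) zcoord A' A x * nabla A' A f x.

End quaternionic_space.

Arguments qball : clear implicits.
Arguments qsphere : clear implicits.

(* Main.v *)
(* With [W = u grad v - v grad u], the function [u Lap v - v Lap u] times
   [(1 - |q|^2)^(-2n-2)] is the divergence of
     [(1 - |q|^2)^(-2n-1) (W - sum_mu <q mu, W> q mu)],  [mu = 1, i, j, k],
   and the scalar product of this field with [q] is [(1 - |q|^2)^(-2n) <q, W>].
   On the boundary, [2 R^{0'} = E - i T] and [2 R^{1'} = E + i T], where [E] is the
   Euler field and [T] is the derivative in the direction [q i], tangent to the
   spheres; the terms in [T] add up to [- i T(uv) / 2], which integrates to 0.

   The divergence theorem on balls is obtained without a surface measure: by
   translation invariance of Lebesgue measure a partial derivative with compact
   support has integral 0, and this is applied to the field times a radial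
   cutoff, whose gradient lives on a thin shell.  The average of a continuous
   function over the shell is close to its [sigma]-average: integrate over the
   pairs [(x, z)] with [z] close to the direction of [x], in both orders; by
   invariance and transitivity all caps of a given radius have the same measure. *)

Require Import Defs.
From mathcomp Require Import all_boot all_order all_algebra.
From mathcomp Require Import complex.
From mathcomp Require Import all_classical all_reals all_analysis.
From mathcomp Require Import measurable_realfun.
From mathcomp Require Import ring lra.

Set Implicit Arguments.
Unset Strict Implicit.
Unset Printing Implicit Defensive.

Import Order.TTheory GRing.Theory Num.Theory.
Import numFieldNormedType.Exports.

Local Open Scope classical_set_scope.
Local Open Scope ring_scope.

(** * Borel sets and Lebesgue measure *)

(** The derivative at 0 of the Moebius map of [q] is a quaternionic matrix [L] with
    [L (adj L) = (1 - |q|^2) (I - q (adj q))]; read over the reals, [q (adj q)] is the sum over [mu]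
    of the projections-up-to-scale onto [q mu], which is why these four fields enter. The exponent
    [2n + 1] is forced by the first-order terms: [2 (2n + 1)] from the weight, [- 4n] from the
    divergence of [q] and [+ 2] from [sum_mu mu^2 = - 2] must add up to 4, the coefficient of the
    Euler field in the invariant Laplacian. The power [r^(4n-2)] is the growth [r^(4n-1)] of the
    area times [1/r], since the flux is taken against [q] and not against the unit normal [q / r].
    Two facts shape the analysis. The functions are known on the open unit ball only, and there
    through continuous partial derivatives, so every estimate stays inside that ball. And [sigma] is
    an abstract measure constrained on subsets of the sphere only, so it enters through its mass and
    a transitive family of isometries. *)

Section borel_rV.
Variables (R : realType) (m : nat).
Implicit Types (x y : 'rV[R]_m) (A : set 'rV[R]_m).

Lemma measurable_box (B : 'I_m -> set R) : (forall i, measurable (B i)) ->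
  measurable [set x : 'rV[R]_m | forall i, B i (x ord0 i)].
Proof.
move=> mB; rewrite (_ : mkset _ =
    \bigcap_(i in [set: 'I_m]) (@rV_coord R m i @^-1` B i)).
  apply: fin_bigcap_measurable => // i _.
  by rewrite -[X in measurable X]setTI; exact: measurable_rV_coord.
by apply/seteqP; split=> x /= h i; [move=> _; apply: h | apply: (h i)].
Qed.

Lemma rV_ballP x y (e : R) : 0 < e ->
  ball x e y <-> (forall i, `|x ord0 i - y ord0 i| < e).
Proof.
move=> e0; split=> [[_ h] i|h]; first exact: h.
by split=> // i j; rewrite ord1; exact: h.
Qed.

(** The sigma-algebra is generated by the coordinates, so openness is traced back to boxes: an open
    set is the union of the boxes with rational endpoints that it contains, and these are countably
    many. *)
Lemma open_measurable_rV A : open A -> measurable A.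
Proof.
move=> oA.
pose box (c : {ffun 'I_m -> rat * rat}) : set 'rV[R]_m :=
  [set x | forall i, `]ratr (c i).1, ratr (c i).2[%classic (x ord0 i)].
pose F (k : nat) := if unpickle k is Some c then
   (if `[< box c `<=` A >] then box c else set0) else set0.
rewrite (_ : A = \bigcup_k F k).
  apply: bigcupT_measurable => k; rewrite /F.
  case: unpickle => // c; case: asboolP => // _.
  exact: (@measurable_box (fun i => `]ratr (c i).1, ratr (c i).2[%classic)).
apply/seteqP; split=> [x Ax|x [k _]]; last first.
  by rewrite /F; case: unpickle => // c; case: asboolP => // + cx; exact.
have /nbhs_ballP[e /= e0 xeA] := open_nbhs_nbhs (conj oA Ax).
have h i : exists c : rat * rat, [/\ x ord0 i - e < ratr c.1, ratr c.1 < x ord0 i,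
    x ord0 i < ratr c.2 & ratr c.2 < x ord0 i + e].
  have [|a] := @rat_in_itvoo R (x ord0 i - e) (x ord0 i).
    by rewrite ltrBlDr ltrDl.
  have [|b] := @rat_in_itvoo R (x ord0 i) (x ord0 i + e); first by rewrite ltrDl.
  by rewrite !in_itv/= => /andP[? ?] /andP[? ?]; exists (a, b).
have [c hc] := choice h.
exists (pickle [ffun i => c i]) => //; rewrite /F pickleK.
have bA : box [ffun i => c i] `<=` A.
  move=> y cy; apply: xeA; apply/rV_ballP => // i.
  have := cy i; rewrite /= ffunE in_itv/= => /andP[? ?].
  have [? ? ? ?] := hc i; rewrite ltr_norml; apply/andP; split; lra.
case: asboolP => // _ i; rewrite /= ffunE in_itv/=.
by have [? -> -> ?] := hc i.
Qed.

Lemma open_continuous_measurable_rV (D : set 'rV[R]_m) (f : 'rV[R]_m -> R) :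
  open D -> (forall x, D x -> {for x, continuous f}) -> measurable_fun D f.
Proof.
move=> oD cf; apply: (measurability _ (RGenOInfty.measurableE R)) => /=.
move=> _ [_ [a ->] <-]; apply: open_measurable_rV.
rewrite openE => x [Dx] /=; rewrite in_itv/= andbT => afx.
apply: filterI; first exact: open_nbhs_nbhs.
have := cf x Dx; rewrite /prop_for /continuous_at => /(_ `]a, +oo[%classic).
apply; apply: open_nbhs_nbhs; split; first exact: interval_open.
by rewrite /= in_itv/= andbT.
Qed.

End borel_rV.

(** The translated measure takes the same values on half-open intervals, and these determine
    Lebesgue measure. *)
Lemma lebesgue_measure_translate (R : realType) (c : R) (A : set R) :
  measurable A ->
  lebesgue_measure ((fun x => x + c) @^-1` A) = lebesgue_measure A.
Proof.
move=> mA.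
have ms : measurable_fun [set: measurableTypeR R]
    ((fun x : R => x + c) : measurableTypeR R -> measurableTypeR R).
  exact: measurable_funD.
apply/esym; apply: (@lebesgue_measure_unique R (pushforward lebesgue_measure
  ((fun x : R => x + c) : measurableTypeR R -> measurableTypeR R))) => //=.
move=> _ [[a b] _ <-]; rewrite /pushforward.
rewrite (_ : _ @^-1` _ = `]a - c, b - c]%classic).
  rewrite !lebesgue_measure_itv/= !lte_fin ltrD2r.
  by case: ifPn => // _; rewrite -!EFinB; congr EFin; lra.
by apply/seteqP; split=> x /=; rewrite !in_itv/= ltrBlDr lerBrDr.
Qed.

Section tonelli_sets.
Local Open Scope ereal_scope.
Context d1 d2 (T1 : measurableType d1) (T2 : measurableType d2) (R : realType).
Variables (m1 : {sigma_finite_measure set T1 -> \bar R})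
          (m2 : {sigma_finite_measure set T2 -> \bar R}).

Lemma tonelli_sections (E : set (T1 * T2)) : measurable E ->
  \int[m1]_x m2 (xsection E x) = \int[m2]_y m1 (ysection E y).
Proof.
move=> mE; have := indic_fubini_tonelli m1 m2 mE.
by rewrite indic_fubini_tonelli_FE// indic_fubini_tonelli_GE.
Qed.

End tonelli_sets.

Lemma integral_step (d : measure_display) (T : measurableType d) (R : realType)
    (mu : {measure set T -> \bar R}) (K : set T) (f : T -> \bar R) (k : \bar R) :
  measurable K -> (forall y, K y -> f y = k) -> (forall y, ~ K y -> f y = 0%E) ->
  (\int[mu]_y f y = k * mu K)%E.
Proof.
move=> mK fK f0; rewrite -integral_cst// [RHS]integral_mkcond.
apply: eq_integral => y _; rewrite patchE; case: ifPn => [|/negP] yK.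
  by rewrite fK//; exact: set_mem.
by rewrite f0// => /mem_set.
Qed.

Section lebesgue_rV_translate.
Variable R : realType.

Lemma measurable_addr_rV m (c : 'rV[R]_m) :
  measurable_fun [set: 'rV[R]_m] (fun x => x + c).
Proof.
apply: measurable_fun_rV => i.
rewrite (_ : _ \o _ = (fun x => rV_coord i x + c ord0 i)).
  by apply: measurable_funD => //; exact: measurable_rV_coord.
by apply/funext => x; rewrite /rV_coord /= mxE.
Qed.

(** Induction along the product that defines the measure: the induction hypothesis translates the
    sections, the one-dimensional case the remaining variable. *)
Lemma lebesgue_rV_translate m (c : 'rV[R]_m) A : measurable A ->
  lebesgue_rV R m ((fun x => x + c) @^-1` A) = lebesgue_rV R m A.
Proof.
elim: m c A => [|m IH] c A mA.
  congr (lebesgue_rV R 0 _); apply/seteqP.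
  by split=> x /=; rewrite (_ : x + c = x)//; apply/rowP => -[].
rewrite /= /lebesgue_step /pushforward /product_measure1.
have mcA : measurable (@cons_rV R m @^-1` A).
  by rewrite -[X in measurable X]setTI; exact: measurable_cons_rV.
pose g t := lebesgue_rV R m (xsection (@cons_rV R m @^-1` A) t).
have mg : measurable_fun [set: measurableTypeR R] g.
  exact: measurable_fun_xsection.
pose c' : 'rV[R]_m := \row_j c ord0 (lift ord0 j).
transitivity (\int[@lebesgue_measure R]_t g ((t : R) + c ord0 ord0)%R)%E.
  apply: eq_integral => t _; rewrite /g /= -[RHS](IH c'); last first.
    exact: measurable_xsection.
  congr (lebesgue_rV R m _); apply/seteqP; split=> y /=;
    rewrite /xsection /= !in_setE /= (_ : cons_rV _ + _ =
      cons_rV (t + c ord0 ord0, y + c'))//; apply/rowP => i; rewrite !mxE;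
    by case: unliftP => [j|] -> //=; rewrite !mxE.
have ms : measurable_fun [set: measurableTypeR R]
    ((fun x : R => x + c ord0 ord0) : measurableTypeR R -> measurableTypeR R).
  exact: measurable_funD.
have := @ge0_integral_pushforward _ _ _ _ R _ ms lebesgue_measure setT g.
rewrite preimage_setT => <- //; last first.
apply: eq_measure_integral => B mB _.
exact: lebesgue_measure_translate.
Qed.

(** The argument for the uniqueness of Haar measure: the pairs [(x, y)] with [f x + y] in [A] and
    [y] in [K] are measured in both orders. For fixed [y] the section is a translate of [f^-1 A];
    after translating [y] by [f x] it becomes a translate of [f^-1 K], the symmetry of [K] turning
    [y - f x] into [f x - y]. A test set [K] of known measure then tells how [f] scales volume. *)
Lemma lebesgue_rV_preimage_ratio m (f g : 'rV[R]_m -> 'rV[R]_m)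
    (A K : set 'rV[R]_m) :
  cancel f g -> cancel g f -> {morph f : x y / x - y} ->
  measurable_fun [set: 'rV[R]_m] f -> measurable A -> measurable K ->
  (forall x, K x -> K (- x)) ->
  (lebesgue_rV R m (f @^-1` A) * lebesgue_rV R m K =
   lebesgue_rV R m (f @^-1` K) * lebesgue_rV R m A)%E.
Proof.
move=> fK gK fB mf mA mK KN; set V := lebesgue_rV R m.
have f0 : f 0 = 0 by rewrite -[X in f X](subrr 0) fB subrr.
have fN x : f (- x) = - f x by rewrite -sub0r fB f0 sub0r.
have fD x y : f (x + y) = f x + f y by rewrite -{1}[y]opprK fB fN opprK.
have pre (h : 'rV[R]_m * 'rV[R]_m -> 'rV[R]_m) B :
    measurable_fun setT h -> measurable B -> measurable (h @^-1` B).
  by move=> mh mB; rewrite -[X in measurable X]setTI; exact: mh.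
have mfB B : measurable B -> measurable (f @^-1` B).
  by move=> mB; rewrite -[X in measurable X]setTI; exact: mf.
pose E : set ('rV[R]_m * 'rV[R]_m) :=
  (fun p => f p.1 + p.2) @^-1` A `&` snd @^-1` K.
pose E' : set ('rV[R]_m * 'rV[R]_m) :=
  snd @^-1` A `&` (fun p => p.2 - f p.1) @^-1` K.
have mE : measurable E.
  apply: measurableI; apply: pre => //; apply: measurable_fun_rV => i.
  rewrite (_ : _ \o _ = (fun p => rV_coord i (f p.1) + rV_coord i p.2)).
    apply: measurable_funD; apply: measurableT_comp => //.
    - exact: measurable_rV_coord.
    - exact: measurableT_comp.
    - exact: measurable_rV_coord.
  by apply/funext => x; rewrite /rV_coord /= mxE.
have mE' : measurable E'.
  apply: measurableI; apply: pre => //; apply: measurable_fun_rV => i.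
  rewrite (_ : _ \o _ = (fun p => rV_coord i p.2 - rV_coord i (f p.1))).
    apply: measurable_funB; apply: measurableT_comp => //.
    - exact: measurable_rV_coord.
    - exact: measurable_rV_coord.
    - exact: measurableT_comp.
  by apply/funext => x; rewrite /rV_coord /= !mxE.
transitivity (\int[V]_y V (ysection E y))%E.
  apply/esym/integral_step => // y Ky; last first.
    rewrite (_ : ysection _ _ = set0) ?measure0//; apply/seteqP; split=> x //=.
    by rewrite /ysection /= in_setE => -[].
  rewrite -[RHS](lebesgue_rV_translate (g y)); last exact: mfB.
  congr (V _); apply/seteqP; split=> x /=; rewrite /ysection /= in_setE /E /=.
    by rewrite fD gK => -[].
  by rewrite fD gK.
rewrite -tonelli_sections//.
transitivity (\int[V]_x V (xsection E' x))%E.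
  apply: eq_integral => x _; rewrite -[RHS](lebesgue_rV_translate (f x)).
    congr (V _); apply/seteqP.
    split=> y /=; rewrite /xsection /= !in_setE /E /E' /= addrK.
      by rewrite addrC.
    by rewrite addrC.
  exact: measurable_xsection.
rewrite tonelli_sections//; apply: integral_step => // y Ay; last first.
  rewrite (_ : ysection _ _ = set0) ?measure0//; apply/seteqP; split=> x //=.
  by rewrite /ysection /= in_setE => -[].
rewrite -[RHS](lebesgue_rV_translate (- g y)); last exact: mfB.
congr (V _); apply/seteqP.
split=> x /=; rewrite /ysection /= in_setE /E' /= fD fN gK.
  by move=> [_ /KN]; rewrite opprB.
by move=> /KN; rewrite opprB.
Qed.

End lebesgue_rV_translate.

Lemma cvg_sumr (R : realType) (T : Type) (F : set_system T) (FF : Filter F)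
    (I : Type) (r : seq I) (f : I -> T -> R) (a : I -> R) :
  (forall i, f i x @[x --> F] --> a i) ->
  (\sum_(i <- r) f i x) @[x --> F] --> \sum_(i <- r) a i.
Proof.
move=> fa; elim: r => [|i r IH].
  by under eq_cvg do rewrite big_nil; rewrite big_nil; exact: cvg_cst.
by under eq_cvg do rewrite big_cons; rewrite big_cons; exact: cvgD.
Qed.

(** * Euclidean balls and spheres *)

Section euclidean.
Variables (R : realType) (m : nat).
Implicit Types (x y : 'rV[R]_m) (s t : R).

(** Row vectors carry the maximum norm, whose balls are boxes. The Euclidean norm is introduced
    through its square, and [eball] accordingly takes the square of the radius. *)
Definition esq x : R := \sum_i x ord0 i ^+ 2.

Definition eball s : set 'rV[R]_m := [set x | esq x < s].

Definition esphere : set 'rV[R]_m := [set x | esq x = 1].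

Lemma esq_ge0 x : 0 <= esq x.
Proof. by apply: sumr_ge0 => i _; exact: sqr_ge0. Qed.

Lemma esqZ t x : esq (t *: x) = t ^+ 2 * esq x.
Proof. by rewrite mulr_sumr; apply: eq_bigr => i _; rewrite mxE exprMn. Qed.

Lemma esq0 : esq 0 = 0.
Proof. by rewrite /esq big1// => i _; rewrite mxE expr0n. Qed.

Lemma esqN x : esq (- x) = esq x.
Proof. by rewrite -scaleN1r esqZ sqrrN expr1n mul1r. Qed.

Lemma coord_sqr_le_esq x i : x ord0 i ^+ 2 <= esq x.
Proof.
by rewrite /esq (bigD1 i)//= lerDl; apply: sumr_ge0 => j _; exact: sqr_ge0.
Qed.

Lemma esqD_le x y : esq (x + y) <= 2 * esq x + 2 * esq y.
Proof.
rewrite /esq !mulr_sumr -big_split/=; apply: ler_sum => i _; rewrite mxE.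
by have := sqr_ge0 (x ord0 i - y ord0 i); nra.
Qed.

Lemma continuous_esq : continuous esq.
Proof.
move=> x; apply: (@cvg_sumr R _ (nbhs x)) => i.
by rewrite expr2; apply: cvgM; exact: coord_continuous.
Qed.

Lemma eball_open s : open (eball s).
Proof.
apply: (@open_comp _ _ esq [set t | t < s]); last exact: open_lt.
by move=> x _; exact: continuous_esq.
Qed.

Lemma measurable_eball s : measurable (eball s).
Proof. by apply: open_measurable_rV; exact: eball_open. Qed.

Lemma measurable_esq : measurable_fun [set: 'rV[R]_m] esq.
Proof.
apply: open_continuous_measurable_rV; first exact: openT.
by move=> x _; exact: continuous_esq.
Qed.

Lemma measurable_esphere : measurable esphere.
Proof.
by rewrite -[X in measurable X]setTI; exact: (measurable_esq _ (measurable_set1 1)).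
Qed.

Lemma compact_closed_eball s : compact [set x | esq x <= s].
Proof.
have cl : closed [set x | esq x <= s].
  apply: (@preimage_closed _ _ esq [set t | t <= s]); last exact: closed_le.
  by move=> x _; exact: continuous_esq.
(* [t ^+ 2 <= s] implies [|t| <= 1 + s], which gives a bounding box without square roots. *)
apply: subclosed_compact cl
  (rV_compact (fun=> @segment_compact R (- (1 + s)) (1 + s))) _.
move=> x /= xs i; rewrite /= in_itv/=.
have := le_trans (coord_sqr_le_esq x i) xs => h.
by apply/andP; split; nra.
Qed.

Lemma bounded_on_closed_eball s (D : set 'rV[R]_m) (f : 'rV[R]_m -> R) :
  (forall x, D x -> {for x, continuous f}) -> (forall x, esq x <= s -> D x) ->
  exists M, 0 < M /\ forall x, esq x <= s -> `|f x| <= M.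
Proof.
move=> cf sD.
have : compact (f @` [set x | esq x <= s]).
  apply: continuous_compact; last exact: compact_closed_eball.
  apply: continuous_in_subspaceT => x; rewrite inE => /sD; exact: cf.
move=> /compact_bounded [M [_ hM]].
exists (`|M| + 1); split; first by rewrite ltr_wpDl.
move=> x xs; apply: hM; last by exists x.
by rewrite (le_lt_trans (ler_norm _))// ltrDl.
Qed.

End euclidean.

Lemma muleI_fin (R : realDomainType) (x y z : \bar R) :
  z \is a fin_num -> (0 < z)%E -> (z * x = z * y)%E -> x = y.
Proof.
move=> zf z0 h; apply/eqP; rewrite eq_le.
by rewrite -(lee_pmul2l zf z0 x y) -(lee_pmul2l zf z0 y x) h lexx.
Qed.

Section lebesgue_rV_eball.
Variables (R : realType) (m : nat).
Implicit Types (x y : 'rV[R]_m) (s t : R).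
Local Notation V := (lebesgue_rV R m).

Lemma lebesgue_rV_cube (a : 'rV[R]_m) s : 0 <= s ->
  V [set x | forall i, `]a ord0 i - s, a ord0 i + s[%classic (x ord0 i)] =
  ((2 * s) ^+ m)%:E.
Proof.
move=> s0; rewrite (@lebesgue_rV_box R m
  (fun i => `]a ord0 i - s, a ord0 i + s[%classic))//.
rewrite (eq_bigr (fun=> (2 * s)%:E)); last first.
  move=> i _; rewrite lebesgue_measure_itv /= lte_fin.
  case: ifPn => [_|]; first by rewrite -EFinB; congr EFin; lra.
  by rewrite -leNgt => h; congr EFin; lra.
by rewrite prodEFin big_const iter_mulr_1 card_ord.
Qed.

Lemma lebesgue_rV_eball_lty s : (V (eball s) < +oo)%E.
Proof.
apply: (@le_lt_trans _ _ (V [set x | forall i,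
   `](0 : 'rV[R]_m) ord0 i - (1 + `|s|),
     (0 : 'rV[R]_m) ord0 i + (1 + `|s|)[%classic (x ord0 i)])).
  apply: le_measure; rewrite ?inE.
  - exact: measurable_eball.
  - exact: (@measurable_box R m (fun i => `](0 : 'rV[R]_m) ord0 i - (1 + `|s|),
      (0 : 'rV[R]_m) ord0 i + (1 + `|s|)[%classic)).
  move=> x xs i; rewrite /= in_itv/= mxE !add0r.
  have := le_lt_trans (coord_sqr_le_esq x i) xs; have := ler_norm s.
  by have := normr_ge0 s => h1 h2 h3; apply/andP; split; nra.
by rewrite lebesgue_rV_cube ?ltry// addr_ge0.
Qed.

Lemma lebesgue_rV_open_gt0 (A : set 'rV[R]_m) : open A -> A !=set0 ->
  (0 < V A)%E.
Proof.
move=> oA [x Ax].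
have /nbhs_ballP[e /= e0 xeA] := open_nbhs_nbhs (conj oA Ax).
apply: (@lt_le_trans _ _ (V [set y | forall i,
   `]x ord0 i - e, x ord0 i + e[%classic (y ord0 i)])).
  by rewrite lebesgue_rV_cube 1?ltW// lte_fin exprn_gt0// mulr_gt0.
apply: le_measure; rewrite ?inE.
- exact: (@measurable_box R m (fun i => `]x ord0 i - e, x ord0 i + e[%classic)).
- exact: open_measurable_rV.
move=> y ye; apply: xeA; apply/rV_ballP => // i; have := ye i.
by rewrite /= in_itv/= ltr_norml => /andP[? ?]; apply/andP; split; lra.
Qed.

Lemma lebesgue_rV_eball_gt0 s : 0 < s -> (0 < V (eball s))%E.
Proof.
move=> s0; apply: lebesgue_rV_open_gt0; first exact: eball_open.
by exists 0; rewrite /eball /= esq0.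
Qed.

Lemma measurable_linear_rV (f : 'rV[R]_m -> 'rV[R]_m) :
  {morph f : x y / x + y} -> (forall t x, f (t *: x) = t *: f x) ->
  measurable_fun [set: 'rV[R]_m] f.
Proof.
move=> fD fZ; apply: measurable_fun_rV => i.
have f0 : f 0 = 0 by have := fZ 0 0; rewrite !scale0r.
rewrite (_ : _ \o _ = (fun x => \sum_j rV_coord j x * f (delta_mx ord0 j) ord0 i)).
  apply: measurable_sum => j.
  by apply: measurable_funM => //; exact: measurable_rV_coord.
apply/funext => x; rewrite /rV_coord /= {1}(row_sum_delta x).
rewrite (big_morph f fD f0) summxE; apply: eq_bigr => j _.
by rewrite fZ mxE.
Qed.

(** Linear isometries, with the inverse as data because [lebesgue_rV_preimage_ratio] asks for
    one. *)
Record lisom := Lisom {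
  lisom_fun :> 'rV[R]_m -> 'rV[R]_m;
  lisom_inv : 'rV[R]_m -> 'rV[R]_m;
  lisomK : cancel lisom_fun lisom_inv;
  lisomVK : cancel lisom_inv lisom_fun;
  lisomD : {morph lisom_fun : x y / x + y};
  lisomZ : forall t x, lisom_fun (t *: x) = t *: lisom_fun x;
  lisom_esq : forall x, esq (lisom_fun x) = esq x }.

Lemma measurable_lisom (f : lisom) : measurable_fun [set: 'rV[R]_m] f.
Proof. by apply: measurable_linear_rV; [move=> x y; exact: lisomD|exact: lisomZ]. Qed.

Lemma lisomB (f : lisom) : {morph f : x y / x - y}.
Proof. by move=> x y; rewrite lisomD -scaleN1r lisomZ scaleN1r. Qed.

(** The unit ball is its own preimage and has finite positive measure, so it cancels in
    [lebesgue_rV_preimage_ratio]. *)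
Lemma lebesgue_rV_lisom (f : lisom) A : measurable A ->
  V (f @^-1` A) = V A.
Proof.
move=> mA; have mB := @measurable_eball R m 1.
have := lebesgue_rV_preimage_ratio (lisomK f) (lisomVK f) (lisomB f)
  (measurable_lisom f) mA mB.
rewrite (_ : f @^-1` eball 1 = eball 1); last first.
  by apply/seteqP; split=> x; rewrite /eball /= lisom_esq.
move=> /(_ _) h; apply: (@muleI_fin _ _ _ (V (eball 1))).
- by rewrite ge0_fin_numE ?measure_ge0// lebesgue_rV_eball_lty.
- exact: lebesgue_rV_eball_gt0.
- by rewrite muleC h// => x; rewrite /eball /= esqN.
Qed.

(** [lebesgue_rV_preimage_ratio] for the dilation by [t^-1] with a cube as test set: its preimage is
    the cube [t] times as large, and both volumes are known. *)
Lemma lebesgue_rV_eball_scale t s : 0 < t ->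
  V (eball (t ^+ 2 * s)) = ((t ^+ m)%:E * V (eball s))%E.
Proof.
move=> t0.
pose c (u : R) := [set x : 'rV[R]_m | forall i,
  `](0 : 'rV[R]_m) ord0 i - u, (0 : 'rV[R]_m) ord0 i + u[%classic (x ord0 i)].
have mc u : measurable (c u).
  exact: (@measurable_box R m (fun i => `](0 : 'rV[R]_m) ord0 i - u,
    (0 : 'rV[R]_m) ord0 i + u[%classic)).
have tK (u : R) (u0 : u != 0) : cancel ( *:%R u : 'rV[R]_m -> _) ( *:%R u^-1).
  by move=> x; rewrite scalerA mulVf// scale1r.
have t1 : t^-1 != 0 by rewrite invr_eq0 gt_eqF.
have := @lebesgue_rV_preimage_ratio R m _ _ (eball s) (c 1) (tK _ t1) _ _ _ _ (mc _).
rewrite invrK => /(_ (tK _ (lt0r_neq0 t0))) h.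
have {h} := h (fun x y => scalerBr _ _ _) _ (measurable_eball _) _.
rewrite (_ : *:%R t^-1 @^-1` eball s = eball (t ^+ 2 * s)); last first.
  apply/seteqP; split=> x; rewrite /eball /= esqZ exprVn;
    by rewrite ltr_pdivrMl ?exprn_gt0.
rewrite (_ : *:%R t^-1 @^-1` c 1 = c t); last first.
  apply/seteqP; split=> x h i; have := h i; rewrite /= !in_itv/= !mxE !add0r;
    by rewrite ltr_pdivlMl// ltr_pdivrMl// mulr1 mulrN1.
rewrite !lebesgue_rV_cube// ?mulr1 ?ltW// => h.
apply: (@muleI_fin _ _ _ (2 ^+ m)%:E); first by [].
  by rewrite lte_fin exprn_gt0.
rewrite muleA -EFinM -exprMn -h; first by rewrite muleC.
  apply: measurable_linear_rV => [x y|u x]; first by rewrite scalerDr.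
  by rewrite !scalerA mulrC.
move=> x cx i; have := cx i; rewrite /= !in_itv/= !mxE !add0r.
by rewrite ltrN2 ltrNl andbC.
Qed.

End lebesgue_rV_eball.

(** * Derivatives along lines and the mean value theorem *)

Section line_derivative.
Variables (R : realType) (V : normedModType R).
Implicit Types (f : V -> R) (a v : V) (t d : R).

Lemma is_derive_line f a v t d :
  is_derive (a + t *: v) v f d <-> is_derive t (1 : R) (fun u => f (a + u *: v)) d.
Proof.
have E : (fun h : R => h^-1 *: ((f \o shift (a + t *: v)) (h *: v) - f (a + t *: v))) =
    (fun h : R => h^-1 *: (((fun u => f (a + u *: v)) \o shift t) (h *: 1) -
                           f (a + t *: v))).
  apply/funext => h /=; congr (_ *: (f _ - _)).
  by rewrite addrCA -scalerDl [_%:A]mulr1.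
by split=> -[dd de]; split; move: dd de; rewrite /derivable /derive E.
Qed.

Lemma is_derive_line0 f a v d :
  is_derive a v f d <-> is_derive 0 (1 : R) (fun u => f (a + u *: v)) d.
Proof. by rewrite -is_derive_line scale0r addr0. Qed.

Lemma is_derive_comp_line (g : R -> R) f a v d d' :
  is_derive a v f d -> is_derive (f a) (1 : R) g d' ->
  is_derive a v (fun x => g (f x)) (d' * d).
Proof.
move=> /is_derive_line0 df dg; apply/is_derive_line0.
apply: (@is_derive1_comp R g (fun u => f (a + u *: v))).
by rewrite scale0r addr0.
Qed.

(** [t] may have either sign, like the coordinate increments to which this is applied; hence a bound
    on [|u|] instead of an interval. *)
Lemma mvt_line f (df : V -> R) a v t :
  (forall u, `|u| <= `|t| -> is_derive (a + u *: v) v f (df (a + u *: v))) ->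
  exists2 u, `|u| <= `|t| & f (a + t *: v) - f a = df (a + u *: v) * t.
Proof.
move=> fd; pose g (u : R) := f (a + u *: v).
have gd u : `|u| <= `|t| -> is_derive u (1 : R) g (df (a + u *: v)).
  by move=> /fd /is_derive_line.
have g0 : g 0 = f a by rewrite /g scale0r addr0.
have [t0|t0] := leP 0 t.
  have ut u : u \in `[0, t] -> `|u| <= `|t|.
    by rewrite in_itv/= => /andP[u0 ut]; rewrite !ger0_norm// (le_trans u0).
  have [||c ct] := @MVT_segment R g (fun u => df (a + u *: v)) 0 t t0.
  - by move=> u uI; apply/gd/ut; exact: subset_itv_oo_cc.
  - by apply: derivable_within_continuous => u /ut /gd [].
  by rewrite g0 subr0 => E; exists c => //; exact: ut.
have ut u : u \in `[t, 0] -> `|u| <= `|t|.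
  by rewrite in_itv/= => /andP[tu u0]; rewrite !ler0_norm ?lerN2// ltW.
have [||c ct] := @MVT_segment R g (fun u => df (a + u *: v)) t 0 (ltW t0).
- by move=> u uI; apply/gd/ut; exact: subset_itv_oo_cc.
- by apply: derivable_within_continuous => u /ut /gd [].
rewrite g0 sub0r => E; exists c; first exact: ut.
by apply: oppr_inj; rewrite opprB E mulrN.
Qed.

End line_derivative.

Section integrable_EFin.
Context d (T : measurableType d) (R : realType).
Variables (mu : {measure set T -> \bar R}) (D : set T) (mD : measurable D).
Implicit Types f g : T -> R.

Lemma integrable_EFinB f g : mu.-integrable D (EFin \o f) ->
  mu.-integrable D (EFin \o g) -> mu.-integrable D (EFin \o (fun x => f x - g x)).
Proof. by move=> fi gi; exact: (integrableB mD fi gi). Qed.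

Lemma integrable_EFinD f g : mu.-integrable D (EFin \o f) ->
  mu.-integrable D (EFin \o g) -> mu.-integrable D (EFin \o (fun x => f x + g x)).
Proof. by move=> fi gi; exact: (integrableD mD fi gi). Qed.

Lemma integrable_EFinZ f (k : R) : mu.-integrable D (EFin \o f) ->
  mu.-integrable D (EFin \o (fun x => k * f x)).
Proof. by move=> fi; exact: (integrableZl mD k fi). Qed.

End integrable_EFin.

Section measure_preserving.
Local Open Scope ereal_scope.
Context d (T : measurableType d) (R : realType).
Variables (mu : {measure set T -> \bar R}) (phi : T -> T).
Hypothesis mphi : measurable_fun [set: T] phi.
Hypothesis mu_phi : forall A, measurable A -> mu (phi @^-1` A) = mu A.

Lemma ge0_integral_preserving (f : T -> \bar R) :
  measurable_fun [set: T] f -> (forall x, 0 <= f x) ->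
  \int[mu]_x f (phi x) = \int[mu]_x f x.
Proof.
move=> mf f0; have := @ge0_integral_pushforward _ _ _ _ R _ mphi mu setT f.
rewrite preimage_setT => <- //.
by apply: eq_measure_integral => A mA _; exact: mu_phi.
Qed.

Lemma integrable_preserving (f : T -> \bar R) :
  mu.-integrable setT f -> mu.-integrable setT (f \o phi).
Proof.
move=> /integrableP[mf fi]; apply/integrableP; split.
  exact: measurableT_comp.
rewrite (@ge0_integral_preserving (fun x => `|f x|))//.
exact: measurableT_comp.
Qed.

Lemma Rintegral_preserving (f : T -> R) :
  mu.-integrable setT (EFin \o f) ->
  (\int[mu]_x f (phi x) = \int[mu]_x f x)%R.
Proof.
move=> fi; congr fine.
have mf : measurable_fun setT (EFin \o f) by case/integrableP: fi.
have := @integral_pushforward _ _ _ _ R _ mphi mu setT _ mf.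
rewrite preimage_setT => <- //; last exact: integrable_preserving.
by apply: eq_measure_integral => A mA _; exact: mu_phi.
Qed.

End measure_preserving.

(** * Integrals of partial derivatives with compact support *)

Section integral_partial.
Variables (R : realType) (m : nat).
Local Notation V := (lebesgue_rV R m).
Implicit Types (f : 'rV[R]_m -> R) (D : set 'rV[R]_m) (s : R).

Lemma measurable_fun_vanish D f : open D ->
  (forall x, D x -> {for x, continuous f}) -> (forall x, ~ D x -> f x = 0) ->
  measurable_fun [set: 'rV[R]_m] f.
Proof.
move=> oD cf f0; have := open_continuous_measurable_rV oD cf.
rewrite measurable_restrictT; last exact: open_measurable_rV.
rewrite (_ : f \_ D = f)//; apply/funext => x; rewrite patchE.
by case: ifPn => // /negP xD; rewrite f0// => /mem_set.
Qed.

Lemma integrable_eball_support s f (M : R) :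
  measurable_fun [set: 'rV[R]_m] f -> (forall x, `|f x| <= M) ->
  (forall x, ~ eball s x -> f x = 0) -> V.-integrable setT (EFin \o f).
Proof.
move=> mf fM f0; rewrite (_ : EFin \o f = (EFin \o f) \_ (eball s)).
  rewrite -integrable_mkcond; last exact: measurable_eball.
  apply: measurable_bounded_integrable.
  - exact: measurable_eball.
  - exact: lebesgue_rV_eball_lty.
  - exact: measurable_funTS.
  - by exists M; split; [exact: num_real|
      move=> y My x _; apply: le_trans (fM x) _; exact: ltW].
apply/funext => x; rewrite patchE; case: ifPn => // /negP xs /=.
by rewrite f0// => /mem_set.
Qed.

Section compact_support.
Variables (D : set 'rV[R]_m) (s : R).
Hypotheses (oD : open D) (sD : forall x, esq x <= s -> D x).

Lemma compact_support_bounded f :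
  (forall x, D x -> {for x, continuous f}) -> (forall x, s < esq x -> f x = 0) ->
  exists M, 0 < M /\ forall x, `|f x| <= M.
Proof.
move=> cf f0; have [M [M0 hM]] := bounded_on_closed_eball cf sD.
exists M; split=> // x; have [|h] := leP (esq x) s; first exact: hM.
by rewrite f0// normr0 ltW.
Qed.

Lemma compact_support_measurable f :
  (forall x, D x -> {for x, continuous f}) -> (forall x, s < esq x -> f x = 0) ->
  measurable_fun [set: 'rV[R]_m] f.
Proof.
move=> cf f0; apply: (measurable_fun_vanish oD cf) => x Dx; apply: f0.
by rewrite ltNge; apply/negP => /sD.
Qed.

Lemma compact_support_integrable f :
  (forall x, D x -> {for x, continuous f}) -> (forall x, s < esq x -> f x = 0) ->
  V.-integrable setT (EFin \o f).
Proof.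
move=> cf f0; have [M [M0 hM]] := compact_support_bounded cf f0.
apply: (@integrable_eball_support (s + 1) _ M) => //.
  exact: compact_support_measurable.
move=> x; rewrite /eball /= => /negP; rewrite -leNgt => h; apply: f0.
by rewrite (lt_le_trans _ h)// ltrDl.
Qed.

(* By translation invariance the difference quotients of [F] have integral 0. *)
Lemma integral_partial_eq0 (k : 'I_m) (F G : 'rV[R]_m -> R) :
  (forall x, D x -> {for x, continuous F}) ->
  (forall x, D x -> {for x, continuous G}) ->
  (forall x, D x -> is_derive x (delta_mx ord0 k : 'rV[R]_m) F (G x)) ->
  (forall x, s < esq x -> F x = 0) -> (forall x, s < esq x -> G x = 0) ->
  \int[V]_x G x = 0.
Proof.
move=> cF cG dFD F0 G0; set e := delta_mx ord0 k : 'rV[R]_m.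
have iF := compact_support_integrable cF F0.
have mF := compact_support_measurable cF F0.
have mG := compact_support_measurable cG G0.
have [M [M0 GM]] := compact_support_bounded cG G0.
(* Where [esq x > s] the function vanishes in a neighbourhood, so [G] is its derivative on the whole
   space and not only on [D]. *)
have dF x : is_derive x e F (G x).
  have [|sx] := leP (esq x) s; first by move=> /sD; exact: dFD.
  rewrite G0//; apply: (@near_eq_is_derive _ _ _ (cst 0)).
  have : nbhs x [set y | s < esq y].
    have := @continuous_esq R m x [set t | s < t]; apply.
    by apply: open_nbhs_nbhs; split; [exact: open_gt|exact: sx].
  by apply: filterS => y /= ys; rewrite F0.
pose h (i : nat) : R := i.+1%:R^-1.
have h0 i : 0 < h i by rewrite invr_gt0.
have h1 i : h i <= 1 by rewrite invf_le1// ler1n.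
pose q i x := (h i)^-1 * (F (x + h i *: e) - F x).
have mFh i : measurable_fun [set: 'rV[R]_m] (fun x => F (x + h i *: e)).
  by apply: measurableT_comp => //; exact: measurable_addr_rV.
have tr i : measurable_fun [set: 'rV[R]_m] (fun x => x + h i *: e).
  exact: measurable_addr_rV.
have intq i : \int[V]_x q i x = 0.
  have iFh := integrable_preserving (tr i)
    (lebesgue_rV_translate (h i *: e)) iF.
  rewrite RintegralZl//; last exact: integrable_EFinB.
  rewrite RintegralB// (Rintegral_preserving (tr i)) ?subrr ?mulr0//.
  exact: lebesgue_rV_translate.
have mq i : measurable_fun [set: 'rV[R]_m] (q i).
  by apply: measurable_funM => //; apply: measurable_funB.
have qM i x : `|q i x| <= M.
  rewrite /q; have [u _ ->] := @mvt_line R _ F G x e (h i) (fun u _ => dF _).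
  by rewrite mulrC mulfK ?gt_eqF.
(* Since [|x|^2 <= 2 |x + h e|^2 + 2 h^2] and [h <= 1], the condition [|x|^2 >= 2 s + 3] puts both
   [x] and [x + h e] outside the support. All quotients thus live on one ball, as domination
   requires. *)
have q0 i x : ~ eball (2 * s + 3) x -> q i x = 0.
  rewrite /eball /= => /negP; rewrite -leNgt => xs.
  have xs1 : s < esq x by have := esq_ge0 x; lra.
  have xs2 : s < esq (x + h i *: e).
    have := esqD_le (x + h i *: e) (- (h i *: e)); rewrite addrK esqN esqZ.
    rewrite (_ : esq e = 1); last first.
      rewrite /esq (bigD1 k)//= big1 ?addr0 ?mxE ?eqxx ?expr1n// => j jk.
      by rewrite mxE (negbTE jk) andbF expr0n.
    have := h0 i; have := h1 i; nra.
  by rewrite /q !F0// subrr mulr0.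
have qG x : q ^~ x @ \oo --> G x.
  have hcvg : h i @[i --> \oo] --> (0 : R)^'.
    move=> A nA; have : \forall i \near \oo, h i != 0 -> A (h i).
      exact: (@cvg_harmonic R _ nA).
    by apply: filterS => i; apply; rewrite gt_eqF// h0.
  have [dFx dG] := dF x; rewrite -dG.
  rewrite (_ : q ^~ x =
      (fun t => t^-1 *: ((F \o shift x) (t *: e) - F x)) \o h).
    exact: cvg_comp hcvg dFx.
  by apply/funext => i; rewrite /q /= [_ *: e + x]addrC.
have mB := @measurable_eball R m (2 * s + 3).
have := @dominated_convergence _ _ _ V setT measurableT (fun i => EFin \o q i)
  (EFin \o G) (EFin \o (fun x => M * \1_(eball (2 * s + 3)) x)).
case.
- by move=> i; exact/measurable_EFinP.
- exact/measurable_EFinP.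
- by apply: aeW => x _; apply/fine_cvgP; split; [exact: nearW|exact: qG].
- apply: (@integrable_eball_support (2 * s + 3) _ M).
  + by apply: measurable_funM => //; exact: measurable_indic.
  + move=> x; rewrite indicE; case: (_ \in _) => /=.
      by rewrite mulr1 gtr0_norm.
    by rewrite mulr0 normr0 ltW.
  + by move=> x xs; rewrite indicE memNset// mulr0.
- apply: aeW => x i _; rewrite /= lee_fin indicE.
  have [xs|xs] := pselect (eball (2 * s + 3) x).
    by rewrite mem_set// mulr1.
  by rewrite q0 ?normr0 ?mulr0 ?memNset// mulr0.
move=> _ _; rewrite (_ : [sequence _]_n = cst 0%E).
  move=> c0; have := cvg_lim (@ereal_hausdorff R) c0.
  rewrite lim_cst; last exact: ereal_hausdorff.
  by rewrite /Rintegral => <-.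
apply/funext => i; rewrite /= -[0%E]/(0%:E) -(intq i) /Rintegral fineK//.
apply: integrable_fin_num => //.
apply: (@integrable_eball_support (2 * s + 3) _ M) => // x; exact: q0.
Qed.

End compact_support.

End integral_partial.

(** * Cutoffs built from the positive part *)

Section positive_part_square.
Variable R : realType.
Implicit Types (s t : R).

(** A quadratic bound on the remainder turns differentiability into algebra; [C = 0] serves for
    affine functions. *)
Lemma is_derive_quadratic (f : R -> R) t d (C : R) :
  (forall h, `|f (t + h) - f t - h * d| <= C * h ^+ 2) ->
  is_derive t (1 : R) f d.
Proof.
move=> fC; have C0 : 0 <= C.
  by have := fC 1; rewrite expr1n mulr1; exact: le_trans.
have cv : (fun h : R => h^-1 *: ((f \o shift t) (h *: 1) - f t)) @ 0^' --> d.
  apply/cvgrPdist_le => /= e e0; near=> h.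
  have h0 : h != 0 by near: h; exact: nbhs_dnbhs_neq.
  rewrite (_ : d - _ = - (h^-1 * (f (t + h) - f t - h * d))); last first.
    by rewrite /= [_%:A]mulr1 [_ *: _]/GRing.scale/= (addrC t); field.
  rewrite normrN normrM normfV ler_pdivrMl ?normr_gt0//.
  apply: (le_trans (fC h)); rewrite -[h ^+ 2]ger0_norm ?sqr_ge0// normrX.
  rewrite expr2 mulrCA ler_wpM2l//.
  apply: (@le_trans _ _ ((C + 1) * `|h|)); first by rewrite ler_wpM2r// lerDl.
  by rewrite -ler_pdivlMl// ?ltr_wpDl//; near: h; apply: dnbhs0_le;
    rewrite mulr_gt0// invr_gt0 ltr_wpDl.
by split; [apply/cvg_ex; exists d|exact: cvg_lim cv].
Unshelve. all: by end_near. Qed.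

(** Squaring makes the positive part C^1, the regularity that [integral_partial_eq0] asks of a
    cutoff. *)
Lemma is_derive_sqr_max0 t :
  is_derive t (1 : R) (fun t => (Num.max 0 t) ^+ 2) (2 * Num.max 0 t).
Proof.
apply: (@is_derive_quadratic _ _ _ 1) => h; rewrite mul1r ler_norml.
by rewrite /Num.max; case: ifP; case: ifP => h1 h2; apply/andP; split; nra.
Qed.

Lemma continuous_max0 : continuous (fun t : R => Num.max 0 t).
Proof.
move=> t; apply: (@continuous_max R R (cst 0) id t); first exact: cst_continuous.
exact: cvg_id.
Qed.

End positive_part_square.

Lemma Rintegral_sum (d : measure_display) (T : measurableType d) (R : realType)
    (mu : {measure set T -> \bar R}) (D : set T) (I : Type) (r : seq I)
    (f : I -> T -> R) : measurable D ->
  (forall i, mu.-integrable D (EFin \o f i)) ->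
  mu.-integrable D (EFin \o (fun x => \sum_(i <- r) f i x)) /\
  \int[mu]_(x in D) (\sum_(i <- r) f i x) = \sum_(i <- r) \int[mu]_(x in D) f i x.
Proof.
move=> mD fi; elim: r => [|i r [IHi IH]].
  rewrite (_ : (fun x => _) = cst 0); last first.
    by apply/funext => x; rewrite big_nil.
  by rewrite big_nil Rintegral_cst// mul0r; split=> //; exact: integrable0.
rewrite (_ : (fun x => _) = (fun x => f i x + \sum_(j <- r) f j x)); last first.
  by apply/funext => x; rewrite big_cons.
by rewrite big_cons; split; [exact: integrable_EFinD|rewrite RintegralD// IH].
Qed.

Lemma esq_delta_line (R : realType) (m : nat) (k : 'I_m) (x : 'rV[R]_m) (h : R) :
  esq (x + h *: delta_mx ord0 k) = esq x + 2 * h * x ord0 k + h ^+ 2.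
Proof.
rewrite /esq (bigD1 k)//= [in RHS](bigD1 k)//= !mxE !eqxx mulr1.
rewrite (eq_bigr (fun i => x ord0 i ^+ 2)); first by ring.
by move=> i ik; rewrite !mxE (negbTE ik) andbF mulr0 addr0.
Qed.

Lemma is_derive_esq (R : realType) (m : nat) (k : 'I_m) (x : 'rV[R]_m) :
  is_derive x (delta_mx ord0 k : 'rV[R]_m) (@esq R m) (2 * x ord0 k).
Proof.
apply/is_derive_line0; apply: (@is_derive_quadratic _ _ _ _ 1) => h.
rewrite !esq_delta_line add0r expr0n /= !mulr0 mul0r !addr0 mul1r.
by rewrite (_ : _ - _ = h ^+ 2); [rewrite ger0_norm ?sqr_ge0|ring].
Qed.

Section pointwise_continuity.
Variables (R : realType) (T : topologicalType).
Implicit Types (f g : T -> R) (x : T).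

Lemma for_continuousM f g x : {for x, continuous f} -> {for x, continuous g} ->
  {for x, continuous (fun y => f y * g y)}.
Proof. by move=> cf cg; apply: cvgM. Qed.

Lemma for_continuousD f g x : {for x, continuous f} -> {for x, continuous g} ->
  {for x, continuous (fun y => f y + g y)}.
Proof. by move=> cf cg; apply: cvgD. Qed.

Lemma for_continuousB f g x : {for x, continuous f} -> {for x, continuous g} ->
  {for x, continuous (fun y => f y - g y)}.
Proof. by move=> cf cg; apply: cvgB. Qed.

Lemma for_continuous_cst (c : R) x : {for x, continuous (fun=> c : R)}.
Proof. exact: cvg_cst. Qed.

Lemma for_continuousX f n x : {for x, continuous f} ->
  {for x, continuous (fun y => f y ^+ n)}.
Proof.
move=> cf; elim: n => [|n IH]; first exact: for_continuous_cst.
rewrite (_ : (fun y => _) = fun y => f y * f y ^+ n).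
  exact: for_continuousM.
by apply/funext => y; rewrite exprS.
Qed.

Lemma for_continuous_sum (I : Type) (r : seq I) (f : I -> T -> R) x :
  (forall i, {for x, continuous (f i)}) ->
  {for x, continuous (fun y => \sum_(i <- r) f i y)}.
Proof. by move=> cf; apply: (@cvg_sumr R _ (nbhs x)) => i; exact: cf. Qed.

End pointwise_continuity.

Lemma for_continuous_coord (R : realType) (m : nat) (i : 'I_m) (x : 'rV[R]_m) :
  {for x, continuous (fun y : 'rV[R]_m => y ord0 i)}.
Proof. exact: coord_continuous. Qed.

Section integral_cutoff.
Variables (R : realType) (m : nat) (D : set 'rV[R]_m) (s : R).
Variables X X' : 'I_m -> 'rV[R]_m -> R.
Local Notation V := (lebesgue_rV R m).
Hypotheses (oD : open D) (sD : forall x, esq x <= s -> D x).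
Hypothesis cX : forall k x, D x -> {for x, continuous (X k)}.
Hypothesis cX' : forall k x, D x -> {for x, continuous (X' k)}.
Hypothesis dX : forall k x, D x ->
  is_derive x (delta_mx ord0 k : 'rV[R]_m) (X k) (X' k x).

Lemma continuous_cutoff (t : R) : continuous (fun x : 'rV[R]_m => Num.max 0 (t - esq x)).
Proof.
move=> x; apply: (@continuous_comp _ _ _ (fun x : 'rV[R]_m => t - esq x)
  (fun t : R => Num.max 0 t)); last exact: continuous_max0.
by apply: for_continuousB; [exact: for_continuous_cst|exact: continuous_esq].
Qed.

(** With [w = max 0 (s - |x|^2)], the field [w^2 X] vanishes outside a closed ball contained in [D],
    so its divergence has integral 0; the gradient of [w^2] is [- 4 w x]. *)
Lemma integral_cutoff_divergence :
  \int[V]_x (Num.max 0 (s - esq x) ^+ 2 * \sum_k X' k x) =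
  4 * \int[V]_x (Num.max 0 (s - esq x) * \sum_k x ord0 k * X k x).
Proof.
pose w (x : 'rV[R]_m) := Num.max 0 (s - esq x).
have cw : continuous w by exact: continuous_cutoff.
have w0 x : s < esq x -> w x = 0 by move=> sx; rewrite /w max_l// subr_le0 ltW.
pose A k x := w x ^+ 2 * X' k x; pose B k x := w x * (x ord0 k * X k x).
have cA k x : D x -> {for x, continuous (A k)}.
  by move=> Dx; apply: for_continuousM; [by apply: for_continuousX; exact: cw|exact: cX'].
have cB k x : D x -> {for x, continuous (B k)}.
  move=> Dx; apply: for_continuousM; first exact: cw.
  by apply: for_continuousM; [exact: for_continuous_coord|exact: cX].
have iA k : V.-integrable setT (EFin \o A k).
  apply: (compact_support_integrable oD sD) => x; first exact: cA.
  by move=> sx; rewrite /A w0// expr0n mul0r.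
have iB k : V.-integrable setT (EFin \o B k).
  apply: (compact_support_integrable oD sD) => x; first exact: cB.
  by move=> sx; rewrite /B w0// mul0r.
under eq_Rintegral do rewrite mulr_sumr.
under [in RHS]eq_Rintegral do rewrite mulr_sumr.
have [_ ->] := @Rintegral_sum _ _ _ V setT _ (index_enum 'I_m) A measurableT iA.
have [_ ->] := @Rintegral_sum _ _ _ V setT _ (index_enum 'I_m) B measurableT iB.
rewrite mulr_sumr; apply: eq_bigr => k _; apply/eqP; rewrite -subr_eq0.
rewrite -RintegralZl// -RintegralB//; last exact: integrable_EFinZ.
apply/eqP; apply: (@integral_partial_eq0 _ _ D s oD sD k (fun x => w x ^+ 2 * X k x)).
- by move=> x Dx; apply: for_continuousM; [by apply: for_continuousX; exact: cw|exact: cX].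
- move=> x Dx; apply: for_continuousB; first exact: cA.
  by apply: for_continuousM; [exact: for_continuous_cst|exact: cB].
- move=> x Dx.
  have dw : is_derive x (delta_mx ord0 k : 'rV[R]_m) (fun x => w x ^+ 2)
      (2 * w x * (- (2 * x ord0 k))).
    apply: (@is_derive_comp_line _ _ (fun t => Num.max 0 t ^+ 2)
      (fun x : 'rV[R]_m => s - esq x)); last exact: is_derive_sqr_max0.
    have de := is_derive_esq k x.
    by rewrite -sub0r; exact: (@is_deriveB _ _ _ (cst s)).
  have dXk := dX k Dx.
  apply: is_derive_eq (@is_deriveM _ _ (fun x => w x ^+ 2) (X k) _ _ _ _ dw dXk) _.
  by rewrite /A /B /GRing.scale /=; ring.
- by move=> x sx; rewrite w0// expr0n mul0r.
- by move=> x sx; rewrite /A /B w0// expr0n !mul0r mulr0 subrr.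
Qed.

End integral_cutoff.

(** * Averages over thin shells *)

Section cap.
Variables (R : realType) (m : nat).
Implicit Types (x y z : 'rV[R]_m) (e a r : R).

Definition enorm x : R := Num.sqrt (esq x).

Lemma enorm_ge0 x : 0 <= enorm x. Proof. exact: sqrtr_ge0. Qed.

Lemma sqr_enorm x : enorm x ^+ 2 = esq x.
Proof. by rewrite sqr_sqrtr// esq_ge0. Qed.

(* The angular neighbourhood of radius [e] of the direction [z]. *)
Definition cap e x z : Prop := esq (x - enorm x *: z) < e ^+ 2 * esq x.

Lemma cap_lisom e (f : lisom R m) x z : cap e (f x) (f z) = cap e x z.
Proof. by rewrite /cap /enorm lisom_esq -lisomZ -lisomB lisom_esq. Qed.

Lemma cap_direction e x z : 0 < esq x ->
  cap e x z = (esq ((enorm x)^-1 *: x - z) < e ^+ 2).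
Proof.
move=> x0; have n0 : 0 < enorm x by rewrite sqrtr_gt0.
rewrite /cap [in LHS](_ : x - _ = enorm x *: ((enorm x)^-1 *: x - z)); last first.
  by rewrite scalerBr scalerA mulfV ?gt_eqF// scale1r.
by rewrite esqZ sqr_enorm mulrC ltr_pM2r.
Qed.

Lemma esq_direction x : 0 < esq x -> esq ((enorm x)^-1 *: x) = 1.
Proof.
by move=> x0; rewrite esqZ exprVn sqr_enorm mulVf// gt_eqF.
Qed.

Lemma ler_norm_sqr (u v : R) : 0 <= v -> u ^+ 2 <= v ^+ 2 -> `|u| <= v.
Proof. by move=> v0 uv; rewrite -(ger0_norm v0) -ler_sqr ?nnegrE// !real_normK ?num_real. Qed.

(** [x - r z = (x - |x| z) - (r - |x|) z]: the cap condition bounds the first part by [e |x|], and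
    [|x| >= a] bounds the second by [r - a]. *)
Lemma cap_close e a r x z : 0 <= e -> 0 <= a -> a <= r -> esq z = 1 ->
  a ^+ 2 <= esq x -> esq x <= r ^+ 2 -> cap e x z ->
  forall i, `|x ord0 i - (r *: z) ord0 i| <= e * r + (r - a).
Proof.
move=> e0 a0 ar z1 ax xr xz i; have n0 := enorm_ge0 x; have n2 := sqr_enorm x.
have nr : enorm x <= r.
  by rewrite -(ger0_norm n0); apply: ler_norm_sqr; rewrite ?n2// (le_trans a0).
have an : a <= enorm x.
  by rewrite -(ger0_norm a0); apply: ler_norm_sqr; rewrite ?n2.
have h1 : `|x ord0 i - enorm x * z ord0 i| <= e * enorm x.
  apply: ler_norm_sqr; first exact: mulr_ge0.
  have := coord_sqr_le_esq (x - enorm x *: z) i; rewrite !mxE => /le_trans; apply.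
  by rewrite exprMn n2 ltW.
have h2 : `|z ord0 i| <= 1.
  by apply: ler_norm_sqr => //; rewrite expr1n -z1 coord_sqr_le_esq.
rewrite mxE (_ : _ - _ = (x ord0 i - enorm x * z ord0 i) -
  (r - enorm x) * z ord0 i); last by ring.
rewrite (le_trans (ler_normB _ _))// lerD//.
  by rewrite (le_trans h1)// ler_wpM2l.
rewrite normrM ger0_norm ?subr_ge0//.
by have := normr_ge0 (z ord0 i); nra.
Qed.

Lemma measurable_enorm : measurable_fun [set: 'rV[R]_m] enorm.
Proof.
apply: (@measurableT_comp _ _ _ _ _ _ (@Num.sqrt R)); last exact: measurable_esq.
by apply: continuous_measurable_fun => t; exact: sqrt_continuous.
Qed.

Lemma continuous_enorm : continuous enorm.
Proof.
move=> x; apply: (@continuous_comp _ _ _ (@esq R m) (@Num.sqrt R)).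
  exact: continuous_esq.
exact: sqrt_continuous.
Qed.

(** The condition on the second component keeps the sections inside the sphere, where [sigma] is
    constrained. *)
Definition cap_set e : set ('rV[R]_m * 'rV[R]_m) :=
  [set p | esphere p.2 /\ cap e p.1 p.2].

Lemma measurable_cap_set e : measurable (cap_set e).
Proof.
pose h (p : 'rV[R]_m * 'rV[R]_m) := esq (p.1 - enorm p.1 *: p.2).
pose k (p : 'rV[R]_m * 'rV[R]_m) := e ^+ 2 * esq p.1.
have mh : measurable_fun setT h.
  apply: measurableT_comp; first exact: measurable_esq.
  apply: measurable_fun_rV => i.
  rewrite (_ : _ \o _ = (fun p => rV_coord i p.1 - enorm p.1 * rV_coord i p.2)).
    apply: measurable_funB; first exact: measurableT_comp (@measurable_rV_coord R m i) _.
    apply: measurable_funM; first exact: measurableT_comp measurable_enorm _.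
    exact: measurableT_comp (@measurable_rV_coord R m i) _.
  by apply/funext => p; rewrite /rV_coord /= !mxE.
have mk : measurable_fun setT k.
  by apply: measurable_funM => //; exact: measurableT_comp (@measurable_esq R m) _.
rewrite (_ : cap_set e = snd @^-1` (@esphere R m) `&` [set p | h p < k p])//.
apply: measurableI.
  by rewrite -[X in measurable X]setTI; exact: measurable_snd (@measurable_esphere R m).
rewrite (_ : mkset _ = setT `&` (fun p => h p < k p) @^-1` [set true]).
  exact: (measurable_fun_ltr mh mk).
by apply/seteqP; split=> [p|p []].
Qed.

Lemma cap_open e z (D : set 'rV[R]_m) : open D -> open (D `&` [set x | cap e x z]).
Proof.
move=> oD; apply: openI => //.
have c x : {for x, continuous (fun x => esq (x - enorm x *: z) - e ^+ 2 * esq x)}.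
  apply: for_continuousB; last first.
    by apply: for_continuousM; [exact: for_continuous_cst|exact: continuous_esq].
  apply: for_continuous_sum => i; apply: for_continuousX.
  rewrite (_ : (fun _ => _) = (fun y : 'rV[R]_m => y ord0 i - enorm y * z ord0 i)).
    apply: for_continuousB; first exact: for_continuous_coord.
    by apply: for_continuousM; [exact: continuous_enorm|exact: for_continuous_cst].
  by apply/funext => y; rewrite !mxE.
rewrite (_ : mkset _ = (fun x => esq (x - enorm x *: z) - e ^+ 2 * esq x) @^-1`
    [set t | t < 0]).
  by apply: open_comp; [move=> x _; exact: c|exact: open_lt].
by apply/seteqP; split=> x; rewrite /cap /= subr_lt0.
Qed.

End cap.

(** Only [x] is confined to the compact set: halving the radii of continuity in the covering
    argument leaves room for an arbitrary nearby [y]. *)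
Lemma compact_uniform_continuous (R : realType) (m : nat) (A : set 'rV[R]_m)
    (g : 'rV[R]_m -> R) (e : R) :
  compact A -> (forall x, A x -> {for x, continuous g}) -> 0 < e ->
  exists2 d, 0 < d & forall x y : 'rV[R]_m, A x -> (forall i, `|x ord0 i - y ord0 i| < d) ->
    `|g x - g y| < e.
Proof.
move=> cA cg e0.
have hF : \forall d \near (0 : R)^'+, forall x, A x ->
    forall y, ball x d y -> `|g x - g y| < e.
  apply: ((compact_near_coveringP A).1 cA R (0^'+)%R
    (fun (d : R) (x : 'rV[R]_m) => forall y, ball x d y -> `|g x - g y| < e) _).
  move=> x Ax.
  have e20 : 0 < e / 2 by rewrite divr_gt0.
  have /cvgrPdist_lt/(_ _ e20)/nbhs_ballP[d /= d0 hd] := cg x Ax.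
  have d20 : 0 < d / 2 by rewrite divr_gt0.
  exists (ball x (d / 2), [set t | t < d / 2]) => /=.
    by split; [exact: nbhsx_ballx|exact: nbhs_right_lt].
  move=> [z t] /= [xz td] y zy.
  rewrite (splitr e) (_ : g z - g y = (g x - g y) - (g x - g z)); last by ring.
  rewrite (le_lt_trans (ler_normB _ _))// ltrD//.
    apply: hd; rewrite (splitr d); apply: ball_triangle xz _.
    by apply: le_ball zy; exact: ltW.
  by apply: hd; apply: le_ball xz; rewrite ler_pdivrMr// ler_pMr// ler1n.
have : \forall d \near 0^'+, (forall x, A x -> forall y, ball x d y -> `|g x - g y| < e) /\
    0 < d.
  by apply: filterI; [exact: hF|exact: nbhs_right_gt].
move=> /filter_ex[d [hd d0]]; exists d => // x y Ax xy.
by apply: hd => //; apply/rV_ballP.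
Qed.

Section shell_average.
Variables (R : realType) (m : nat).
Local Notation V := (lebesgue_rV R m).
Local Notation S := (@esphere R m).
Variable sigma : {measure set 'rV[R]_m -> \bar R}.
Hypothesis sigma1 : sigma S = 1%E.
Hypothesis sigma_trans : forall z z', S z -> S z' -> exists f : lisom R m,
  f z = z' /\ forall A, measurable A -> A `<=` S -> sigma (f @^-1` A) = sigma A.

Lemma sphere_lty : (sigma S < +oo)%E. Proof. by rewrite sigma1 ltry. Qed.

(** Nothing is known of [sigma] off the sphere; its restriction to the sphere is a finite measure on
    the whole space, hence admissible in Tonelli's theorem. *)
Let mu : {finite_measure set 'rV[R]_m -> \bar R} :=
  mfrestr (@measurable_esphere R m) sphere_lty.

Let mu_sphere A : A `<=` S -> mu A = sigma A.
Proof. by move=> AS; rewrite /mu /= /mfrestr /mrestr setIidl. Qed.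

Lemma ge0_integral_mu_sphere (f : 'rV[R]_m -> \bar R) :
  (forall z, ~ S z -> f z = 0%E) ->
  (\int[mu]_z f z = \int[sigma]_(z in S) f z)%E.
Proof.
move=> f0; have mS := @measurable_esphere R m.
transitivity (\int[mu]_(z in S) f z)%E.
  rewrite [RHS]integral_mkcond; apply: eq_integral => z _; rewrite patchE.
  by case: ifPn => // /negP zS; rewrite f0// => /mem_set.
by apply: eq_measure_integral => A mA AS; exact: mu_sphere.
Qed.

Let cs e := cap_set (R := R) (m := m) e.
Let mcs e : measurable (cs e) := @measurable_cap_set R m e.

Lemma sphere_nonempty : exists z, S z.
Proof.
apply: contrapT => /forallNP h; have := sigma1.
rewrite (_ : S = set0) ?measure0; last by apply/seteqP; split=> // z /h.
by move/eqP; rewrite eq_sym onee_eq0.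
Qed.

Lemma mu_cap_const e x y : 0 < esq x -> 0 < esq y ->
  mu (xsection (cs e) x) = mu (xsection (cs e) y).
Proof.
move=> x0 y0.
have sec u : 0 < esq u -> xsection (cs e) u =
    [set z | S z /\ esq ((enorm u)^-1 *: u - z) < e ^+ 2].
  move=> u0; apply/seteqP; split=> z; rewrite /xsection /= in_setE /cs /cap_set /=;
  by rewrite cap_direction.
have [f [fxy fs]] := sigma_trans (esq_direction x0) (esq_direction y0).
rewrite !mu_sphere; [|by rewrite sec// => z []..].
rewrite -(fs (xsection _ y)); [|exact: measurable_xsection|by rewrite sec// => z []].
congr (sigma _); rewrite !sec// -fxy; apply/seteqP.
by split=> z /=; rewrite /esphere /= -lisomB !lisom_esq.
Qed.

(** The counterpart of [mu_cap_const] in the other variable: an isometry taking [z] to [z']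
    preserves Lebesgue measure and the radial weight. *)
Lemma radial_cap_const e (w : 'rV[R]_m -> \bar R) z z' : S z -> S z' ->
  measurable_fun [set: 'rV[R]_m] w -> (forall x, 0 <= w x)%E ->
  (forall x y, esq x = esq y -> w x = w y) ->
  (\int[V]_x (w x * (\1_(cs e) (x, z))%:E) = \int[V]_x (w x * (\1_(cs e) (x, z'))%:E))%E.
Proof.
move=> Sz Sz' mw w0 wr; have [f [fz _]] := sigma_trans Sz Sz'.
rewrite -[RHS](@ge0_integral_preserving _ _ _ V f).
- apply: eq_integral => x _; rewrite (wr (f x) x) ?lisom_esq//; congr (_ * _)%E.
  rewrite !indicE (_ : ((f x, z') \in cs e) = ((x, z) \in cs e))//.
  apply/idP/idP; rewrite !inE /cs /cap_set /= -fz cap_lisom /esphere /=;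
    by rewrite lisom_esq.
- exact: measurable_lisom.
- by move=> A mA; exact: lebesgue_rV_lisom.
- apply: emeasurable_funM => //; apply/measurable_EFinP.
  apply: measurableT_comp; first exact: measurable_indic.
  exact: measurable_pair2.
- by move=> x; rewrite mule_ge0// lee_fin.
Qed.

Lemma tonelli_radial_cap e (w : 'rV[R]_m -> R) :
  measurable_fun [set: 'rV[R]_m] w -> (forall x, 0 <= w x) ->
  (\int[V]_x ((w x)%:E * mu (xsection (cs e) x)) =
   \int[sigma]_(z in S) \int[V]_x ((w x)%:E * (\1_(cs e) (x, z))%:E))%E.
Proof.
move=> mw w0.
pose F (p : 'rV[R]_m * 'rV[R]_m) := ((w p.1)%:E * (\1_(cs e) p)%:E)%E.
have mF : measurable_fun setT F.
  apply: emeasurable_funM; apply/measurable_EFinP.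
    exact: measurableT_comp mw _.
  exact: measurable_indic.
have F0 p : (0 <= F p)%E by rewrite mule_ge0// lee_fin// w0.
have := @fubini_tonelli _ _ _ _ R V mu F mF F0.
rewrite /fubini_F /fubini_G [in X in _ = X]ge0_integral_mu_sphere => [<-|z Sz].
  apply: eq_integral => x _; rewrite /F /= ge0_integralZl//.
  - congr (_ * _)%E.
    exact: (esym (congr1 (@^~ x) (indic_fubini_tonelli_FE mu (mcs e)))).
  - apply/measurable_EFinP; apply: measurableT_comp; first exact: measurable_indic.
    exact: measurable_pair1.
  - by rewrite lee_fin w0.
rewrite integral0_eq// => x _; rewrite /F indicE memNset ?mule0//.
by case.
Qed.


(** If the caps were null, the indicator of the shell [1/4 < |x|^2 < 1] would have integral 0 over
    the pairs of [cap_set]. In the other order the integral is at least the Lebesgue measure of an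
    open set, nonempty because it contains [(3/4) z0]. *)
Lemma mu_cap_gt0 e : 0 < e -> exists2 l : R, 0 < l &
  forall x, 0 < esq x -> mu (xsection (cs e) x) = l%:E.
Proof.
move=> e0; have [q1 q2] : (3/4 : R) ^+ 2 < 1 /\ 1/4 < (3/4 : R) ^+ 2 by split; lra.
have [z0 Sz0] := sphere_nonempty.
have z01 : 0 < esq z0 by rewrite Sz0.
have muE x : 0 < esq x -> mu (xsection (cs e) x) = mu (xsection (cs e) z0).
  by move=> x0; exact: mu_cap_const.
have fin : mu (xsection (cs e) z0) \is a fin_num.
  by apply: fin_num_measure; exact: measurable_xsection.
exists (fine (mu (xsection (cs e) z0))); last by move=> x /muE ->; rewrite fineK.
rewrite lt_neqAle fine_ge0 ?measure_ge0// andbT eq_sym; apply/eqP => l0.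
have {}l0 : mu (xsection (cs e) z0) = 0%E by rewrite -(fineK fin) l0.
pose A : set 'rV[R]_m := eball 1 `&` [set x | 1/4 < esq x].
have oA : open A.
  apply: openI; first exact: eball_open.
  apply: (@open_comp _ _ (@esq R m) [set t | 1/4 < t]); last exact: open_gt.
  by move=> x _; exact: continuous_esq.
have mA : measurable A by exact: open_measurable_rV.
have mw : measurable_fun [set: 'rV[R]_m] (\1_A : _ -> R) by exact: measurable_indic.
have w0 x : 0 <= (\1_A x : R) by rewrite indicE.
have wr x y : esq x = esq y -> (\1_A x)%:E = (\1_A y)%:E :> \bar R.
  move=> xy; rewrite !indicE (_ : (x \in A) = (y \in A))//.
  by apply/idP/idP; rewrite !inE /A /eball /= xy.
have := @tonelli_radial_cap e \1_A mw w0.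
rewrite integral0_eq; last first.
  move=> x _; have [[_ x0]|xA] := pselect (A x); last by rewrite indicE memNset// mul0e.
  by rewrite muE ?l0 ?mule0// (lt_trans _ x0)// divr_gt0.
rewrite (eq_integral (fun=> \int[V]_x ((\1_A x)%:E * (\1_(cs e) (x, z0))%:E)))%E; last first.
  move=> z; rewrite inE => Sz; apply: (@radial_cap_const e (fun x => (\1_A x)%:E) _ _ Sz Sz0) => //.
  exact/measurable_EFinP.
rewrite integral_cst; last exact: measurable_esphere.
rewrite sigma1 mule1 => V0; suff : (0 < \int[V]_x ((\1_A x)%:E * (\1_(cs e) (x, z0))%:E))%E.
  by move=> /lt_eqF/eqP; apply; exact: V0.
have mAc : measurable (A `&` [set x | cap e x z0]).
  by apply: open_measurable_rV; exact: cap_open.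
apply: (@lt_le_trans _ _ (V (A `&` [set x | cap e x z0]))).
  apply: lebesgue_rV_open_gt0; first exact: cap_open.
  exists ((3/4) *: z0); rewrite /A /eball /cap /enorm /= esqZ Sz0 mulr1.
  rewrite sqrtr_sqr ger0_norm; last by rewrite divr_ge0.
  by rewrite subrr esq0 mulr_gt0 ?exprn_gt0.
rewrite -[leLHS]mul1e -integral_cst//.
rewrite integral_mkcond; apply: ge0_le_integral => //.
- by move=> x _; rewrite patchE; case: ifPn.
- exact: ((measurable_restrictT _ mAc).1 (measurable_cst _)).
- apply: emeasurable_funM => //; apply/measurable_EFinP => //.
  apply: measurableT_comp; first exact: measurable_indic.
  exact: measurable_pair2.
- move=> x _; rewrite patchE; case: ifPn => [|_]; last by rewrite mule_ge0// lee_fin.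
  by rewrite inE => -[Ax cx]; rewrite !indicE !mem_set ?mule1.
Qed.

(* Compare the integrals of [w x * h x] and of [w x * h (r z)] over the pairs
   [(x, z)] such that [cap e x z]. *)
Lemma shell_average_core e eta M r (w h : 'rV[R]_m -> R) : 0 < e -> 0 <= eta ->
  V.-integrable setT (EFin \o w) -> (forall x, 0 <= w x) ->
  (forall x y, esq x = esq y -> w x = w y) ->
  (forall x, w x != 0 -> 0 < esq x) ->
  measurable_fun [set: 'rV[R]_m] h -> (forall x, `|h x| <= M) ->
  (forall x z, w x != 0 -> S z -> cap e x z -> `|h x - h (r *: z)| <= eta) ->
  `|\int[V]_x (w x * h x) - \int[V]_x w x * \int[sigma]_(z in S) h (r *: z)|
    <= eta * \int[V]_x w x.
Proof.
move=> e0 eta0 iw w0 wr wx mh hM hw.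
have [l l0 muE] := mu_cap_gt0 e0.
have mS := @measurable_esphere R m.
have [z0 Sz0] := sphere_nonempty.
have M0 : 0 <= M := le_trans (normr_ge0 _) (hM 0).
have mw : measurable_fun [set: 'rV[R]_m] w by apply/measurable_EFinP; case/integrableP: iw.
have mcsz z : measurable_fun [set: 'rV[R]_m] (fun x => \1_(cs e) (x, z) : R).
  apply: measurableT_comp; first exact: measurable_indic.
  exact: measurable_pair2.
have wl x : ((w x)%:E * mu (xsection (cs e) x) = (l * w x)%:E)%E.
  have [wx0|/wx/muE ->] := eqVneq (w x) 0; first by rewrite wx0 mul0e mulr0.
  by rewrite mulrC.
have EI (f : 'rV[R]_m -> R) : V.-integrable setT (EFin \o f) ->
    (\int[V]_x (f x)%:E = (\int[V]_x f x)%:E)%E.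
  by move=> fi; rewrite /Rintegral fineK//; exact: integrable_fin_num.
set W := \int[V]_x w x; set c := \int[sigma]_(z in S) h (r *: z).
(* By [radial_cap_const] the left side is constant in [z], so it equals its [sigma]-mean, which
   Tonelli's theorem evaluates as [l * W]. *)
have kE z : S z -> (\int[V]_x ((w x)%:E * (\1_(cs e) (x, z))%:E) = (l * W)%:E)%E.
  move=> Sz; have := @tonelli_radial_cap e w mw w0.
  under eq_integral do rewrite wl.
  rewrite EI ?RintegralZl//; last exact: integrable_EFinZ.
  move=> ->; rewrite [RHS](eq_integral (cst (\int[V]_x ((w x)%:E * (\1_(cs e) (x, z))%:E))%E)).
    by rewrite [RHS]integral_cst// sigma1 mule1.
  move=> z'; rewrite inE => Sz'.
  apply: (@radial_cap_const e (EFin \o w) _ _ Sz' Sz); first exact/measurable_EFinP.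
    by move=> x; rewrite lee_fin.
  by move=> x y /wr /= ->.
(* The shift by [N] makes [h x] and even [h (r *: z) - eta] nonnegative, so that Tonelli's theorem
   for nonnegative functions applies; its contribution [N * W] cancels at the end. *)
pose N := M + eta.
have hN x : 0 <= h x + N.
  by have := hM x; rewrite /N ler_norml => /andP[+ _]; lra.
have bh : [bounded h x | x in setT].
  by exists M; split; [exact: num_real|move=> y My x _; apply: le_trans (hM x) _; exact: ltW].
have iwh : V.-integrable setT (EFin \o (fun x => w x * h x)).
  rewrite (_ : EFin \o _ = (fun x => (h x)%:E * (w x)%:E)%E); last first.
    by apply/funext => x; rewrite /= mulrC.
  exact: integrableMr.
pose H x := w x * h x + N * w x.
have HE x : H x = w x * (h x + N) by rewrite /H mulrDr (mulrC N).
have H0 x : 0 <= H x by rewrite HE mulr_ge0.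
have iH : V.-integrable setT (EFin \o H).
  by apply: integrable_EFinD => //; exact: integrable_EFinZ.
have mH : measurable_fun [set: 'rV[R]_m] H by apply/measurable_EFinP; case/integrableP: iH.
have mrz : measurable_fun [set: 'rV[R]_m] (fun z => r *: z).
  by apply: measurable_linear_rV => [x y|t x]; rewrite ?scalerDr// !scalerA mulrC.
have ihr : sigma.-integrable S (EFin \o (fun z => h (r *: z))).
  apply: measurable_bounded_integrable; [exact: mS|exact: sphere_lty| |].
    by apply: measurable_funTS; exact: measurableT_comp.
  by exists M; split; [exact: num_real|move=> y My x _; apply: le_trans (hM _) _; exact: ltW].
have ics k : sigma.-integrable S (EFin \o cst k).
  apply: (measurable_bounded_integrable (f := cst k) mS sphere_lty) => //.
  by exists `|k|; split; [exact: num_real|move=> y ky x _; exact: ltW].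
have outer k : (\int[sigma]_(z in S) ((l * W) * (h (r *: z) + k))%:E =
    ((l * W) * (c + k))%:E)%E.
  have ihk : sigma.-integrable S (EFin \o (fun z => h (r *: z) + k)).
    exact: (integrable_EFinD mS ihr (ics k)).
  have -> : (\int[sigma]_(z in S) ((l * W) * (h (r *: z) + k))%:E)%E =
      (\int[sigma]_(z in S) ((l * W) * (h (r *: z) + k)))%:E.
    by rewrite /Rintegral fineK//; apply: integrable_fin_num => //; exact: integrable_EFinZ.
  rewrite RintegralZl// (RintegralD mS ihr (ics k)) Rintegral_cst//.
  by rewrite sigma1 mulr1.
pose I z := (\int[V]_x ((H x)%:E * (\1_(cs e) (x, z))%:E))%E.
have mI : measurable_fun [set: 'rV[R]_m] I.
  pose F (p : 'rV[R]_m * 'rV[R]_m) := ((H p.1)%:E * (\1_(cs e) p)%:E)%E.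
  apply: (@measurable_fun_fubini_tonelli_G _ _ _ _ R V F) => [|p].
    apply: emeasurable_funM; apply/measurable_EFinP.
      exact: measurableT_comp mH _.
    exact: measurable_indic.
  by rewrite mule_ge0// lee_fin.
have I0 z : (0 <= I z)%E by apply: integral_ge0 => x _; rewrite mule_ge0// lee_fin.
have mwcs z k : measurable_fun [set: 'rV[R]_m]
    (fun x => k%:E * ((w x)%:E * (\1_(cs e) (x, z))%:E))%E.
  by apply: emeasurable_funM => //; apply: emeasurable_funM; apply/measurable_EFinP.
have mHcs z : measurable_fun [set: 'rV[R]_m] (fun x => (H x)%:E * (\1_(cs e) (x, z))%:E)%E.
  by apply: emeasurable_funM; apply/measurable_EFinP.
have kI z k : S z -> 0 <= k ->
    (\int[V]_x (k%:E * ((w x)%:E * (\1_(cs e) (x, z))%:E)) = ((l * W) * k)%:E)%E.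
  move=> Sz k0; rewrite ge0_integralZl//.
  - by rewrite kE// -EFinM mulrC.
  - by apply: emeasurable_funM; apply/measurable_EFinP.
  - by move=> x _; rewrite mule_ge0// lee_fin.
have hwz x z : S z -> cap e x z -> w x != 0 -> h (r *: z) - eta <= h x <= h (r *: z) + eta.
  by move=> Sz cz wx0; have := hw x z wx0 Sz cz; rewrite ler_distl.
have upI z : S z -> (I z <= ((l * W) * (h (r *: z) + (N + eta)))%:E)%E.
  move=> Sz; have k0 : 0 <= h (r *: z) + (N + eta) by rewrite addrA addr_ge0.
  rewrite -(kI z)//; apply: ge0_le_integral => //.
  - by move=> x _; rewrite mule_ge0// lee_fin.
  - move=> x _; rewrite muleA; have [csx|csx] := pselect (cs e (x, z)); last first.
      by rewrite indicE memNset// !mule0.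
    rewrite indicE mem_set// !mule1 lee_fin HE mulrC.
    have [->|wx0] := eqVneq (w x) 0; first by rewrite !mulr0.
    rewrite ler_wpM2r//.
    by case: csx => _ /(hwz _ _ Sz)/(_ wx0)/andP[]; lra.
have loI z : S z -> (((l * W) * (h (r *: z) + (N - eta)))%:E <= I z)%E.
  move=> Sz; have k0 : 0 <= h (r *: z) + (N - eta).
    by have := hM (r *: z); rewrite /N ler_norml => /andP[+ _]; lra.
  rewrite -(kI z)//; apply: ge0_le_integral => //.
  - by move=> x _; rewrite !mule_ge0// lee_fin.
  - move=> x _; rewrite muleA; have [csx|csx] := pselect (cs e (x, z)); last first.
      by rewrite indicE memNset// !mule0.
    rewrite indicE mem_set// !mule1 lee_fin HE mulrC.
    have [->|wx0] := eqVneq (w x) 0; first by rewrite !(mulr0, mul0r).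
    rewrite ler_wpM2l//.
    by case: csx => _ /(hwz _ _ Sz)/(_ wx0)/andP[]; lra.
have tI : (\int[sigma]_(z in S) I z = (l * (\int[V]_x (w x * h x) + N * W))%:E)%E.
  rewrite -tonelli_radial_cap//.
  rewrite (eq_integral (fun x => (l * H x)%:E)); last first.
    move=> x _; rewrite HE EFinM muleAC wl -EFinM; congr EFin; ring.
  rewrite EI; last exact: integrable_EFinZ.
  rewrite RintegralZl// RintegralD// ?RintegralZl//.
  exact: integrable_EFinZ.
have lW0 : 0 <= l * W by apply: mulr_ge0; [exact: ltW|exact: Rintegral_ge0].
have mout k : measurable_fun S (fun z => ((l * W) * (h (r *: z) + k))%:E).
  apply/measurable_EFinP; apply: measurable_funTS; apply: measurable_funM => //.
  by apply: measurable_funD => //; exact: measurableT_comp.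
have up : l * (\int[V]_x (w x * h x) + N * W) <= (l * W) * (c + (N + eta)).
  rewrite -lee_fin -tI -outer; apply: ge0_le_integral => //.
  exact: measurable_funTS.
have lo : (l * W) * (c + (N - eta)) <= l * (\int[V]_x (w x * h x) + N * W).
  rewrite -lee_fin -tI -outer; apply: ge0_le_integral => //.
  - move=> z _; rewrite lee_fin mulr_ge0//.
    by have := hM (r *: z); rewrite /N ler_norml => /andP[+ _]; lra.
  - exact: measurable_funTS.
rewrite -!mulrA !(ler_pM2l l0) in up lo.
by rewrite ler_norml; apply/andP; split; nra.
Qed.

Lemma measurable_closed_eball s : measurable [set x : 'rV[R]_m | esq x <= s].
Proof.
rewrite (_ : mkset _ = ~` [set x : 'rV[R]_m | s < esq x]); last first.
  by apply/seteqP; split=> x /=; rewrite leNgt => /negP.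
apply: measurableC; apply: open_measurable_rV.
apply: (@open_comp _ _ (@esq R m) [set t | s < t]); last exact: open_gt.
by move=> x _; exact: continuous_esq.
Qed.

(** The inner radius [a] is chosen before the weight and serves all radial weights on the shell at
    once, both the tents of shrinking width and the indicator of the shell. *)
Lemma shell_average (D : set 'rV[R]_m) (g : 'rV[R]_m -> R) r eta :
  open D -> (forall x, D x -> {for x, continuous g}) ->
  0 < r -> (forall x, esq x <= r ^+ 2 -> D x) -> 0 < eta ->
  exists a, [/\ 0 < a, a < r & forall w : 'rV[R]_m -> R,
    V.-integrable setT (EFin \o w) -> (forall x, 0 <= w x) ->
    (forall x y, esq x = esq y -> w x = w y) ->
    (forall x, w x != 0 -> a ^+ 2 <= esq x /\ esq x <= r ^+ 2) ->
    `|\int[V]_x (w x * g x) - \int[V]_x w x * \int[sigma]_(z in S) g (r *: z)|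
      <= eta * \int[V]_x w x].
Proof.
move=> oD cg r0 rD eta0; set C := [set x : 'rV[R]_m | esq x <= r ^+ 2].
have cgC x : C x -> {for x, continuous g} by move=> /rD; exact: cg.
have [d d0 hd] := compact_uniform_continuous (@compact_closed_eball R m (r ^+ 2)) cgC eta0.
have [M [M0 hM]] := bounded_on_closed_eball cg rD.
pose t := Num.min r d; have t0 : 0 < t by rewrite lt_min r0.
have tr : t <= r by rewrite ge_min lexx.
have td : t <= d by rewrite ge_min lexx orbT.
(* With these choices [e * r + (r - a) = t / 4 + t / 2 < d], so [cap_close] brings [x] and [r *: z]
   within the modulus of continuity of [g]. *)
pose a := r - t / 2; pose e := t / (4 * r).
have a0 : 0 < a by rewrite /a; lra.
have ar : a < r by rewrite /a; lra.
have e0 : 0 < e by rewrite divr_gt0// mulr_gt0.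
have er : e * r = t / 4 by rewrite /e; field; rewrite gt_eqF.
exists a; split=> // w iw w0 wr wC.
have rz z : S z -> C (r *: z) by move=> Sz; rewrite /C /= esqZ Sz mulr1.
(* Outside [D] nothing is known of [g]; extended by 0 from the closed ball it is bounded and
   measurable on the whole space. *)
pose h := g \_ C.
have hg x : C x -> h x = g x by move=> Cx; rewrite /h patchE mem_set.
have mC : measurable C by exact: measurable_closed_eball.
rewrite (eq_Rintegral _ (g := fun x : 'rV[R]_m => w x * h x)); last first.
  move=> x _; have [->|/wC[_ Cx]] := eqVneq (w x) 0; first by rewrite !mul0r.
  by rewrite hg.
rewrite [X in _ * X](eq_Rintegral _ (g := fun z : 'rV[R]_m => h (r *: z))); last first.
  by move=> z; rewrite inE => /rz Cz; rewrite hg.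
apply: (@shell_average_core e eta M) => //.
- exact: ltW.
- by move=> x /wC[ax _]; apply: lt_le_trans ax; rewrite exprn_gt0.
- apply: (measurable_restrictT _ mC).1.
  apply: measurable_funS (open_continuous_measurable_rV oD cg); last exact: rD.
  exact: open_measurable_rV.
- move=> x; rewrite /h patchE; case: ifPn => [|_]; last by rewrite normr0 ltW.
  by rewrite inE => /hM.
- move=> x z /wC[ax xr] Sz cz; rewrite !hg//; last exact: rz.
  apply/ltW/hd => // i.
  apply: le_lt_trans (cap_close (ltW e0) (ltW a0) (ltW ar) Sz ax xr cz i) _.
  by rewrite er /a; lra.
Qed.

End shell_average.

(** * The divergence theorem on balls *)

Section cutoff_weights.
Variable R : realType.
Implicit Types (s d y : R).

(* [cutoff s d] is a C^1 approximation of the indicator of [y < s], and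
   [- tent s d] is its derivative; both are one-sided second differences in [s]
   of powers of [max 0 (s - y)]. *)
Definition cutoff s d y : R :=
  (2 * d ^+ 2)^-1 * (Num.max 0 (s - y) ^+ 2 - 2 * Num.max 0 (s - d - y) ^+ 2
    + Num.max 0 (s - 2 * d - y) ^+ 2).

Definition tent s d y : R :=
  (d ^+ 2)^-1 * (Num.max 0 (s - y) - 2 * Num.max 0 (s - d - y)
    + Num.max 0 (s - 2 * d - y)).

Lemma cutoff_out s d y : 0 < d -> s <= y -> cutoff s d y = 0.
Proof.
move=> d0 sy; rewrite /cutoff !max_l; [|lra..].
by rewrite expr0n /= mulr0 subrr addr0 mulr0.
Qed.

Lemma cutoff_in s d y : 0 < d -> y <= s - 2 * d -> cutoff s d y = 1.
Proof.
move=> d0 sy; rewrite /cutoff !max_r; [|lra..].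
by field; rewrite gt_eqF.
Qed.

Lemma cutoff_bound s d y : 0 < d -> 0 <= cutoff s d y <= 1.
Proof.
move=> d0; have d2 : 0 < 2 * d ^+ 2 by rewrite mulr_gt0 ?exprn_gt0.
rewrite /cutoff -(ler_pM2l d2) -[X in _ && X](ler_pM2l d2) mulr0 mulr1 mulVKf ?gt_eqF//.
have [h1|h1] := leP 0 (s - y); have [h2|h2] := leP 0 (s - d - y);
  have [h3|h3] := leP 0 (s - 2 * d - y); apply/andP; split; nra.
Qed.

Lemma tent_ge0 s d y : 0 < d -> 0 <= tent s d y.
Proof.
move=> d0; apply: mulr_ge0; first by rewrite invr_ge0 exprn_ge0// ltW.
have [h1|h1] := leP 0 (s - y); have [h2|h2] := leP 0 (s - d - y);
  have [h3|h3] := leP 0 (s - 2 * d - y); lra.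
Qed.

Lemma tent_support s d y : 0 < d -> tent s d y != 0 -> s - 2 * d <= y /\ y <= s.
Proof.
move=> d0; have [ys|ys] := leP (s - 2 * d) y; have [sy|sy] := leP y s => //.
- by rewrite /tent !max_l; [|lra..]; rewrite mulr0 subrr addr0 mulr0 eqxx.
- rewrite /tent !max_r; [|lra..].
  by rewrite (_ : _ + _ = 0); [rewrite mulr0 eqxx|ring].
- by exfalso; lra.
Qed.

End cutoff_weights.

Section integral_cutoff_tent.
Variables (R : realType) (m : nat) (D : set 'rV[R]_m) (s : R).
Variables X X' : 'I_m -> 'rV[R]_m -> R.
Local Notation V := (lebesgue_rV R m).
Hypotheses (oD : open D) (sD : forall x, esq x <= s -> D x).
Hypothesis cX : forall k x, D x -> {for x, continuous (X k)}.
Hypothesis cX' : forall k x, D x -> {for x, continuous (X' k)}.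
Hypothesis dX : forall k x, D x ->
  is_derive x (delta_mx ord0 k : 'rV[R]_m) (X k) (X' k x).

Lemma integrable_max0X n t (f : 'rV[R]_m -> R) : t <= s ->
  (forall x, D x -> {for x, continuous f}) ->
  V.-integrable setT (EFin \o (fun x => Num.max 0 (t - esq x) ^+ n.+1 * f x)).
Proof.
move=> ts cf; apply: (compact_support_integrable oD sD) => x.
  move=> Dx; apply: for_continuousM; last exact: cf.
  by apply: for_continuousX; exact: continuous_cutoff.
by move=> sx; rewrite max_l ?expr0n ?mul0r//; lra.
Qed.

Lemma Rintegral_comb3 d (T : measurableType d) (mu : {measure set T -> \bar R})
    (c : R) (f g h : T -> R) :
  mu.-integrable setT (EFin \o f) -> mu.-integrable setT (EFin \o g) ->
  mu.-integrable setT (EFin \o h) ->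
  \int[mu]_x (c * (f x - 2 * g x + h x)) =
  c * (\int[mu]_x f x - 2 * \int[mu]_x g x + \int[mu]_x h x).
Proof.
move=> fi gi hi; have gi2 := integrable_EFinZ measurableT 2 gi.
have fgi := integrable_EFinB measurableT fi gi2.
rewrite RintegralZl//; last exact: integrable_EFinD.
by rewrite RintegralD// RintegralB// RintegralZl.
Qed.

(** The second difference of [integral_cutoff_divergence], taken at [s], [s - d] and [s - 2 d]; the
    normalizations [2 d^2] and [d^2] turn the factor 4 into 2. *)
Lemma integral_cutoff_tent d : 0 < d ->
  \int[V]_x (cutoff s d (esq x) * \sum_k X' k x) =
  2 * \int[V]_x (tent s d (esq x) * \sum_k x ord0 k * X k x).
Proof.
move=> d0; have s1 : s - d <= s by lra.
have s2 : s - 2 * d <= s by lra.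
pose f x := \sum_k X' k x; pose g (x : 'rV[R]_m) := \sum_k x ord0 k * X k x.
have cf x : D x -> {for x, continuous f}.
  by move=> Dx; apply: for_continuous_sum => k; exact: cX'.
have cg x : D x -> {for x, continuous g}.
  move=> Dx; apply: for_continuous_sum => k.
  by apply: for_continuousM; [exact: for_continuous_coord|exact: cX].
have id t : t <= s -> \int[V]_x (Num.max 0 (t - esq x) ^+ 2 * f x) =
    4 * \int[V]_x (Num.max 0 (t - esq x) ^+ 1 * g x).
  move=> ts; apply: (integral_cutoff_divergence oD _ cX cX' dX) => x xt.
  by apply: sD; exact: le_trans xt ts.
transitivity (\int[V]_x ((2 * d ^+ 2)^-1 * (Num.max 0 (s - esq x) ^+ 2 * f x -
    2 * (Num.max 0 (s - d - esq x) ^+ 2 * f x) +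
    Num.max 0 (s - 2 * d - esq x) ^+ 2 * f x))).
  by apply: eq_Rintegral => x _; rewrite /cutoff -/(f x); ring.
transitivity (2 * \int[V]_x ((d ^+ 2)^-1 * (Num.max 0 (s - esq x) ^+ 1 * g x -
    2 * (Num.max 0 (s - d - esq x) ^+ 1 * g x) +
    Num.max 0 (s - 2 * d - esq x) ^+ 1 * g x))); last first.
  by congr (_ * _); apply: eq_Rintegral => x _; rewrite /tent -/(g x); ring.
rewrite !Rintegral_comb3 ?id//; try exact: integrable_max0X.
by field; rewrite gt_eqF.
Qed.

End integral_cutoff_tent.

Section ball_divergence.
Variables (R : realType) (m : nat).
Local Notation V := (lebesgue_rV R m).
Local Notation S := (@esphere R m).
Variable sigma : {measure set 'rV[R]_m -> \bar R}.
Hypothesis sigma1 : sigma S = 1%E.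
Hypothesis sigma_trans : forall z z', S z -> S z' -> exists f : lisom R m,
  f z = z' /\ forall A, measurable A -> A `<=` S -> sigma (f @^-1` A) = sigma A.
Variables (D : set 'rV[R]_m) (r : R).
Hypotheses (oD : open D) (r0 : 0 < r) (rD : forall x, esq x <= r ^+ 2 -> D x).

Lemma cvg_integral_cutoff (f : 'rV[R]_m -> R) (d : nat -> R) :
  (forall x, D x -> {for x, continuous f}) ->
  (forall n, 0 < d n) -> d n @[n --> \oo] --> 0 ->
  \int[V]_x (cutoff (r ^+ 2) (d n) (esq x) * f x) @[n --> \oo] -->
  \int[V]_(x in eball (r ^+ 2)) f x.
Proof.
move=> cf d0 dcvg; set s := r ^+ 2.
have [M [M0 hM]] := bounded_on_closed_eball cf rD.
have mB : measurable (@eball R m s) by exact: measurable_eball.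
have mf : measurable_fun (@eball R m s) f.
  apply: measurable_funS (open_continuous_measurable_rV oD cf).
    exact: open_measurable_rV.
  by move=> x /ltW; exact: rD.
pose F n x := cutoff s (d n) (esq x) * f x.
have mF n : measurable_fun (@eball R m s) (F n).
  apply: measurable_funM => //; apply: measurable_funTS.
  rewrite /cutoff; apply: measurable_funM => //.
  have mm t : measurable_fun [set: 'rV[R]_m] (fun x => Num.max 0 (t - esq x) ^+ 2).
    apply: measurable_funX; apply: open_continuous_measurable_rV; first exact: openT.
    by move=> x _; exact: continuous_cutoff.
  by apply: measurable_funD => //; apply: measurable_funB => //; exact: measurable_funM.
have FM n x : eball s x -> `|F n x| <= M.
  move=> xs; rewrite /F normrM -[leRHS]mul1r.
  have /andP[c0 c1] := cutoff_bound s (esq x) (d0 n).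
  by apply: ler_pM => //; [rewrite ger0_norm|apply: hM; exact: ltW].
have := @dominated_convergence _ _ _ V _ mB (fun n => EFin \o F n) (EFin \o f) (cst M%:E).
case.
- by move=> n; exact/measurable_EFinP.
- exact/measurable_EFinP.
- apply: aeW => x xs; apply/fine_cvgP; split; first exact: nearW.
  apply: cvg_near_cst; have ds : 0 < (s - esq x) / 2 by rewrite divr_gt0// subr_gt0.
  near=> n; rewrite /= /F cutoff_in ?mul1r//.
  suff : d n <= (s - esq x) / 2 by lra.
  by near: n; apply: (cvgr_le _ dcvg).
- apply/integrableP; split; first exact: measurable_cst.
  under eq_integral do rewrite /= gtr0_norm//.
  by rewrite integral_cst// lte_mul_pinfty ?lee_fin ?ltW// lebesgue_rV_eball_lty.
- by apply: aeW => x n xs; rewrite /= lee_fin; exact: FM.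
move=> fi _ cvgF.
have fE : (\int[V]_(x in eball s) (EFin \o f) x = (\int[V]_(x in eball s) f x)%:E)%E.
  by rewrite /Rintegral fineK//; exact: integrable_fin_num.
move: cvgF; rewrite fE => /fine_cvgP[_ cvgF].
rewrite (_ : (fun n => _) = fine \o (fun n => \int[V]_(x in eball s) (EFin \o F n) x)%E)//.
apply/funext => n; rewrite /= -/(Rintegral V (eball s) (F n)) Rintegral_mkcond.
apply: eq_Rintegral => x _; rewrite patchE; case: ifPn => // /negP xs.
by rewrite cutoff_out ?mul0r// leNgt; apply/negP => /mem_set.
Unshelve. all: by end_near. Qed.

Lemma integrable_tent d : 0 < d ->
  V.-integrable setT (EFin \o (fun x => tent (r ^+ 2) d (esq x))).
Proof.
move=> d0; have i1 t : t <= r ^+ 2 ->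
    V.-integrable setT (EFin \o (fun x => Num.max 0 (t - esq x) ^+ 1 * 1)).
  move=> tr; apply: (integrable_max0X oD rD) => // x _.
  exact: for_continuous_cst.
have := integrable_EFinZ measurableT (d ^+ 2)^-1 (integrable_EFinD measurableT
  (integrable_EFinB measurableT (i1 (r ^+ 2) _)
    (integrable_EFinZ measurableT 2 (i1 (r ^+ 2 - d) _))) (i1 (r ^+ 2 - 2 * d) _)).
rewrite (_ : (fun x => _) = (fun x => tent (r ^+ 2) d (esq x))); first by apply; lra.
by apply/funext => x; rewrite /tent !mulr1 !expr1.
Qed.

(** [X'] lists the diagonal partial derivatives, [X' k] being the [k]-th partial derivative of
    [X k]: those that enter the divergence. *)
Definition C1_field (X X' : 'I_m -> 'rV[R]_m -> R) :=
  [/\ forall k x, D x -> {for x, continuous (X k)},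
      forall k x, D x -> {for x, continuous (X' k)} &
      forall k x, D x -> is_derive x (delta_mx ord0 k : 'rV[R]_m) (X k) (X' k x)].

(** The tent lives on [r^2 - 2 d <= |x|^2 <= r^2], which lies in the shell of [shell_average] as
    soon as [2 d <= r^2 - a^2]. The mass of the tent is not evaluated; [ball_divergence] eliminates
    it. *)
Lemma cutoff_flux (X X' : 'I_m -> 'rV[R]_m -> R) (d : nat -> R) eta :
  C1_field X X' -> (forall n, 0 < d n) -> d n @[n --> \oo] --> 0 -> 0 < eta ->
  \forall n \near \oo,
  `|\int[V]_x (cutoff (r ^+ 2) (d n) (esq x) * \sum_k X' k x) -
    2 * (\int[V]_x tent (r ^+ 2) (d n) (esq x) *
         \int[sigma]_(z in S) \sum_k (r *: z) ord0 k * X k (r *: z))| <=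
  2 * (eta * \int[V]_x tent (r ^+ 2) (d n) (esq x)).
Proof.
move=> [cX cX' dX] d0 dcvg eta0.
have cg x : D x -> {for x, continuous (fun x : 'rV[R]_m => \sum_k x ord0 k * X k x)}.
  move=> Dx; apply: for_continuous_sum => k.
  by apply: for_continuousM; [exact: for_continuous_coord|exact: cX].
have [a [a0 ar ha]] := shell_average sigma1 sigma_trans oD cg r0 rD eta0.
have ar2 : 0 < (r ^+ 2 - a ^+ 2) / 2 by nra.
near=> n; rewrite (integral_cutoff_tent oD rD cX cX' dX (d0 n)) -mulrBr normrM.
rewrite ger0_norm// ler_wpM2l//; apply: ha.
- exact: integrable_tent.
- by move=> x; exact: tent_ge0.
- by move=> x y ->.
- move=> x /(tent_support (d0 n))[h1 h2]; split=> //; apply: le_trans h1.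
  suff : d n <= (r ^+ 2 - a ^+ 2) / 2 by lra.
  by near: n; apply: (cvgr_le _ dcvg).
Unshelve. all: by end_near. Qed.

(* The constant relating the surface integral to [sigma] is found by applying
   the limiting argument to the field [X k x = x_k] as well. *)
Lemma ball_divergence (X X' : 'I_m -> 'rV[R]_m -> R) : C1_field X X' ->
  r ^+ 2 * \int[V]_(x in eball (r ^+ 2)) \sum_k X' k x =
  (m%:R * fine (V (eball (r ^+ 2)))) *
    \int[sigma]_(z in S) \sum_k (r *: z) ord0 k * X k (r *: z).
Proof.
move=> C1X; set s := r ^+ 2; have s0 : 0 < s by rewrite exprn_gt0.
set I := \int[V]_(x in eball s) _; set c := \int[sigma]_(z in S) _.
set J := m%:R * fine (V (eball s)).
pose Y (k : 'I_m) (x : 'rV[R]_m) := x ord0 k.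
have C1Y : C1_field Y (fun _ => cst 1).
  split=> [k x _|k x _|k x _]; first exact: for_continuous_coord.
    exact: for_continuous_cst.
  apply/is_derive_line0; apply: (@is_derive_quadratic _ _ _ _ 0) => h.
  by rewrite /Y !mxE !eqxx /= [X in `|X|](_ : _ = 0) ?normr0 ?mul0r//; ring.
pose d (n : nat) : R := n.+1%:R^-1.
have d0 n : 0 < d n by rewrite invr_gt0.
have dcvg : d n @[n --> \oo] --> 0 by exact: cvg_harmonic.
pose b n := \int[V]_x tent s (d n) (esq x).
have b0 n : 0 <= b n by apply: Rintegral_ge0 => x _; exact: tent_ge0.
pose P n := \int[V]_x (cutoff s (d n) (esq x) * \sum_k X' k x).
pose Q n := \int[V]_x (cutoff s (d n) (esq x) * m%:R).
have [cX cX' dX] := C1X.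
have PI : P n @[n --> \oo] --> I.
  by apply: cvg_integral_cutoff => // x Dx; apply: for_continuous_sum => k; exact: cX'.
have QJ : Q n @[n --> \oo] --> J.
  have := @cvg_integral_cutoff (cst m%:R) d (fun x _ => @for_continuous_cst _ _ _ x) d0 dcvg.
  by rewrite Rintegral_cst//; exact: measurable_eball.
have QY n : Q n = \int[V]_x (cutoff s (d n) (esq x) * \sum_(k < m) 1).
  by apply: eq_Rintegral => x _; rewrite sumr_const card_ord.
have fluxY : \int[sigma]_(z in S) \sum_k (r *: z) ord0 k * Y k (r *: z) = s.
  rewrite (eq_Rintegral _ (g := cst s)).
    by rewrite Rintegral_cst ?sigma1 ?mulr1//; exact: measurable_esphere.
  move=> z; rewrite inE => Sz; rewrite -[RHS]mulr1 -Sz -esqZ.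
  by apply: eq_bigr => k _; rewrite expr2.
suff T0 : s * P n - Q n * c @[n --> \oo] --> (0 : R).
  apply/eqP; rewrite -subr_eq0; apply/eqP; apply: cvg_unique T0 => //.
  by apply: cvgB; apply: cvgM => //; exact: cvg_cst.
apply/cvgrPdist_le => /= e e0.
pose K := 2 * (s + `|c|) * ((J + 1) / s); have K0 : 0 <= K.
  have J0 : 0 <= J by rewrite mulr_ge0// fine_ge0// measure_ge0.
  by rewrite /K mulr_ge0 ?divr_ge0 ?mulr_ge0 ?addr_ge0// ltW.
(* The bound [s / 2] lets the estimate for [Y] control the mass [b n] by [(J + 1) / s]; the other
   bound keeps the final error [eta * K] below [e]. *)
pose eta := Num.min (s / 2) (e / (K + 1)).
have eta0 : 0 < eta by rewrite lt_min !divr_gt0// ltr_wpDl.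
have eta1 : eta <= s / 2 by rewrite ge_min lexx.
have eta2 : eta * K <= e.
  have : eta <= e / (K + 1) by rewrite ge_min lexx orbT.
  rewrite ler_pdivlMr ?ltr_wpDl// mulrDr mulr1; lra.
near=> n.
have hP : `|P n - 2 * (b n * c)| <= 2 * (eta * b n).
  by near: n; exact: cutoff_flux.
have hQ : `|Q n - 2 * (b n * s)| <= 2 * (eta * b n).
  near: n; have := cutoff_flux C1Y d0 dcvg eta0; rewrite fluxY.
  by apply: filterS => n; rewrite QY.
have QJ1 : Q n <= J + 1 by near: n; apply: (cvgr_le _ QJ); rewrite ltrDl.
have {}hb : b n <= (J + 1) / s.
  rewrite ler_pdivlMr//; move: hQ; rewrite ler_norml => /andP[hQ _].
  have := b0 n; nra.
rewrite sub0r normrN.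
(* The mass [b n] of the tent cancels in this combination of the two estimates. *)
rewrite (_ : _ - _ = (P n - 2 * (b n * c)) * s - (Q n - 2 * (b n * s)) * c); last by ring.
apply: le_trans (ler_normB _ _) _.
rewrite [X in X + _]normrM [X in _ + X]normrM (gtr0_norm s0).
have c0 := normr_ge0 c.
have h1 := ler_wpM2r (ltW s0) hP; have h2 := ler_wpM2r c0 hQ.
apply: le_trans (lerD h1 h2) _; rewrite -mulrDr; apply: le_trans eta2.
rewrite /K [leLHS](_ : _ = eta * (2 * (s + `|c|)) * b n); last by ring.
by rewrite [leRHS]mulrA ler_wpM2l// !mulr_ge0 ?addr_ge0// ltW.
Unshelve. all: by end_near. Qed.

End ball_divergence.

Lemma Rintegral_indicM (d : measure_display) (T : measurableType d) (R : realType)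
    (mu : {measure set T -> \bar R}) (B : set T) (f : T -> R) :
  \int[mu]_x (\1_B x * f x) = \int[mu]_(x in B) f x.
Proof.
rewrite [RHS]Rintegral_mkcond; apply: eq_Rintegral => x _.
by rewrite patchE indicE; case: (x \in B); rewrite ?mul1r ?mul0r.
Qed.

Section tangential_flux.
Variables (R : realType) (m : nat).
Local Notation V := (lebesgue_rV R m).
Local Notation S := (@esphere R m).
Variable sigma : {measure set 'rV[R]_m -> \bar R}.
Hypothesis sigma1 : sigma S = 1%E.
Hypothesis sigma_trans : forall z z', S z -> S z' -> exists f : lisom R m,
  f z = z' /\ forall A, measurable A -> A `<=` S -> sigma (f @^-1` A) = sigma A.
Variables (D : set 'rV[R]_m) (r : R).
Hypotheses (oD : open D) (r0 : 0 < r) (rD : forall x, esq x <= r ^+ 2 -> D x).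

Lemma fine_lebesgue_eball t : 0 < t ->
  fine (V (eball (t ^+ 2))) = t ^+ m * fine (V (eball 1)).
Proof.
by move=> t0; rewrite -[t ^+ 2]mulr1 lebesgue_rV_eball_scale// fineM// ge0_fin_numE
  ?measure_ge0// lebesgue_rV_eball_lty.
Qed.

(* The divergence of a field tangent to the spheres has integral 0 over every
   centred ball, hence over every centred shell. *)
Lemma tangential_flux_eq0 (X X' : 'I_m -> 'rV[R]_m -> R) : (0 < m)%N ->
  C1_field D X X' ->
  (forall x, D x -> \sum_k x ord0 k * X k x = 0) ->
  \int[sigma]_(z in S) \sum_k X' k (r *: z) = 0.
Proof.
move=> m0 C1X X0; have [cX cX' dX] := C1X.
pose g x := \sum_k X' k x.
have cg x : D x -> {for x, continuous g}.
  by move=> Dx; apply: for_continuous_sum => k; exact: cX'.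
have g0 t : 0 < t -> t <= r -> \int[V]_(x in eball (t ^+ 2)) g x = 0.
  move=> t0 tr; have tD x : esq x <= t ^+ 2 -> D x.
    by move=> xt; apply: rD; apply: le_trans xt _; rewrite ler_pXn2r// nnegrE ltW.
  have := ball_divergence sigma1 sigma_trans oD t0 tD C1X.
  rewrite [X in _ = _ * X](eq_Rintegral _ (g := cst 0)); last first.
    move=> z; rewrite inE => Sz; apply: X0; apply: tD.
    by rewrite esqZ Sz mulr1.
  rewrite Rintegral_cst; last exact: measurable_esphere.
  by rewrite mul0r mulr0 => /eqP; rewrite mulf_eq0 expf_eq0/= gt_eqF//= => /eqP.
set c := \int[sigma]_(z in S) _; have c_small eta : 0 < eta -> `|c| <= eta.
  move=> eta0.
  have [a [a0 ar ha]] := shell_average sigma1 sigma_trans oD cg r0 rD eta0.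
  have iI t (f : 'rV[R]_m -> R) : 0 < t -> t <= r ->
      (forall x, D x -> {for x, continuous f}) ->
      V.-integrable setT (EFin \o (fun x => \1_(eball (t ^+ 2)) x * f x)).
    move=> t0 tr cf; have [M [M0 hM]] := bounded_on_closed_eball cf rD.
    have tr2 : t ^+ 2 <= r ^+ 2 by rewrite ler_pXn2r// nnegrE ltW.
    have bD : @eball R m (t ^+ 2) `<=` [set x | esq x <= r ^+ 2].
      by move=> x xt; apply: le_trans tr2; exact: ltW.
    apply: (@integrable_eball_support _ _ (t ^+ 2) _ M).
    - apply: (@eq_measurable_fun _ _ _ _ _ (f \_ (eball (t ^+ 2)))).
        move=> x _; rewrite patchE indicE.
        by case: (x \in eball _); rewrite ?mul1r ?mul0r.
      apply: (measurable_restrictT _ (@measurable_eball _ _ _)).1.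
      apply: measurable_funS (open_continuous_measurable_rV oD cf).
        exact: open_measurable_rV.
      by move=> x /bD; exact: rD.
    - move=> x; have [xt|xt] := pselect (eball (t ^+ 2) x).
        by rewrite indicE mem_set// mul1r; apply: hM; exact: bD.
      by rewrite indicE memNset// mul0r normr0 ltW.
    - by move=> x xt; rewrite indicE memNset// mul0r.
  (* The indicator of [a^2 <= |x|^2 < r^2]: [w * g] has integral 0 as a difference of integrals over
     balls, while the integral of [w] is positive and divides out of the estimate. *)
  pose w (x : 'rV[R]_m) : R := \1_(eball (r ^+ 2)) x - \1_(eball (a ^+ 2)) x.
  pose one := fun _ : 'rV[R]_m => 1 : R.
  have c1 x : D x -> {for x, continuous one}.
    by move=> _; exact: for_continuous_cst.
  have int_w f : (forall x, D x -> {for x, continuous f}) ->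
      \int[V]_x (w x * f x) = \int[V]_(x in eball (r ^+ 2)) f x -
        \int[V]_(x in eball (a ^+ 2)) f x /\
      V.-integrable setT (EFin \o (fun x => w x * f x)).
    move=> cf; rewrite (_ : (fun x => w x * f x) = (fun x =>
      \1_(eball (r ^+ 2)) x * f x - \1_(eball (a ^+ 2)) x * f x)); last first.
      by apply/funext => x; rewrite /w mulrBl.
    have ir := iI r f r0 (lexx r) cf; have ia := iI a f a0 (ltW ar) cf.
    by rewrite RintegralB// !Rintegral_indicM; split=> //; exact: integrable_EFinB.
  have [intw1 iw1] := int_w one c1; have [intwg _] := int_w g cg.
  have w1 : (fun x => w x * one x) = w by apply/funext => x; rewrite mulr1.
  rewrite w1 in intw1 iw1.
  have wE x : w x = ((a ^+ 2 <= esq x < r ^+ 2)%R : bool)%:R.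
    have eballE t : (x \in @eball R m t) = (esq x < t).
      by apply/idP/idP; rewrite inE.
    rewrite /w !indicE !eballE.
    have ar2 : a ^+ 2 < r ^+ 2 by rewrite ltr_pXn2r// nnegrE ltW.
    have [xa|xa] := leP (a ^+ 2) (esq x); first by rewrite subr0.
    by rewrite (lt_trans xa ar2) /=; exact: subrr.
  have wpos : 0 < \int[V]_x w x.
    rewrite intw1 !Rintegral_cst; [|exact: measurable_eball..].
    rewrite !mul1r !fine_lebesgue_eball// -mulrBl mulr_gt0//.
      by rewrite subr_gt0 ltrXn2r ?nnegrE ?ltW// -lt0n.
    apply: fine_gt0; rewrite lebesgue_rV_eball_gt0//=.
    exact: lebesgue_rV_eball_lty.
  have := ha w iw1; rewrite intwg (g0 r r0 (lexx r)) (g0 a a0 (ltW ar)) !sub0r oppr0.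
  rewrite sub0r normrN normrM (gtr0_norm wpos) [eta * _]mulrC (ler_pM2l wpos); apply.
  - by move=> x; rewrite wE.
  - by move=> x y xy; rewrite !wE xy.
  - by move=> x; rewrite wE; case: andP => [[? /ltW]|]; rewrite ?eqxx.
apply/eqP; rewrite -normr_eq0 eq_le normr_ge0 andbT.
by apply/ler_addgt0Pl => eta /c_small; rewrite addr0.
Qed.

End tangential_flux.

(** * The invariant Laplacian in coordinates *)

Section chain_rule.
Variables (R : realType) (m : nat) (D : set 'rV[R]_m).
Variables (f : 'rV[R]_m -> R) (df : 'I_m -> 'rV[R]_m -> R).
Hypothesis dfD : forall k x, D x -> is_derive x (delta_mx ord0 k : 'rV[R]_m) f (df k x).

(** From [x] to [y] one coordinate at a time, with the mean value theorem on each segment. The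
    intermediate points depend on the coordinate but all lie in the box around [x] with half-sides
    [|y_i - x_i|]. *)
Lemma mvt_coordinates (x y : 'rV[R]_m) :
  (forall z : 'rV[R]_m, (forall i, `|z ord0 i - x ord0 i| <= `|y ord0 i - x ord0 i|) -> D z) ->
  exists xi : 'I_m -> 'rV[R]_m,
    (forall k i, `|xi k ord0 i - x ord0 i| <= `|y ord0 i - x ord0 i|) /\
    f y - f x = \sum_k df k (xi k) * (y ord0 k - x ord0 k).
Proof.
move=> boxD.
pose p (k : nat) : 'rV[R]_m := \row_i (if (i < k)%N then y ord0 i else x ord0 i).
have p0 : p 0%N = x by apply/rowP => i; rewrite mxE.
have pm : p m = y by apply/rowP => i; rewrite mxE ltn_ord.
have pS (k : 'I_m) : p k.+1 = p k + (y ord0 k - x ord0 k) *: delta_mx ord0 k.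
  apply/rowP => i; rewrite !mxE ltnS leq_eqVlt eqxx /=.
  have [->|ik] := eqVneq i k; first by rewrite ltnn mulr1 eqxx /=; ring.
  by rewrite mulr0 addr0 (inj_eq val_inj) (negbTE ik).
have boxp (k : 'I_m) u : `|u| <= `|y ord0 k - x ord0 k| -> forall i,
    `|(p k + u *: delta_mx ord0 k : 'rV[R]_m) ord0 i - x ord0 i| <=
    `|y ord0 i - x ord0 i|.
  move=> uk i; rewrite !mxE eqxx /=.
  have [->|ik] := eqVneq i k; first by rewrite ltnn mulr1 addrAC subrr add0r.
  by rewrite mulr0 addr0; case: ifP => // _; rewrite subrr normr0.
have ex (k : 'I_m) : exists xk : 'rV[R]_m,
    (forall i, `|xk ord0 i - x ord0 i| <= `|y ord0 i - x ord0 i|) /\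
    f (p k.+1) - f (p k) = df k xk * (y ord0 k - x ord0 k).
  have [|u uk E] := @mvt_line R _ f (df k) (p k) (delta_mx ord0 k) (y ord0 k - x ord0 k).
    by move=> u uk; apply: dfD; apply: boxD; exact: boxp.
  by exists (p k + u *: delta_mx ord0 k); split; [exact: boxp|rewrite pS].
have [xi hxi] := choice ex; exists xi; split; first by move=> k; case: (hxi k).
rewrite -{1}pm -{1}p0 -(telescope_sumr (fun k => f (p k)))//.
by rewrite big_mkord; apply: eq_bigr => k _; case: (hxi k).
Qed.

(** The chain rule from continuous partial derivatives, which is what [Ck_on] provides; the
    increment formula of [mvt_coordinates] takes the place of total differentiability. *)
Lemma is_derive_curve (g : R -> 'rV[R]_m) (dg : 'I_m -> R) (t : R) :
  open D -> (forall k x, D x -> {for x, continuous (df k)}) -> D (g t) ->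
  (forall i, is_derive t (1 : R) (fun u => g u ord0 i) (dg i)) ->
  is_derive t (1 : R) (fun u => f (g u)) (\sum_k df k (g t) * dg k).
Proof.
move=> oD cdf Dgt dgi; set x := g t.
have /nbhs_ballP[e /= e0 xeD] := open_nbhs_nbhs (conj oD Dgt).
have gc i (d : R) : 0 < d -> \forall h \near (0 : R)^',
    `|g (h + t) ord0 i - x ord0 i| < d.
  move=> d0; have [di _] := dgi i.
  have /differentiable_continuous ci : differentiable (fun u => g u ord0 i) t.
    exact/derivable1_diffP.
  have sh : (h + t) @[h --> (0 : R)] --> t.
    rewrite -[X in _ --> X]add0r; apply: cvgD; [exact: cvg_id|exact: cvg_cst].
  have /cvgrPdist_lt/(_ _ d0) H := cvg_comp _ _ sh ci.
  apply: (@nbhs_dnbhs _ 0); move: H; apply: filterS => h.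
  by rewrite distrC.
have gcall d : 0 < d -> \forall h \near (0 : R)^',
    forall i, `|g (h + t) ord0 i - x ord0 i| < d.
  by move=> d0; apply: filter_forall => i; exact: gc.
(* The increment formula is asked only when [g (h + t)] is close to [x], so that some [xi] exists
   for every [h] and can be chosen as a function of [h]. *)
pose Q (h : R) (xi : 'I_m -> 'rV[R]_m) :=
  (forall k i, `|xi k ord0 i - x ord0 i| <= `|g (h + t) ord0 i - x ord0 i|) /\
  ((forall i, `|g (h + t) ord0 i - x ord0 i| < e) ->
   f (g (h + t)) - f x = \sum_k df k (xi k) * (g (h + t) ord0 k - x ord0 k)).
have exQ h : exists xi, Q h xi.
  have [he|nhe] := pselect (forall i, `|g (h + t) ord0 i - x ord0 i| < e).
    have [z hz|xi [xi1 xi2]] := @mvt_coordinates x (g (h + t)).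
      apply: xeD; apply/rV_ballP => // i; rewrite distrC.
      exact: le_lt_trans (hz i) (he i).
    by exists xi.
  by exists (fun=> x); split=> // k i; rewrite subrr normr0.
have [xi hxi] := choice exQ.
have xicvg k : xi h k @[h --> (0 : R)^'] --> x.
  apply/cvg_ballP => d d0; near=> h; apply/rV_ballP => // i.
  rewrite distrC; have [h1 _] := hxi h; apply: le_lt_trans (h1 k i) _.
  by move: i; near: h; exact: gcall.
have cv : (fun h : R => h^-1 *: (((fun u => f (g u)) \o shift t) (h *: 1) - f (g t)))
    @ 0^' --> \sum_k df k x * dg k.
  have : \sum_k df k (xi h k) * (h^-1 * (g (h + t) ord0 k - x ord0 k))
      @[h --> (0 : R)^'] --> \sum_k df k x * dg k.
    apply: (@cvg_sumr R _ (0^')%R) => k; apply: cvgM.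
      by apply: cvg_comp (xicvg k) _; exact: cdf.
    have [dk <-] := dgi k; move: dk; rewrite /derivable /derive.
    rewrite (_ : (fun h : R => h^-1 *: (((fun u => g u ord0 k) \o shift t) (h *: 1) -
      g t ord0 k)) = (fun h : R => h^-1 * (g (h + t) ord0 k - x ord0 k)))//.
    by apply/funext => h /=; rewrite [_%:A]mulr1.
  apply: cvg_trans; apply: near_eq_cvg; near=> h.
  have [_ Eh] := hxi h; rewrite /= [_%:A]mulr1 -[RHS]/(h^-1 * _) Eh.
    by rewrite mulr_sumr; apply: eq_bigr => k _; rewrite mulrCA.
  by near: h; exact: gcall.
by split; [apply/cvg_ex; exists (\sum_k df k x * dg k)|exact: cvg_lim cv].
Unshelve. all: by end_near. Qed.

End chain_rule.

(** * Quaternionic vectors in real coordinates *)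

Section quaternion_coordinates.
Variables (R : realType) (n : nat).
Local Notation R4n := 'rV[R]_(n * 4).
Local Notation Hn := 'cV[quat R]_n.
Implicit Types (p q : quat R) (x y : R4n) (k mu : 'I_4) (l : 'I_n).

Definition qc k q : R := [:: qre q; qi q; qj q; qk q]`_k.

Definition qe mu : quat R :=
  Quat (mu == 0 :> nat)%:R (mu == 1 :> nat)%:R (mu == 2 :> nat)%:R (mu == 3 :> nat)%:R.

Lemma ord4P (P : 'I_4 -> Prop) :
  P (Ordinal (isT : 0 < 4)%N) -> P (Ordinal (isT : 1 < 4)%N) ->
  P (Ordinal (isT : 2 < 4)%N) -> P (Ordinal (isT : 3 < 4)%N) -> forall k, P k.
Proof.
move=> P0 P1 P2 P3 -[[|[|[|[|//]]]] h].
- by rewrite (_ : Ordinal h = Ordinal (isT : 0 < 4)%N)//; exact: val_inj.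
- by rewrite (_ : Ordinal h = Ordinal (isT : 1 < 4)%N)//; exact: val_inj.
- by rewrite (_ : Ordinal h = Ordinal (isT : 2 < 4)%N)//; exact: val_inj.
- by rewrite (_ : Ordinal h = Ordinal (isT : 3 < 4)%N)//; exact: val_inj.
Qed.

Lemma sum_ord4 (W : nmodType) (F : 'I_4 -> W) : \sum_k F k =
  F (Ordinal (isT : 0 < 4)%N) + F (Ordinal (isT : 1 < 4)%N) +
  F (Ordinal (isT : 2 < 4)%N) + F (Ordinal (isT : 3 < 4)%N).
Proof.
rewrite !big_ord_recr big_ord0 /= add0r.
by do 3 (congr (_ + _); last by congr F; exact: val_inj); congr F; exact: val_inj.
Qed.

Lemma qcD k : {morph qc k : p q / p + q}.
Proof. by move=> p q; elim/ord4P: k; rewrite /qc. Qed.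

Lemma qc0 k : qc k 0 = 0.
Proof. by elim/ord4P: k; rewrite /qc. Qed.

Lemma qcN k : {morph qc k : p / - p}.
Proof. by move=> p; elim/ord4P: k; rewrite /qc. Qed.

Lemma qc_sum k (I : Type) (r : seq I) (F : I -> quat R) :
  qc k (\sum_(i <- r) F i) = \sum_(i <- r) qc k (F i).
Proof. exact: (big_morph _ (qcD k) (qc0 k)). Qed.

Lemma qcZ k (t : R) p : qc k (qreal t * p) = t * qc k p.
Proof. by elim/ord4P: k; rewrite /qc /=; ring. Qed.

Lemma quatP p q : (forall k, qc k p = qc k q) -> p = q.
Proof.
case: p q => [a b c d] [a' b' c' d'] h.
by congr Quat; [have := h (Ordinal (isT : 0 < 4)%N)|have := h (Ordinal (isT : 1 < 4)%N)
  |have := h (Ordinal (isT : 2 < 4)%N)|have := h (Ordinal (isT : 3 < 4)%N)].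
Qed.

(** Parseval's identity for the basis [1, i, j, k]: [qc k (p * qe mu)] is the scalar product of
    [qconj p * qe k] with [qe mu], and the right side is the scalar product of [qconj p * qe k] with
    [qconj q * qe k']. *)
Lemma sum_qc_mul p q k k' :
  \sum_mu qc k (p * qe mu) * qc k' (q * qe mu) = qc k (p * qconj q * qe k').
Proof.
case: p q => [a b c d] [a' b' c' d']; rewrite sum_ord4.
by elim/ord4P: k; elim/ord4P: k'; rewrite /qc /qe /=; ring.
Qed.

(** Contracting the second derivatives of the Moebius curves over the four directions of one
    coordinate uses this identity; it is the source of the first-order term of the invariant
    Laplacian. *)
Lemma sum_qe_mul_qe p : \sum_mu qe mu * p * qe mu = - (qreal 2 * qconj p).
Proof.
case: p => [a b c d]; rewrite sum_ord4; apply: quatP => k.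
by elim/ord4P: k; rewrite /qc /qe /=; ring.
Qed.

Lemma ofHE (q : Hn) l k : ofH q ord0 (mxvec_index l k) = qc k (q l ord0).
Proof. by rewrite /ofH mxvecE mxE. Qed.

Lemma qc_toH x l k : qc k (toH x l ord0) = x ord0 (mxvec_index l k).
Proof. by rewrite -ofHE toHK. Qed.

Lemma mxvec_index_ind (P : 'I_(n * 4) -> Prop) :
  (forall l k, P (mxvec_index l k)) -> forall i, P i.
Proof. by move=> h i; case/mxvec_indexP: i. Qed.

Lemma sum_mxvec_index (W : nmodType) (F : 'I_(n * 4) -> W) :
  \sum_i F i = \sum_l \sum_k F (mxvec_index l k).
Proof.
rewrite pair_bigA /= (reindex _ (curry_mxvec_bij n 4)) /=.
by apply: eq_bigr => -[].
Qed.

Lemma esq_toH x : hsqnorm (toH x) = esq x.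
Proof.
rewrite /hsqnorm /esq mxE sum_mxvec_index.
rewrite (big_morph (@qre R) (fun p q => erefl) erefl).
apply: eq_bigr => l _; rewrite sum_ord4 -!qc_toH !mxE.
by rewrite /qc /=; ring.
Qed.

Lemma toHD x y : toH (x + y) = toH x + toH y.
Proof.
by apply/colP => l; rewrite [RHS]mxE; apply: quatP => k; rewrite qcD !qc_toH mxE.
Qed.

Lemma toHZ (t : R) x : toH (t *: x) = qreal t *: toH x.
Proof.
by apply/colP => l; rewrite [RHS]mxE; apply: quatP => k; rewrite qcZ !qc_toH mxE.
Qed.

Lemma toH_delta l k l' :
  toH (delta_mx ord0 (mxvec_index l k)) l' ord0 = if l' == l then qe k else 0.
Proof.
apply: quatP => k'; rewrite qc_toH -mxvec_delta mxvecE mxE.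
have [_|_] := eqVneq l' l; last by rewrite qc0.
by elim/ord4P: k; elim/ord4P: k'.
Qed.

(* The vector fields [q mu], [mu = 1, i, j, k]; for fixed [q] they span the right
   quaternionic line through [q]. *)
Definition rmul mu x : R4n := ofH (rscale (toH x) (qe mu)).

Lemma rmulE mu x l k : rmul mu x ord0 (mxvec_index l k) = qc k (toH x l ord0 * qe mu).
Proof. by rewrite ofHE mxE. Qed.

Lemma toH_rmul mu x l : toH (rmul mu x) l ord0 = toH x l ord0 * qe mu.
Proof. by rewrite /rmul ofHK mxE. Qed.

Definition mu0 : 'I_4 := Ordinal (isT : 0 < 4)%N.

Lemma qe_mu0 : qe mu0 = 1. Proof. by []. Qed.

Lemma rmul_mu0 x : rmul mu0 x = x.
Proof.
apply/rowP => i; elim/mxvec_index_ind: i => l k.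
by rewrite rmulE qe_mu0 mulr1 qc_toH.
Qed.

Lemma rmulD mu : {morph rmul mu : x y / x + y}.
Proof.
move=> x y; apply/rowP => i; elim/mxvec_index_ind: i => l k.
by rewrite [RHS]mxE !rmulE toHD mxE mulrDl qcD.
Qed.

Lemma rmulZ mu (t : R) x : rmul mu (t *: x) = t *: rmul mu x.
Proof.
apply/rowP => i; elim/mxvec_index_ind: i => l k.
by rewrite [RHS]mxE !rmulE toHZ mxE -mulrA qcZ.
Qed.

Lemma rmul_sum_delta mu x : rmul mu x = \sum_i x ord0 i *: rmul mu (delta_mx ord0 i).
Proof.
have r0 : rmul mu 0 = 0 by have := rmulZ mu 0 0; rewrite !scale0r.
rewrite {1}(row_sum_delta x) (big_morph _ (rmulD mu) r0).
by apply: eq_bigr => i _; rewrite rmulZ.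
Qed.

Lemma rmul_rmul mu x : rmul mu (rmul mu x) = (if mu == mu0 then 1 else -1) *: x.
Proof.
apply/rowP => i; elim/mxvec_index_ind: i => l k.
rewrite [RHS]mxE rmulE toH_rmul -qc_toH -qcZ -mulrA; congr (qc k _).
case: (toH x l ord0) => a b c d.
by elim/ord4P: mu; apply: quatP => k'; elim/ord4P: k'; rewrite /qc /qe /=; ring.
Qed.

(** Right multiplication by [i], [j], [k] is skew-symmetric: these fields are tangent to the
    spheres, and in [trace_rmul] they have trace 0. *)
Lemma dot_rmul mu x :
  \sum_i x ord0 i * rmul mu x ord0 i = if mu == mu0 then esq x else 0.
Proof.
rewrite /esq sum_mxvec_index; case: ifP => [/eqP ->|mu_neq].
  rewrite sum_mxvec_index; apply: eq_bigr => l _; apply: eq_bigr => k _.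
  by rewrite rmul_mu0 expr2.
rewrite big1// => l _; rewrite sum_ord4 !rmulE -!qc_toH.
move: mu_neq; case: (toH x l ord0) => a b c d.
by elim/ord4P: mu => //= _; rewrite /qc /qe /=; ring.
Qed.

Lemma trace_rmul mu :
  \sum_i rmul mu (delta_mx ord0 i) ord0 i = if mu == mu0 then (n * 4)%:R else 0.
Proof.
case: ifP => [/eqP ->|mu_neq].
  rewrite (eq_bigr (fun=> 1)); first by rewrite sumr_const card_ord.
  by move=> i _; rewrite rmul_mu0 mxE !eqxx.
rewrite sum_mxvec_index big1// => l _; rewrite sum_ord4 !rmulE !toH_delta eqxx.
by move: mu_neq; elim/ord4P: mu => //= _; rewrite /qc /qe /=; ring.
Qed.

End quaternion_coordinates.

Lemma is_derive_quadratic_poly (R : realType) (a0 a1 a2 t : R) :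
  is_derive t (1 : R) (fun u => a0 + a1 * u + a2 * u ^+ 2) (a1 + 2 * a2 * t).
Proof.
apply: (@is_derive_quadratic _ _ _ _ `|a2|) => h.
by rewrite (_ : _ - _ - _ = a2 * h ^+ 2); [rewrite normrM normrX real_normK ?num_real|ring].
Qed.

Lemma is_derive_quotient (R : realType) (f g : R -> R) (t df dg : R) :
  is_derive t (1 : R) f df -> is_derive t (1 : R) g dg -> g t != 0 ->
  is_derive t (1 : R) (fun u => f u / g u) ((df * g t - f t * dg) / g t ^+ 2).
Proof.
move=> hf hg gt0; have hV := is_deriveV gt0 hg.
apply: is_derive_eq (@is_deriveM _ _ f (fun u => (g u)^-1) _ _ _ _ hf hV) _.
by rewrite /GRing.scale /=; field.
Qed.

Lemma is_derive_sumr (R : realType) (W : normedModType R) (m : nat)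
    (f : 'I_m -> W -> R) (df : 'I_m -> R) (x v : W) :
  (forall i, is_derive x v (f i) (df i)) ->
  is_derive x v (fun y => \sum_i f i y) (\sum_i df i).
Proof.
move=> hf; rewrite (_ : (fun y => _) = \sum_i f i); first exact: is_derive_sum.
by apply/funext => y; rewrite fct_sumE.
Qed.

Section rational_curve.
Variables (R : realType) (a0 a1 a2 b1 b2 : R).

Let P (u : R) := a0 + a1 * u + a2 * u ^+ 2.
Let Q (u : R) := 1 + b1 * u + b2 * u ^+ 2.
Let dP (u : R) := a1 + 2 * a2 * u.
Let dQ (u : R) := b1 + 2 * b2 * u.
Let d1 (u : R) := (dP u * Q u - P u * dQ u) / Q u ^+ 2.

(** The second-order expansion of [P / Q] at 0, where [Q 0 = 1]. The first derivative is given on a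
    neighbourhood of 0 so that it can be differentiated again. *)
Lemma rational_curve_derive : exists d : R -> R,
  [/\ \forall t \near (0 : R), is_derive t (1 : R) (fun u => P u / Q u) (d t),
      d 0 = a1 - a0 * b1 &
      is_derive (0 : R) (1 : R) d (2 * (a2 - a1 * b1 + a0 * (b1 ^+ 2 - b2)))].
Proof.
have hP t : is_derive t (1 : R) P (dP t) := is_derive_quadratic_poly a0 a1 a2 t.
have hQ t : is_derive t (1 : R) Q (dQ t) := is_derive_quadratic_poly 1 b1 b2 t.
have hdP t : is_derive t (1 : R) dP (2 * a2).
  apply: (@is_derive_quadratic _ _ _ _ 0) => h.
  by rewrite /dP (_ : _ - _ - _ = 0) ?normr0 ?mul0r//; ring.
have hdQ t : is_derive t (1 : R) dQ (2 * b2).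
  apply: (@is_derive_quadratic _ _ _ _ 0) => h.
  by rewrite /dQ (_ : _ - _ - _ = 0) ?normr0 ?mul0r//; ring.
have Q0 : Q 0 = 1 by rewrite /Q; ring.
have Qn : \forall t \near (0 : R), Q t != 0.
  have cQ : {for 0, continuous Q}.
    by apply/differentiable_continuous/derivable1_diffP; case: (hQ 0).
  have : \forall t \near (0 : R), 0 < Q t.
    by have := cvgr_gt (Q 0) cQ; apply; rewrite Q0.
  by apply: filterS => t /lt0r_neq0.
exists d1; split.
- by apply: filterS Qn => t; exact: is_derive_quotient.
- by rewrite /d1 Q0 expr1n divr1 /dP /P /dQ; ring.
have hn : is_derive (0 : R) (1 : R) (fun u => dP u * Q u - P u * dQ u)
    (2 * a2 - 2 * a0 * b2).
  have h1 := @is_deriveM _ _ dP Q _ _ _ _ (hdP 0) (hQ 0).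
  have h2 := @is_deriveM _ _ P dQ _ _ _ _ (hP 0) (hdQ 0).
  apply: is_derive_eq (@is_deriveB _ _ _ (fun u => dP u * Q u) (fun u => P u * dQ u) _ _ _ _ h1 h2) _.
  by rewrite /GRing.scale /= /dP /Q /P /dQ; ring.
have hd : is_derive (0 : R) (1 : R) (fun u => Q u ^+ 2) (2 * b1).
  apply: is_derive_eq (@is_deriveM _ _ Q Q _ _ _ _ (hQ 0) (hQ 0)) _.
  by rewrite /GRing.scale /= Q0 /dQ; ring.
have Q20 : Q 0 ^+ 2 != 0 by rewrite Q0 expr1n oner_eq0.
apply: is_derive_eq (is_derive_quotient hn hd Q20) _.
by rewrite Q0 /dP /P /dQ !expr1n divr1; ring.
Qed.

End rational_curve.

Section second_derivative.
Variables (R : realType) (m : nat).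

Lemma partial2_line (g : 'rV[R]_m -> R) (k : 'I_m) (h : R -> R) (d : R) :
  (\forall t \near (0 : R), is_derive t (1 : R) (fun u => g (u *: delta_mx ord0 k)) (h t)) ->
  is_derive (0 : R) (1 : R) h d -> partial k (partial k g) 0 = d.
Proof.
move=> gh hd; apply: derive_val; apply/is_derive_line0.
apply: near_eq_is_derive hd; apply: filterS gh => t gt.
have : is_derive t (1 : R) (fun u => g (0 + u *: delta_mx ord0 k)) (h t).
  by under eq_fun do rewrite add0r.
by move=> /is_derive_line [_ <-].
Qed.

Lemma Ck_on_is_derive j (D : set 'rV[R]_m) (f : 'rV[R]_m -> R) k x :
  Ck_on j.+1 D f -> D x ->
  is_derive x (delta_mx ord0 k : 'rV[R]_m) f (partial k f x).
Proof. by move=> [_ /(_ k)[dk _]] Dx; apply: derivableP; exact: dk. Qed.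

Lemma Ck_on_partial j (D : set 'rV[R]_m) (f : 'rV[R]_m -> R) k :
  Ck_on j.+1 D f -> Ck_on j D (partial k f).
Proof. by case=> _ /(_ k)[]. Qed.

Lemma Ck_on_continuous j (D : set 'rV[R]_m) (f : 'rV[R]_m -> R) x :
  Ck_on j D f -> D x -> {for x, continuous f}.
Proof. by case: j => [|j] [cf _]; exact: cf. Qed.

(* Second derivatives of [f] composed with curves [g k]: only the first two
   derivatives of the curves at 0 matter. *)
Lemma laplacian_curves (D : set 'rV[R]_m) (f : 'rV[R]_m -> R)
    (phi : 'rV[R]_m -> 'rV[R]_m) (x : 'rV[R]_m)
    (d1 : 'I_m -> 'I_m -> R -> R) (d2 : 'I_m -> 'I_m -> R) :
  open D -> Ck_on 2 D f -> D x -> phi 0 = x ->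
  (forall k i, \forall t \near (0 : R), is_derive t (1 : R)
    (fun u => phi (u *: delta_mx ord0 k) ord0 i) (d1 k i t)) ->
  (forall k i, is_derive (0 : R) (1 : R) (d1 k i) (d2 k i)) ->
  \sum_k partial k (partial k (fun y => f (phi y))) 0 =
  \sum_i \sum_j partial j (partial i f) x * (\sum_k d1 k i 0 * d1 k j 0) +
  \sum_i partial i f x * \sum_k d2 k i.
Proof.
move=> oD f2 Dx phi0 hd1 hd2.
have cf i y : D y -> {for y, continuous (partial i f)}.
  exact: Ck_on_continuous (Ck_on_partial i f2).
have cff i j y : D y -> {for y, continuous (partial j (partial i f))}.
  exact: Ck_on_continuous (Ck_on_partial j (Ck_on_partial i f2)).
pose c k t := phi (t *: delta_mx ord0 k).
have c0 k : c k 0 = x by rewrite /c scale0r.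
have hc k i : is_derive (0 : R) (1 : R) (fun u => c k u ord0 i) (d1 k i 0).
  exact: nbhs_singleton (hd1 k i).
have /nbhs_ballP[e /= e0 xeD] := open_nbhs_nbhs (conj oD Dx).
have cD k : \forall t \near (0 : R), D (c k t).
  have : \forall t \near (0 : R), forall i, `|x ord0 i - c k t ord0 i| < e.
    apply: (@filter_forall _ _ _ _ (nbhs_filter (0 : R))) => i; have [di _] := hc k i.
    have /derivable1_diffP/differentiable_continuous ci := di.
    by have /cvgrPdist_lt/(_ _ e0) := ci; rewrite c0.
  by apply: filterS => t ct; apply: xeD; exact/rV_ballP.
have hk k : is_derive (0 : R) (1 : R)
    (fun t => \sum_i partial i f (c k t) * d1 k i t)
    (\sum_i (partial i f x * d2 k i +
       d1 k i 0 * \sum_j partial j (partial i f) x * d1 k j 0)).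
  apply: is_derive_sumr => i.
  have h1 : is_derive (0 : R) (1 : R) (fun t => partial i f (c k t))
      (\sum_j partial j (partial i f) (c k 0) * d1 k j 0).
    apply: (@is_derive_curve _ _ D (partial i f) (fun j => partial j (partial i f))).
    - by move=> j y; exact: Ck_on_is_derive (Ck_on_partial i f2).
    - exact: oD.
    - by move=> j y; exact: cff.
    - by rewrite c0.
  apply: is_derive_eq (@is_deriveM _ _ (fun t => partial i f (c k t)) (d1 k i)
    _ _ _ _ h1 (hd2 k i)) _.
  by rewrite /GRing.scale /= c0.
transitivity (\sum_k \sum_i (partial i f x * d2 k i +
       d1 k i 0 * \sum_j partial j (partial i f) x * d1 k j 0)).
  apply: eq_bigr => k _; apply: (partial2_line _ (hk k)).
  near=> t; apply: (@is_derive_curve _ _ D f (fun j => partial j f)).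
  - by move=> j y; exact: Ck_on_is_derive f2.
  - exact: oD.
  - by move=> j y; exact: cf.
  - by near: t; exact: cD.
  - by near: t; apply: filter_forall => i; exact: hd1.
rewrite exchange_big /= -big_split /=; apply: eq_bigr => i _.
rewrite big_split /= addrC mulr_sumr; congr (_ + _).
under eq_bigr do rewrite mulr_sumr.
rewrite exchange_big /=; apply: eq_bigr => j _; rewrite mulr_sumr.
by apply: eq_bigr => k _; ring.
Unshelve. all: by end_near. Qed.

End second_derivative.

(** * Derivatives of the Moebius transformations at the origin *)

Section mobius_laplacian.
Variables (R : realType) (n : nat).
Local Notation R4n := 'rV[R]_(n * 4).
Implicit Types (x y a : R4n) (k mu : 'I_4) (l : 'I_n).

Lemma qrealC (t : R) (p : quat R) : p * qreal t = qreal t * p.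
Proof. by case: p => a b c d; congr Quat => /=; ring. Qed.

Lemma qrealD (s t : R) : qreal (s + t) = qreal s + qreal t.
Proof. by congr Quat => /=; ring. Qed.

Lemma qreal_sum (I : Type) (r : seq I) (F : I -> R) :
  qreal (\sum_(i <- r) F i) = \sum_(i <- r) qreal (F i).
Proof. exact: (big_morph (@qreal R) qrealD erefl). Qed.

Lemma qconj_mul (p : quat R) : qconj p * p = qreal (qsqr p).
Proof. by case: p => a b c d; congr Quat => /=; rewrite /qsqr /=; ring. Qed.

Lemma qconjM (p q : quat R) : qconj (p * q) = qconj q * qconj p.
Proof. by case: p q => [a b c d] [a' b' c' d']; congr Quat => /=; ring. Qed.

Lemma qconjD : {morph @qconj R : p q / p + q}.
Proof. by move=> [a b c d] [a' b' c' d']; congr Quat => /=; ring. Qed.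

Lemma qconjK : involutive (@qconj R).
Proof. by move=> [a b c d]; congr Quat => /=; ring. Qed.

Lemma sum_qsqr_toH x : \sum_l qsqr (toH x l ord0) = esq x.
Proof.
rewrite /esq sum_mxvec_index; apply: eq_bigr => l _.
by rewrite sum_ord4 -!qc_toH /qc /qsqr.
Qed.

(** Since [|a|^2 = (1 - s) (1 + s)], the coefficient [(1 - s) / |a|^2] is [1 / (1 + s)], which also
    makes sense at [a = 0] and absorbs the case distinction. *)
Lemma mobius_mxE a l l' : esq a < 1 ->
  let s := Num.sqrt (1 - esq a) in
  mobius_mx (toH a) l l' =
  qreal (1 / (1 + s)) * (toH a l ord0 * qconj (toH a l' ord0)) + qreal (s *+ (l == l')).
Proof.
move=> a1 /=; set s := Num.sqrt _.
have s0 : 0 < s by rewrite sqrtr_gt0 subr_gt0.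
have s2 : s ^+ 2 = 1 - esq a by rewrite sqr_sqrtr// subr_ge0 ltW.
rewrite /mobius_mx esq_toH -/s; case: eqVneq => [a0|a0].
  have ea : esq a = 0.
    by rewrite -sum_qsqr_toH big1// => i _; rewrite a0 mxE /qsqr /= expr0n !addr0.
  have s1 : s = 1 by rewrite /s ea subr0 sqrtr1.
  rewrite a0 !mxE !mul0r mulr0 add0r s1; case: (l == l') => //.
have ea : esq a != 0.
  apply: contra_neq a0 => ea; apply/colP => i; apply: quatP => k.
  rewrite qc_toH mxE qc0; apply/eqP; rewrite -sqrf_eq0 eq_le sqr_ge0 andbT -ea.
  exact: coord_sqr_le_esq.
rewrite !mxE big_ord1 !mxE; congr (qreal _ * _ + _).
  have -> : esq a = (1 - s) * (1 + s) by rewrite -subr_sqr expr1n s2; ring.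
  have s1 : 1 - s != 0.
    by apply: contra_neq ea => s1; rewrite -[esq a](subKr 1) -s2 -[s](subKr 1) s1; ring.
  by field; rewrite s1 /= gt_eqF// addr_gt0.
by case: (l == l').
Qed.

(* [Lcoef a l l' * qe R mu] is the [l]-th component of the derivative at 0 of the
   Moebius transformation in the direction [qe R mu] of the [l']-th coordinate. *)
Definition Lcoef a l l' : quat R :=
  let s := Num.sqrt (1 - esq a) in
  qreal (s / (1 + s)) * (toH a l ord0 * qconj (toH a l' ord0)) - qreal (s *+ (l == l')).

(** On a coordinate axis the map is [(p - t c) (1 - t b)^-1]; multiplying by the conjugate of
    [1 - t b] makes each real coordinate a quotient of quadratic polynomials in [t]. *)
Lemma mobius_line a l k l' mu (t : R) : esq a < 1 ->
  let p := toH a l ord0 in let b := qconj (toH a l' ord0) * qe R mu in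
  let c := mobius_mx (toH a) l l' * qe R mu in
  ofH (mobius (toH a) (toH (t *: delta_mx ord0 (mxvec_index l' mu)))) ord0 (mxvec_index l k) =
  (qc k p + - qc k (c + p * qconj b) * t + qc k (c * qconj b) * t ^+ 2) /
  (1 + (- 2 * qre b) * t + qsqr b * t ^+ 2).
Proof.
move=> a1 p b c; rewrite ofHE /mobius mxE.
have sumE (M : 'I_n -> quat R) : \sum_j M j * toH (t *: delta_mx ord0 (mxvec_index l' mu)) j ord0 =
    qreal t * (M l' * qe R mu).
  rewrite (bigD1 l')//= big1 => [|j jl].
    by rewrite addr0 toHZ mxE toH_delta eqxx mulrA qrealC -mulrA.
  by rewrite toHZ mxE toH_delta (negbTE jl) !mulr0.
set q := toH (t *: _); have -> : (toH a - mobius_mx (toH a) *m q) l ord0 = p - qreal t * c.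
  by rewrite [LHS]mxE [X in _ + X]mxE [X in - X]mxE (sumE (mobius_mx (toH a) l)).
have -> : (adj (toH a) *m q) ord0 ord0 = qreal t * b.
  rewrite mxE -(sumE (fun j => qconj (toH a j ord0))); apply: eq_bigr => j _.
  by congr (_ * _); rewrite /adj !mxE.
move: p b c => [p0 p1 p2 p3] [b0 b1 b2 b3] [c0 c1 c2 c3].
rewrite -[1 : quat R]/(Quat 1 0 0 0) -[(_ - _)^-1]/(qinv _) /qinv mulrA qrealC -mulrA qcZ mulrC; congr (_ / _).
  by elim/ord4P: k; rewrite /qc /=; ring.
by rewrite /qsqr /=; ring.
Qed.

Lemma mobius0 a : ofH (mobius (toH a) (toH (0 : R4n))) = a.
Proof.
rewrite -[RHS]toHK; congr ofH; apply/colP => l.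
have t0 : toH (0 : R4n) = 0.
  by apply/colP => j; rewrite [RHS]mxE; apply: quatP => k; rewrite qc_toH mxE qc0.
by rewrite /mobius t0 !mulmx0 mxE [X in X / _]mxE !mxE !subr0 invr1 mulr1.
Qed.

(** [(p - t c) (1 - t b)^-1 = p + t (p b - c) + t^2 (p b - c) b + ...], where [p b - c] is
    [Lcoef a l l' * qe R mu]. *)
Lemma mobius_line_derive a l k l' mu : esq a < 1 ->
  exists d : R -> R,
  [/\ \forall t \near (0 : R), is_derive t (1 : R)
       (fun u => ofH (mobius (toH a) (toH (u *: delta_mx ord0 (mxvec_index l' mu))))
          ord0 (mxvec_index l k)) (d t),
      d 0 = qc k (Lcoef a l l' * qe R mu) &
      is_derive (0 : R) (1 : R) d
        (2 * qc k (Lcoef a l l' * qe R mu * (qconj (toH a l' ord0) * qe R mu)))].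
Proof.
move=> a1; set p := toH a l ord0; set b := qconj (toH a l' ord0) * qe R mu.
set c := mobius_mx (toH a) l l' * qe R mu.
have LE : Lcoef a l l' * qe R mu = p * b - c.
  rewrite /c mobius_mxE// /Lcoef -/p /b mulrA -mulrBl; congr (_ * _).
  set s := Num.sqrt _; set q := p * _.
  have s0 : 1 + s != 0 by rewrite gt_eqF// ltr_wpDr// sqrtr_ge0.
  rewrite (_ : s / (1 + s) = 1 - 1 / (1 + s)); last by field.
  by rewrite qrealD mulrDl (_ : qreal 1 = 1)// mul1r opprD addrA; congr (_ + _ - _);
    case: q => *; congr Quat => /=; ring.
have [d [h1 h2 h3]] := rational_curve_derive (qc k p) (- qc k (c + p * qconj b))
  (qc k (c * qconj b)) (- 2 * qre b) (qsqr b).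
exists d; split.
- apply: filterS h1 => t; congr is_derive.
  by apply/funext => u; rewrite mobius_line.
- rewrite h2 LE; move: (p) (b) (c) => [p0 p1 p2 p3] [b0 b1 b2 b3] [c0 c1 c2 c3].
  by elim/ord4P: (k); rewrite /qc /=; ring.
- apply: is_derive_eq h3 _; rewrite LE.
  move: (p) (b) (c) => [p0 p1 p2 p3] [b0 b1 b2 b3] [c0 c1 c2 c3].
  by elim/ord4P: (k); rewrite /qc /qsqr /=; ring.
Qed.

(** In matrix form [L = w a (adj a) - s I] with [w = s / (1 + s)], and the coefficient of
    [a (adj a)] in [L (adj L)] is [w^2 |a|^2 - 2 w s = - s^2]. Likewise [sum_Lcoef_toH] is
    [L a = - s^2 a], from [w |a|^2 - s = - s^2]. *)
Lemma sum_Lcoef_sqr a l l2 : esq a < 1 ->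
  \sum_l' Lcoef a l l' * qconj (Lcoef a l2 l') =
  qreal (1 - esq a) * (qreal ((l == l2)%:R) - toH a l ord0 * qconj (toH a l2 ord0)).
Proof.
move=> a1; set s := Num.sqrt (1 - esq a); set w := s / (1 + s).
have s2 : s ^+ 2 = 1 - esq a by rewrite sqr_sqrtr// subr_ge0 ltW.
have s0 : 1 + s != 0 by rewrite gt_eqF// ltr_wpDr// sqrtr_ge0.
have ea : esq a = 1 - s ^+ 2 by rewrite s2 subKr.
pose x (j : 'I_n) : R := w ^+ 2 * qsqr (toH a j ord0) - w * s * ((l == j)%:R + (l2 == j)%:R).
pose y (j : 'I_n) : R := s ^+ 2 * ((l == j)%:R * (l2 == j)%:R).
transitivity (\sum_j (qreal (x j) * (toH a l ord0 * qconj (toH a l2 ord0)) + qreal (y j))).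
  apply: eq_bigr => j _; rewrite /Lcoef -/s -/w /x /y.
  have [->|lj] := eqVneq l j; have [->|l2j] := eqVneq l2 j;
    rewrite /= ?mulr1n ?mulr0n;
    move: (toH a j ord0) (toH a l ord0) (toH a l2 ord0) =>
      [g0 g1 g2 g3] [c0 c1 c2 c3] [d0 d1 d2 d3];
    by congr Quat; rewrite /qsqr /=; ring.
rewrite big_split /= -mulr_suml -!qreal_sum.
have -> : \sum_j x j = - s ^+ 2.
  rewrite sumrB -!mulr_sumr sum_qsqr_toH big_split /=.
  have delta (i : 'I_n) : \sum_(j < n) ((i == j)%:R : R) = 1.
    rewrite (bigD1 i)//= eqxx big1 ?addr0// => j ji.
    by rewrite eq_sym (negbTE ji).
  by rewrite !delta ea /w; field.
have -> : \sum_j y j = s ^+ 2 * (l == l2)%:R.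
  rewrite -mulr_sumr (bigD1 l)//= eqxx mul1r big1 ?addr0 1?eq_sym// => j jl.
  by rewrite eq_sym (negbTE jl) mul0r.
rewrite -s2; move: (toH a l ord0 * _) => [c0 c1 c2 c3].
by congr Quat => /=; ring.
Qed.

Lemma sum_Lcoef_toH a l : esq a < 1 ->
  \sum_l' Lcoef a l l' * toH a l' ord0 = - (qreal (1 - esq a) * toH a l ord0).
Proof.
move=> a1; set s := Num.sqrt (1 - esq a); set w := s / (1 + s).
have s2 : s ^+ 2 = 1 - esq a by rewrite sqr_sqrtr// subr_ge0 ltW.
have s0 : 1 + s != 0 by rewrite gt_eqF// ltr_wpDr// sqrtr_ge0.
have ea : esq a = 1 - s ^+ 2 by rewrite s2 subKr.
pose x (j : 'I_n) : R := w * qsqr (toH a j ord0) - s * (l == j)%:R.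
transitivity (\sum_j qreal (x j) * toH a l ord0).
  apply: eq_bigr => j _; rewrite /Lcoef -/s -/w /x.
  have [->|lj] := eqVneq l j; rewrite /= ?mulr1n ?mulr0n;
    move: (toH a j ord0) (toH a l ord0) => [g0 g1 g2 g3] [c0 c1 c2 c3];
    by congr Quat; rewrite /qsqr /=; ring.
rewrite -mulr_suml -qreal_sum.
have -> : \sum_j x j = - s ^+ 2.
  rewrite sumrB -!mulr_sumr sum_qsqr_toH (bigD1 l)//= eqxx big1 => [|j jl].
    by rewrite ea /w /= addr0 mulr1; field.
  by rewrite eq_sym (negbTE jl).
rewrite -s2; case: (toH a l ord0) => [c0 c1 c2 c3].
by congr Quat => /=; ring.
Qed.

(* The invariant Laplacian divided by [1 - |a|^2], see [mobius_laplacianE]. *)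
Definition reduced_laplacian (f : R4n -> R) (a : R4n) : R :=
  \sum_k partial k (partial k f) a
  - \sum_mu \sum_i \sum_j
      rmul mu a ord0 i * rmul mu a ord0 j * partial j (partial i f) a
  + 4 * \sum_i a ord0 i * partial i f a.

(** In [laplacian_curves] the second-order coefficients come from [L (adj L)]; the second
    derivatives, contracted by [sum_qe_mul_qe], add up to [2 L (- 2 a) = 4 (1 - |a|^2) a]. *)
Lemma mobius_laplacianE (D : set R4n) (f : R4n -> R) a :
  open D -> Ck_on 2 D f -> D a -> esq a < 1 ->
  \sum_k partial k (partial k (fun y => f (ofH (mobius (toH a) (toH y))))) 0 =
  (1 - esq a) * reduced_laplacian f a.
Proof.
move=> oD f2 Da a1.
pose e (k : 'I_(n * 4)) : R4n := delta_mx ord0 k.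
(* [D1 k] is the first derivative and [D2 k] half of the second derivative at 0 of the image of the
   [k]-th axis. *)
pose D1 (k : 'I_(n * 4)) : R4n := ofH (\col_l \sum_l' Lcoef a l l' * toH (e k) l' ord0).
pose D2 (k : 'I_(n * 4)) : R4n := ofH (\col_l (\sum_l' Lcoef a l l' * toH (e k) l' ord0 *
  (qconj (toH a l' ord0) * toH (e k) l' ord0))).
have D1E l kk l' mu : D1 (mxvec_index l' mu) ord0 (mxvec_index l kk) =
    qc kk (Lcoef a l l' * qe R mu).
  rewrite ofHE mxE (bigD1 l')//= big1 ?addr0 => [|j jl]; rewrite toH_delta ?eqxx//.
  by rewrite (negbTE jl) mulr0.
have D2E l kk l' mu : D2 (mxvec_index l' mu) ord0 (mxvec_index l kk) =
    qc kk (Lcoef a l l' * qe R mu * (qconj (toH a l' ord0) * qe R mu)).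
  rewrite ofHE mxE (bigD1 l')//= big1 ?addr0 => [|j jl]; rewrite toH_delta ?eqxx//.
  by rewrite (negbTE jl) mulr0 mul0r.
have ex (k i : 'I_(n * 4)) : exists d : R -> R,
  [/\ \forall t \near (0 : R), is_derive t (1 : R)
       (fun u => ofH (mobius (toH a) (toH (u *: e k))) ord0 i) (d t),
      d 0 = D1 k ord0 i & is_derive (0 : R) (1 : R) d (2 * D2 k ord0 i)].
  elim/mxvec_index_ind: k => l' mu; elim/mxvec_index_ind: i => l kk.
  by rewrite D1E D2E; exact: mobius_line_derive.
have exk (k : 'I_(n * 4)) : exists d : 'I_(n * 4) -> R -> R, forall i,
  [/\ \forall t \near (0 : R), is_derive t (1 : R)
       (fun u => ofH (mobius (toH a) (toH (u *: e k))) ord0 i) (d i t),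
      d i 0 = D1 k ord0 i & is_derive (0 : R) (1 : R) (d i) (2 * D2 k ord0 i)].
  by have [d hd] := choice (ex k); exists d.
have [d hd] := choice exk.
have hd1 (k i : 'I_(n * 4)) := let: And3 h _ _ := hd k i in h.
have hd2 (k i : 'I_(n * 4)) := let: And3 _ _ h := hd k i in h.
rewrite (@laplacian_curves _ _ D f (fun y => ofH (mobius (toH a) (toH y))) a
  d (fun k i : 'I_(n * 4) => 2 * D2 k ord0 i) oD f2 Da (mobius0 a) hd1 hd2).
have S1 (i j : 'I_(n * 4)) : \sum_k d k i 0 * d k j 0 = (1 - esq a) *
    ((i == j)%:R - \sum_mu rmul mu a ord0 i * rmul mu a ord0 j).
  rewrite (eq_bigr (fun k : 'I_(n * 4) => D1 k ord0 i * D1 k ord0 j)); last first.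
    by move=> k _; have [_ -> _] := hd k i; have [_ -> _] := hd k j.
  elim/mxvec_index_ind: i => l kk; elim/mxvec_index_ind: j => l2 kk2.
  rewrite sum_mxvec_index.
  under eq_bigr do (under eq_bigr do rewrite !D1E; rewrite sum_qc_mul).
  rewrite -qc_sum -mulr_suml sum_Lcoef_sqr// -mulrA qcZ; congr (_ * _).
  rewrite mulrBl qcD qcN; congr (_ - _).
    have -> : (mxvec_index l kk == mxvec_index l2 kk2)%:R =
        qc kk (toH (e (mxvec_index l2 kk2)) l ord0) by rewrite qc_toH mxE eqxx.
    rewrite toH_delta qcZ; case: (l == l2); rewrite ?mul1r// mul0r.
    by rewrite qc0.
  under eq_bigr do rewrite !rmulE.
  by rewrite sum_qc_mul.
have S2 (i : 'I_(n * 4)) : \sum_k 2 * D2 k ord0 i = (1 - esq a) * (4 * a ord0 i).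
  elim/mxvec_index_ind: i => l kk; rewrite -mulr_sumr sum_mxvec_index.
  transitivity (2 * qc kk (\sum_l' Lcoef a l l' * - (qreal 2 * toH a l' ord0))).
    congr (_ * _); rewrite qc_sum; apply: eq_bigr => l' _.
    under eq_bigr do rewrite D2E.
    rewrite -qc_sum; congr (qc _ _); rewrite -[X in - (_ * X)]qconjK -sum_qe_mul_qe mulr_sumr.
    by apply: eq_bigr => mu _; rewrite !mulrA.
  transitivity (2 * qc kk (- (qreal 2 * \sum_l' Lcoef a l l' * toH a l' ord0))).
    congr (_ * qc _ _); rewrite mulr_sumr -sumrN; apply: eq_bigr => l' _.
    by rewrite mulrN !mulrA qrealC.
  by rewrite sum_Lcoef_toH// -qc_toH qcN qcZ qcN qcZ; ring.
rewrite /reduced_laplacian.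
under eq_bigr do (under eq_bigr do rewrite S1).
under [X in _ + X = _]eq_bigr do rewrite S2.
rewrite mulrDr; congr (_ + _); last first.
  by rewrite !mulr_sumr; apply: eq_bigr => i _; ring.
rewrite [X in _ * (_ - X)]exchange_big /= -sumrB mulr_sumr; apply: eq_bigr => i _.
rewrite [X in _ * (_ - X)]exchange_big /= (_ : partial i (partial i f) a =
    \sum_j (i == j)%:R * partial j (partial i f) a).
  rewrite -sumrB mulr_sumr; apply: eq_bigr => j _.
  by rewrite -mulr_suml; ring.
rewrite (bigD1 i)//= eqxx mul1r big1 ?addr0// => j ji.
by rewrite eq_sym (negbTE ji) mul0r.
Qed.

End mobius_laplacian.

(** * The divergence form *)

Lemma is_derive_onemX (R : realType) (N : nat) (t : R) :
  is_derive t (1 : R) (fun u => (1 - u) ^+ N) (- (N%:R * (1 - t) ^+ N.-1)).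
Proof.
elim: N => [|N IH].
  by rewrite mul0r oppr0 (_ : (fun u => _) = cst 1); first exact: is_derive_cst.
have d1 : is_derive t (1 : R) (fun u : R => 1 - u) (-1).
  apply: (@is_derive_quadratic _ _ _ _ 0) => h.
  by rewrite [X in `|X|](_ : _ = 0) ?normr0 ?mul0r//; ring.
rewrite (_ : (fun u => _) = (fun u : R => (1 - u) * (1 - u) ^+ N)); last first.
  by apply/funext => u; rewrite exprS.
apply: is_derive_eq (@is_deriveM _ _ (fun u : R => 1 - u) (fun u => (1 - u) ^+ N)
  _ _ _ _ d1 IH) _.
rewrite /GRing.scale /=; case: N {IH} => [|N] /=; first by ring.
by rewrite exprS -!natr1; ring.
Qed.

Section C1_functions.
Variables (R : realType) (m : nat) (D : set 'rV[R]_m).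
Implicit Types (f g : 'rV[R]_m -> R) (k : 'I_m) (x : 'rV[R]_m).

(** One direction at a time and with the derivative as data, so that the rules below assemble the
    derivative of a composite expression. *)
Definition C1_along k f f' :=
  [/\ forall x, D x -> {for x, continuous f},
      forall x, D x -> {for x, continuous f'} &
      forall x, D x -> is_derive x (delta_mx ord0 k : 'rV[R]_m) f (f' x)].

Lemma C1_alongD k f f' g g' : C1_along k f f' -> C1_along k g g' ->
  C1_along k (fun x => f x + g x) (fun x => f' x + g' x).
Proof.
move=> [cf cf' df] [cg cg' dg]; split=> x Dx.
- by apply: for_continuousD; [exact: cf|exact: cg].
- by apply: for_continuousD; [exact: cf'|exact: cg'].
- exact: (@is_deriveD _ _ _ f g _ _ _ _ (df x Dx) (dg x Dx)).
Qed.

Lemma C1_alongB k f f' g g' : C1_along k f f' -> C1_along k g g' ->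
  C1_along k (fun x => f x - g x) (fun x => f' x - g' x).
Proof.
move=> [cf cf' df] [cg cg' dg]; split=> x Dx.
- by apply: for_continuousB; [exact: cf|exact: cg].
- by apply: for_continuousB; [exact: cf'|exact: cg'].
- exact: (@is_deriveB _ _ _ f g _ _ _ _ (df x Dx) (dg x Dx)).
Qed.

Lemma C1_alongM k f f' g g' : C1_along k f f' -> C1_along k g g' ->
  C1_along k (fun x => f x * g x) (fun x => f' x * g x + f x * g' x).
Proof.
move=> [cf cf' df] [cg cg' dg]; split=> x Dx.
- by apply: for_continuousM; [exact: cf|exact: cg].
- by apply: for_continuousD; apply: for_continuousM;
    [exact: cf'|exact: cg|exact: cf|exact: cg'].
- apply: is_derive_eq (@is_deriveM _ _ f g _ _ _ _ (df x Dx) (dg x Dx)) _.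
  by rewrite /GRing.scale /= addrC [in LHS]mulrC addrC; ring.
Qed.

Lemma C1_along_sum k (p : nat) (F F' : 'I_p -> 'rV[R]_m -> R) :
  (forall i, C1_along k (F i) (F' i)) ->
  C1_along k (fun x => \sum_i F i x) (fun x => \sum_i F' i x).
Proof.
move=> hF; split=> x Dx.
- by apply: for_continuous_sum => i; case: (hF i) => + _ _; exact.
- by apply: for_continuous_sum => i; case: (hF i) => _ + _; exact.
- by apply: is_derive_sumr => i; case: (hF i) => _ _; exact.
Qed.

Lemma C1_along_cst k (c : R) : C1_along k (fun=> c) (fun=> 0).
Proof.
by split=> x Dx; [exact: for_continuous_cst|exact: for_continuous_cst|exact: is_derive_cst].
Qed.

Lemma C1_along_Ck j k f : Ck_on j.+1 D f -> C1_along k f (partial k f).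
Proof.
move=> f1; split=> x Dx; first exact: Ck_on_continuous f1 Dx.
  exact: Ck_on_continuous (Ck_on_partial k f1) Dx.
exact: Ck_on_is_derive f1 Dx.
Qed.

Lemma C1_along_weight k (N : nat) : (forall x, D x -> esq x < 1) ->
  C1_along k (fun x => ((1 - esq x) ^+ N)^-1)
    (fun x => (N%:R * (2 * x ord0 k)) * ((1 - esq x) ^+ N.+1)^-1).
Proof.
move=> D1; have pos x : D x -> 1 - esq x != 0.
  by move=> /D1 x1; rewrite gt_eqF// subr_gt0.
have cV p x : D x -> {for x, continuous (fun x => ((1 - esq x) ^+ p)^-1)}.
  move=> Dx; have nz : (1 - esq x) ^+ p != 0 by apply: expf_neq0; exact: pos.
  have cX : {for x, continuous (fun y : 'rV[R]_m => (1 - esq y) ^+ p)}.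
    apply: for_continuousX; apply: for_continuousB; first exact: for_continuous_cst.
    exact: continuous_esq.
  exact: (@cvgV _ _ (nbhs x) _ (fun y => (1 - esq y) ^+ p) _ nz cX).
split=> x Dx; first exact: cV.
  apply: for_continuousM; last exact: cV.
  apply: for_continuousM; first exact: for_continuous_cst.
  by apply: for_continuousM; [exact: for_continuous_cst|exact: for_continuous_coord].
have dw : is_derive (esq x) (1 : R) (fun t : R => ((1 - t) ^+ N)^-1)
    (N%:R * ((1 - esq x) ^+ N.+1)^-1).
  have nz : (1 - esq x) ^+ N != 0 by apply: expf_neq0; exact: pos.
  apply: is_derive_eq (@is_deriveV R (fun u => (1 - u) ^+ N) _ _ _ nz
    (is_derive_onemX N (esq x))) _.
  rewrite /GRing.scale /=; case: N {cV} nz => [|N] nz /=; first by ring.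
  by rewrite !exprS; field; rewrite ?expf_neq0 pos.
apply: is_derive_eq (is_derive_comp_line (is_derive_esq k x) dw) _.
by ring.
Qed.

End C1_functions.

(** * The flux field and its divergence *)

Section flux_field.
Variables (R : realType) (n : nat).
Local Notation R4n := 'rV[R]_(n * 4).
Local Notation D := (@eball R (n * 4) 1).
Implicit Types (f g : R4n -> R) (i j k : 'I_(n * 4)) (mu : 'I_4) (x : R4n).

Lemma C1_along_rmul k mu j :
  C1_along D k (fun x => rmul mu x ord0 j)
    (fun=> rmul mu (delta_mx ord0 k) ord0 j).
Proof.
have E (y : R4n) : rmul mu y ord0 j = \sum_i y ord0 i * rmul mu (delta_mx ord0 i) ord0 j.
  by rewrite {1}rmul_sum_delta summxE; apply: eq_bigr => i _; rewrite mxE.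
split=> x Dx.
- rewrite (_ : (fun y => _) = (fun y : R4n => \sum_i y ord0 i * rmul mu (delta_mx ord0 i) ord0 j)).
    apply: for_continuous_sum => i; apply: for_continuousM.
      exact: for_continuous_coord.
    exact: for_continuous_cst.
  by apply/funext => y; exact: E.
- exact: for_continuous_cst.
- apply/is_derive_line0; apply: (@is_derive_quadratic _ _ _ _ 0) => h.
  rewrite !rmulD !rmulZ !mxE [X in `|X|](_ : _ = 0) ?normr0 ?mul0r//; ring.
Qed.

Definition wronskian f g j x : R := f x * partial j g x - g x * partial j f x.

(** The [k]-th partial derivative of [wronskian f g j], in the form that the product rule
    produces. *)
Definition dwronskian f g k j x : R :=
  (partial k f x * partial j g x + f x * partial k (partial j g) x) -
  (partial k g x * partial j f x + g x * partial k (partial j f) x).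

(** The density [(1 - |x|^2)^(-2n-2)] of the invariant measure times the factor [1 - |x|^2] of
    [mobius_laplacianE]. *)
Definition weight x : R := ((1 - esq x) ^+ (2 * n).+1)^-1.

Definition flux_field f g i x : R :=
  weight x * (wronskian f g i x -
    \sum_mu rmul mu x ord0 i * \sum_j rmul mu x ord0 j * wronskian f g j x).

Definition dflux_field f g i x : R :=
  ((2 * n).+1%:R * (2 * x ord0 i)) * ((1 - esq x) ^+ (2 * n).+2)^-1 *
    (wronskian f g i x -
      \sum_mu rmul mu x ord0 i * \sum_j rmul mu x ord0 j * wronskian f g j x) +
  weight x * (dwronskian f g i i x - \sum_mu
    (rmul mu (delta_mx ord0 i) ord0 i * (\sum_j rmul mu x ord0 j * wronskian f g j x) +
     rmul mu x ord0 i * \sum_j (rmul mu (delta_mx ord0 i) ord0 j * wronskian f g j x +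
       rmul mu x ord0 j * dwronskian f g i j x))).

Lemma C1_flux_field f g : Ck_on 2 D f -> Ck_on 2 D g ->
  C1_field D (flux_field f g) (dflux_field f g).
Proof.
move=> f2 g2; suff h k : C1_along D k (flux_field f g k) (dflux_field f g k).
  by split=> k x Dx; case: (h k) => h1 h2 h3; [exact: h1|exact: h2|exact: h3].
have hw j : C1_along D k (wronskian f g j) (dwronskian f g k j).
  by apply: C1_alongB; apply: C1_alongM;
    first [exact: C1_along_Ck f2|exact: C1_along_Ck g2|
      exact: C1_along_Ck (Ck_on_partial j g2)|exact: C1_along_Ck (Ck_on_partial j f2)].
apply: C1_alongM; first exact: C1_along_weight.
apply: C1_alongB; first exact: hw.
apply: C1_along_sum => mu; apply: C1_alongM; first exact: C1_along_rmul.
by apply: C1_along_sum => j; apply: C1_alongM; [exact: C1_along_rmul|exact: hw].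
Qed.

(** By [dot_rmul] only [mu0] contributes, and there [rmul mu x] is [x]. The resulting factor
    [1 - |x|^2] lowers the exponent from [2n + 1] to [2n] on the boundary. *)
Lemma radial_part_flux f g x :
  \sum_i x ord0 i * (wronskian f g i x -
    \sum_mu rmul mu x ord0 i * \sum_j rmul mu x ord0 j * wronskian f g j x) =
  (1 - esq x) * \sum_i x ord0 i * wronskian f g i x.
Proof.
under eq_bigr do rewrite mulrBr mulr_sumr.
rewrite sumrB exchange_big /= mulrBl mul1r; congr (_ - _).
rewrite (bigD1 mu0)//= [X in _ + X]big1 ?addr0 => [|mu mu_neq].
  under eq_bigr do rewrite mulrA.
  rewrite -mulr_suml dot_rmul eqxx; congr (_ * _).
  by apply: eq_bigr => j _; rewrite rmul_mu0.
under eq_bigr do rewrite mulrA.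
by rewrite -mulr_suml dot_rmul (negbTE mu_neq) mul0r.
Qed.

Lemma flux_field_radial f g x : esq x < 1 ->
  \sum_i x ord0 i * flux_field f g i x =
  ((1 - esq x) ^+ (2 * n))^-1 * \sum_i x ord0 i * wronskian f g i x.
Proof.
move=> x1; have nz : 1 - esq x != 0 by rewrite gt_eqF// subr_gt0.
rewrite (eq_bigr (fun i => weight x * (x ord0 i * (wronskian f g i x -
    \sum_mu rmul mu x ord0 i * \sum_j rmul mu x ord0 j * wronskian f g j x)))).
  rewrite -mulr_sumr radial_part_flux mulrA; congr (_ * _).
  by rewrite /weight exprS invfM mulrAC mulVf// mul1r.
by move=> i _; rewrite /flux_field mulrCA.
Qed.

(** The products of first derivatives are antisymmetric in [i] and [j] and the coefficients
    symmetric, so these products cancel. *)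
Lemma sum_dwronskian mu f g x :
  \sum_i \sum_j rmul mu x ord0 i * rmul mu x ord0 j * dwronskian f g i j x =
  f x * (\sum_i \sum_j rmul mu x ord0 i * rmul mu x ord0 j * partial j (partial i g) x) -
  g x * (\sum_i \sum_j rmul mu x ord0 i * rmul mu x ord0 j * partial j (partial i f) x).
Proof.
pose r i := rmul mu x ord0 i.
have E i j : r i * r j * dwronskian f g i j x =
    (r i * r j * (partial i f x * partial j g x) -
     r i * r j * (partial i g x * partial j f x)) +
    (f x * (r i * r j * partial i (partial j g) x) -
     g x * (r i * r j * partial i (partial j f) x)).
  rewrite /dwronskian; move: (r i) (r j) (f x) (g x) (partial i f x) (partial j f x)
    (partial i g x) (partial j g x) (partial i (partial j f) x)
    (partial i (partial j g) x) => *; ring.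
under eq_bigr do under eq_bigr do rewrite -/(r _) -/(r _) E.
under eq_bigr do rewrite big_split /= !sumrB.
rewrite big_split /= !sumrB.
have -> : \sum_i \sum_j r i * r j * (partial i g x * partial j f x) =
    \sum_i \sum_j r i * r j * (partial i f x * partial j g x).
  rewrite exchange_big /=; apply: eq_bigr => i _; apply: eq_bigr => j _; ring.
rewrite subrr add0r.
congr (_ - _); rewrite exchange_big mulr_sumr /=; apply: eq_bigr => i _;
  by rewrite mulr_sumr; apply: eq_bigr => j _; rewrite -/(r i) -/(r j); ring.
Qed.

(** The balance [2 (2n + 1) - 4n + 2 = 4]. For each function, [e] stands for the Euler derivative,
    [l] for the flat Laplacian and [s] for the second-order terms along the fields [q mu]. *)
Let flux_identity (fx gx eg ef lg lf sg sf : R) :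
  2 * (2 * n).+1%:R * (fx * eg - gx * ef) +
  (fx * lg - gx * lf - ((n * 4)%:R * (fx * eg - gx * ef) + -2 * (fx * eg - gx * ef) +
    (fx * sg - gx * sf))) =
  fx * (lg - sg + 4 * eg) - gx * (lf - sf + 4 * ef).
Proof. by rewrite -natr1 !natrM; ring. Qed.

Lemma flux_field_divergence f g x : esq x < 1 ->
  \sum_i dflux_field f g i x =
  weight x * (f x * reduced_laplacian g x - g x * reduced_laplacian f x).
Proof.
move=> x1; have nz : 1 - esq x != 0 by rewrite gt_eqF// subr_gt0.
pose S mu := \sum_j rmul mu x ord0 j * wronskian f g j x.
pose V := \sum_i x ord0 i * wronskian f g i x.
rewrite /dflux_field big_split /=.
have -> : \sum_i (2 * n).+1%:R * (2 * x ord0 i) * ((1 - esq x) ^+ (2 * n).+2)^-1 *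
    (wronskian f g i x - \sum_mu rmul mu x ord0 i * S mu) =
    weight x * (2 * (2 * n).+1%:R * V).
  rewrite (eq_bigr (fun i => ((2 * n).+1%:R * 2 * ((1 - esq x) ^+ (2 * n).+2)^-1) *
    (x ord0 i * (wronskian f g i x - \sum_mu rmul mu x ord0 i * S mu)))); last first.
    by move=> i _; ring.
  rewrite -mulr_sumr radial_part_flux -/V /weight exprS.
  by field; rewrite ?expf_neq0 nz.
rewrite -mulr_sumr -mulrDr; congr (_ * _).
rewrite sumrB exchange_big /=.
(* The middle term comes from differentiating the inner factor [rmul mu x] along the field [q mu]:
   this gives [(q mu) mu], which is [q] for [mu0] and [- q] otherwise. *)
have wS mu : \sum_i (rmul mu (delta_mx ord0 i) ord0 i * S mu +
     rmul mu x ord0 i * \sum_j (rmul mu (delta_mx ord0 i) ord0 j * wronskian f g j x +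
       rmul mu x ord0 j * dwronskian f g i j x)) =
   (if mu == mu0 then (n * 4)%:R else 0) * S mu + (if mu == mu0 then 1 else -1) * V +
   \sum_i \sum_j rmul mu x ord0 i * rmul mu x ord0 j * dwronskian f g i j x.
  rewrite big_split /= -mulr_suml trace_rmul -addrA; congr (_ + _).
  under eq_bigr do rewrite big_split /= mulrDr.
  rewrite big_split /=; congr (_ + _); last first.
    by apply: eq_bigr => i _; rewrite mulr_sumr; apply: eq_bigr => j _; rewrite mulrA.
  under eq_bigr do rewrite mulr_sumr.
  rewrite exchange_big /= mulr_sumr; apply: eq_bigr => j _.
  rewrite mulrA; have -> : (if mu == mu0 then 1 else -1) * x ord0 j =
      rmul mu (rmul mu x) ord0 j by rewrite rmul_rmul mxE.
  rewrite (rmul_sum_delta mu (rmul mu x)) summxE mulr_suml.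
  by apply: eq_bigr => i _; rewrite mxE mulrA.
rewrite [X in _ - X](eq_bigr _ (fun mu _ => wS mu)).
rewrite [X in _ - X]big_split /= [X in _ - (X + _)]big_split /=.
under [X in _ - (_ + X)]eq_bigr do rewrite sum_dwronskian.
have S0 : S mu0 = V by apply: eq_bigr => j _; rewrite rmul_mu0.
rewrite [X in _ - (_ + X)]sumrB.
rewrite -[X in _ - (_ + (X - _))]mulr_sumr -[X in _ - (_ + (_ - X))]mulr_sumr.
rewrite -[X in _ - (_ + X + _)]mulr_suml.
have -> : \sum_mu (if mu == mu0 then 1 else -1) = - 2 :> R by rewrite sum_ord4 /=; ring.
have -> : \sum_mu (if mu == mu0 then (n * 4)%:R else 0) * S mu = (n * 4)%:R * V.
  rewrite (bigD1 mu0)//= [X in _ + X]big1 ?addr0 ?S0// => mu mu_neq.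
  by rewrite (negbTE mu_neq) mul0r.
rewrite /reduced_laplacian.
have -> : V = f x * (\sum_i x ord0 i * partial i g x) - g x * (\sum_i x ord0 i * partial i f x).
  rewrite !mulr_sumr -sumrB; apply: eq_bigr => i _; rewrite /wronskian.
  by move: (x ord0 i) (f x) (g x) (partial i f x) (partial i g x) => *; ring.
have -> : \sum_i dwronskian f g i i x = f x * (\sum_i partial i (partial i g) x) -
    g x * (\sum_i partial i (partial i f) x).
  rewrite !mulr_sumr -sumrB; apply: eq_bigr => i _; rewrite /dwronskian.
  by move: (f x) (g x) (partial i f x) (partial i g x) (partial i (partial i f) x)
    (partial i (partial i g) x) => *; ring.
exact: flux_identity.
Qed.

End flux_field.

(** * Transitivity of Sp(n) on the unit sphere *)

Section adjoint.
Variable R : realType.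

Lemma qconj_sum (I : Type) (r : seq I) (F : I -> quat R) :
  qconj (\sum_(i <- r) F i) = \sum_(i <- r) qconj (F i).
Proof.
apply: (big_morph _ (@qconjD R)); by rewrite /qconj /= !oppr0.
Qed.

Lemma adjM p q s (A : 'M[quat R]_(p, q)) (B : 'M[quat R]_(q, s)) :
  adj (A *m B) = adj B *m adj A.
Proof.
apply/matrixP => i j; rewrite !mxE qconj_sum; apply: eq_bigr => k _.
by rewrite !mxE qconjM.
Qed.

Lemma adjK p q (A : 'M[quat R]_(p, q)) : adj (adj A) = A.
Proof. by apply/matrixP => i j; rewrite !mxE qconjK. Qed.

Lemma adjB p q (A B : 'M[quat R]_(p, q)) : adj (A - B) = adj A - adj B.
Proof.
by apply/matrixP => i j; rewrite !mxE qconjD.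
Qed.

Lemma qconj0 : qconj (0 : quat R) = 0.
Proof. by have : qconj (Quat 0 0 0 0) = Quat 0 0 0 0 :> quat R by rewrite /qconj /= !oppr0. Qed.

Lemma qconj1 : qconj (1 : quat R) = 1.
Proof. by have : qconj (Quat 1 0 0 0) = Quat 1 0 0 0 :> quat R by rewrite /qconj /= !oppr0. Qed.

Lemma adj1 p : adj (1%:M : 'M[quat R]_p) = 1%:M.
Proof.
apply/matrixP => i j; rewrite !mxE eq_sym.
by case: (i == j); rewrite /= ?mulr1n ?mulr0n ?qconj1 ?qconj0.
Qed.

End adjoint.

Section transitivity.
Variables (R : realType) (n : nat).
Local Notation R4n := 'rV[R]_(n * 4).
Local Notation Hn := 'cV[quat R]_n.

Lemma mulmx_qreal p q s (t : R) (A : 'M[quat R]_(p, q)) (B : 'M[quat R]_(q, s)) :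
  A *m (qreal t *: B) = qreal t *: (A *m B).
Proof.
apply/matrixP => i j; rewrite !mxE mulr_sumr; apply: eq_bigr => k _.
by rewrite mxE mulrA qrealC -mulrA.
Qed.

Lemma hsqnorm_mulmx (U : 'M[quat R]_n) (q : Hn) : adj U *m U = 1%:M ->
  hsqnorm (U *m q) = hsqnorm q.
Proof. by move=> UU; rewrite /hsqnorm adjM mulmxA -(mulmxA (adj q)) UU mulmx1. Qed.

Lemma esq_ofH (q : Hn) : esq (ofH q) = hsqnorm q.
Proof. by rewrite -esq_toH ofHK. Qed.

Section unitary_lisom.
Variables (U : 'M[quat R]_n) (UU : U *m adj U = 1%:M) (UU' : adj U *m U = 1%:M).
Let f (x : R4n) : R4n := ofH (U *m toH x).
Let g (x : R4n) : R4n := ofH (adj U *m toH x).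

Let toH_f x : toH (f x) = U *m toH x. Proof. exact: ofHK. Qed.

Fact unitaryK : cancel f g.
Proof. by move=> x; rewrite /f /g ofHK mulmxA UU' mul1mx toHK. Qed.
Fact unitaryVK : cancel g f.
Proof. by move=> x; rewrite /f /g ofHK mulmxA UU mul1mx toHK. Qed.
Fact unitaryD : {morph f : x y / x + y}.
Proof.
move=> x y; apply: (can_inj (@toHK R n)).
apply: (etrans (toH_f (x + y))); rewrite (toHD x y) mulmxDr -(toH_f x) -(toH_f y).
exact/esym/toHD.
Qed.
Fact unitaryZ (t : R) x : f (t *: x) = t *: f x.
Proof.
apply: (can_inj (@toHK R n)); apply: (etrans (toH_f (t *: x))).
rewrite (toHZ t x) mulmx_qreal -(toH_f x).
exact/esym/toHZ.
Qed.
Fact unitary_esq x : esq (f x) = esq x.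
Proof. by rewrite esq_ofH hsqnorm_mulmx// esq_toH. Qed.

Definition unitary_lisom : lisom R (n * 4) :=
  Lisom unitaryK unitaryVK unitaryD unitaryZ unitary_esq.

End unitary_lisom.

(* A quaternionic reflection [1 - v a^-1 v*] with [v = p - q] and [a = v* p]
   maps [p] to [q]; it is unitary because [a + a* = |v|^2]. *)
Lemma unitary_transitive (p q : Hn) : hsqnorm p = 1 -> hsqnorm q = 1 ->
  exists U : 'M[quat R]_n,
    [/\ U *m adj U = 1%:M, adj U *m U = 1%:M & U *m p = q].
Proof.
move=> p1 q1; have [->|pq] := eqVneq p q.
  by exists 1%:M; rewrite adj1 !mulmx1 mul1mx.
pose v := p - q; pose A : 'M[quat R]_1 := adj v *m p; pose a := A ord0 ord0.
have nrm (z : Hn) : adj z *m z = (qreal (hsqnorm z))%:M.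
  apply/matrixP => i j; rewrite !ord1 [RHS]mxE eqxx mulr1n mxE /hsqnorm mxE.
  under eq_bigr do rewrite !mxE qconj_mul.
  by rewrite -qreal_sum.
have vv : adj v *m v = A + adj A.
  rewrite /A adjM adjK /v adjB !mulmxBl !mulmxBr !nrm p1 q1.
  by rewrite opprB addrC.
have A0 : A = a%:M by apply/matrixP => i j; rewrite !ord1 [RHS]mxE eqxx mulr1n.
(* [a = 0] would give [|v|^2 = a + qconj a = 0], contrary to [p != q]. *)
have a0 : a != 0.
  apply/eqP => a0; have : adj v *m v = 0.
    have A00 : A = 0 by apply/matrixP => i j; rewrite A0 a0 !mxE mul0rn.
    by rewrite vv A00 add0r; apply/matrixP => i j; rewrite !mxE qconj0.
  rewrite nrm => /matrixP/(_ ord0 ord0); rewrite !mxE eqxx mulr1n => -[v0].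
  move/eqP: pq; apply; apply/eqP; rewrite -subr_eq0 -/v; apply/eqP.
  apply: (can_inj (@ofHK R n)); apply/rowP => i.
  have t0 : ofH (0 : Hn) = 0.
    apply/rowP => j; elim/mxvec_index_ind: j => l k.
    by rewrite ofHE !mxE qc0.
  rewrite t0 mxE; apply/eqP; rewrite -sqrf_eq0 eq_le sqr_ge0 andbT.
  by rewrite -v0 -esq_ofH coord_sqr_le_esq.
pose Ai : 'M[quat R]_1 := a^-1%:M.
have AiA : Ai *m A = 1%:M.
  apply/matrixP => i j; rewrite A0 !ord1 mxE big_ord1 !mxE eqxx !mulr1n.
  by rewrite mulVr// unitfE.
have AAi : adj A *m adj Ai = 1%:M by rewrite -adjM AiA adj1.
have AiA' : A *m Ai = 1%:M.
  apply/matrixP => i j; rewrite A0 !ord1 mxE big_ord1 !mxE eqxx !mulr1n.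
  by rewrite mulrV// unitfE.
have AAi' : adj Ai *m adj A = 1%:M by rewrite -adjM AiA' adj1.
pose W := v *m Ai *m adj v.
have adjW : adj W = v *m adj Ai *m adj v.
  by rewrite /W !adjM adjK mulmxA.
have Wp : W *m p = v by rewrite /W -!mulmxA -/A AiA mulmx1.
exists (1%:M - W); split.
- rewrite adjB adj1 mulmxBl !mulmxBr !mul1mx mulmx1.
  have -> : W *m adj W = adj W + W.
    rewrite adjW /W !mulmxA -(mulmxA (v *m Ai)) vv mulmxDr mulmxDl.
    rewrite -(mulmxA v Ai A) AiA mulmx1 -(mulmxA (v *m Ai) (adj A)) AAi mulmx1.
    by rewrite mulmxDl.
  by rewrite opprB addrK subrK.
- rewrite adjB adj1 mulmxBl !mulmxBr !mul1mx mulmx1.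
  have -> : adj W *m W = adj W + W.
    rewrite adjW /W !mulmxA -(mulmxA (v *m adj Ai)) vv mulmxDr mulmxDl.
    rewrite -(mulmxA (v *m adj Ai) A) AiA' mulmx1 -(mulmxA v (adj Ai)) AAi' mulmx1.
    by rewrite mulmxDl.
  by rewrite opprB [adj W + W]addrC addrK subrK.
- by rewrite mulmxBl mul1mx Wp /v opprB addrCA subrr addr0.
Qed.

Lemma qball_eball (r : R) : 0 <= r -> qball R n r = eball (r ^+ 2).
Proof.
move=> r0; have E (x : R4n) : (Num.sqrt (esq x) < r) = (esq x < r ^+ 2).
  rewrite -[X in _ = (X < _)](sqr_sqrtr (esq_ge0 x)) ltr_pXn2r// nnegrE.
  exact: sqrtr_ge0.
by apply/seteqP; split=> x; rewrite /qball /eball /= /hnorm esq_toH E.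
Qed.

Lemma qsphere_esphere : qsphere R n = esphere (R := R) (m := n * 4).
Proof.
apply/seteqP; split=> x; rewrite /qsphere /esphere /= /hnorm esq_toH.
  by move=> x1; rewrite -(sqr_sqrtr (esq_ge0 x)) x1 expr1n.
by move=> ->; rewrite sqrtr1.
Qed.

Lemma sphere_transitive (sigma : {measure set R4n -> \bar R}) :
  SpSp1_invariant sigma -> forall z z', esphere z -> esphere z' ->
  exists f : lisom R (n * 4), f z = z' /\
    forall A, measurable A -> A `<=` @esphere R (n * 4) -> sigma (f @^-1` A) = sigma A.
Proof.
move=> inv z z' z1 z1'; rewrite /esphere /= -esq_toH in z1.
rewrite /esphere /= -esq_toH in z1'.
have [U [UU UU' Uz]] := unitary_transitive z1 z1'.
exists (unitary_lisom UU UU'); split; first by rewrite /= Uz toHK.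
move=> A mA; rewrite -qsphere_esphere => AS.
have Sp11 : @Sp1 R 1 by rewrite /Sp1 /= qconj1 mulr1.
rewrite -[RHS](inv U 1 UU Sp11 A mA AS).
have -> : SpSp1_act U 1 = unitary_lisom UU UU'; last by [].
apply/funext => x; rewrite /SpSp1_act /= qconj1; congr ofH.
by apply/colP => l; rewrite mxE mulr1.
Qed.

End transitivity.

Lemma sumr_lincomb (K : pzRingType) (I : finType) (F G : I -> K) (s : K) :
  \sum_i (F i + s * G i) = \sum_i F i + s * \sum_i G i.
Proof. by rewrite big_split mulr_sumr. Qed.

(** * Green's formula for real functions *)

Section green_formula.
Variables (R : realType) (n : nat).
Local Notation R4n := 'rV[R]_(n * 4).
Local Notation D := (@eball R (n * 4) 1).
Local Notation V := (lebesgue_rV R (n * 4)).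
Local Notation S := (@esphere R (n * 4)).
Variable sigma : {measure set R4n -> \bar R}.
Hypothesis n0 : (0 < n)%N.
Hypothesis sigma1 : sigma S = 1%E.
Hypothesis sigma_trans : forall z z', S z -> S z' -> exists f : lisom R (n * 4),
  f z = z' /\ forall A, measurable A -> A `<=` S -> sigma (f @^-1` A) = sigma A.
Variable r : R.
Hypotheses (r0 : 0 < r) (r1 : r < 1).

Let rD x : esq x <= r ^+ 2 -> D x.
Proof. by move=> /le_lt_trans; apply; rewrite expr_lt1// ltW. Qed.

Let oD : open D := @eball_open R (n * 4) 1.

Let m0 : (0 < n * 4)%N. Proof. by rewrite muln_gt0 n0. Qed.

(** [4n |B_r|] is [sphere_area] times [r^(4n)], and dividing by the [r^2] of [ball_divergence]
    leaves the exponent [4n - 2]. *)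
Lemma ball_flux (X X' : 'I_(n * 4) -> R4n -> R) : C1_field D X X' ->
  \int[V]_(x in eball (r ^+ 2)) \sum_k X' k x =
  sphere_area R n * r ^+ (4 * n - 2) *
    \int[sigma]_(z in S) \sum_k (r *: z) ord0 k * X k (r *: z).
Proof.
move=> C1X; have := ball_divergence sigma1 sigma_trans oD r0 rD C1X.
set I := \int[V]_(x in _) _; set c := \int[sigma]_(z in _) _ => E.
have r2 : r ^+ 2 != 0 by rewrite expf_neq0// gt_eqF.
apply: (mulfI r2); rewrite E fine_lebesgue_eball// /sphere_area qball_eball// expr1n.
have -> : r ^+ (n * 4) = r ^+ 2 * r ^+ (4 * n - 2).
  (* The subtraction in [4 * n - 2] is truncated; [n0] makes it exact. *)
  have n4 : (2 <= 4 * n)%N by rewrite (@leq_trans 4)// leq_pmulr.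
  by rewrite -exprD subnKC// mulnC.
by rewrite [(4 * n)%N]mulnC; ring.
Qed.

Lemma sphere_integrable (g : R4n -> R) :
  (forall x, D x -> {for x, continuous g}) ->
  sigma.-integrable S (EFin \o (fun z => g (r *: z))).
Proof.
move=> cg; have [M [M0 hM]] := bounded_on_closed_eball cg rD.
have rz z : S z -> esq (r *: z) <= r ^+ 2 by move=> Sz; rewrite esqZ Sz mulr1.
apply: measurable_bounded_integrable.
- exact: measurable_esphere.
- by rewrite sigma1 ltry.
- apply: (measurable_comp (@measurable_eball R (n * 4) 1)).
  + by move=> _ [z /rz/rD ? <-].
  + exact: (open_continuous_measurable_rV oD cg).
  + apply: measurable_funTS; apply: measurable_linear_rV => [x y|t x].
      by rewrite scalerDr.
    by rewrite !scalerA mulrC.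
- by exists M; split; [exact: num_real|move=> y My z /rz/hM zM; apply: le_trans zM _; exact: ltW].
Qed.

Definition mu1 : 'I_4 := Ordinal (isT : 1 < 4)%N.

Definition radial_wronskian (f g : R4n -> R) (x : R4n) : R :=
  \sum_k x ord0 k * wronskian f g k x.

Definition tangential (dh : 'I_(n * 4) -> R4n -> R) (x : R4n) : R :=
  \sum_k rmul mu1 x ord0 k * dh k x.

(** The field [h(q) q i] is tangent to the spheres, and its divergence is the derivative of [h]
    along [q i] because the linear field [q i] has trace 0. *)
Lemma integral_tangential_eq0 (h : R4n -> R) (dh : 'I_(n * 4) -> R4n -> R) :
  (forall k, C1_along D k h (dh k)) ->
  \int[sigma]_(z in S) tangential dh (r *: z) = 0.
Proof.
move=> hC.
have := @tangential_flux_eq0 _ _ sigma sigma1 sigma_trans D r oD r0 rD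
  (fun k x => h x * rmul mu1 x ord0 k)
  (fun k x => dh k x * rmul mu1 x ord0 k + h x * rmul mu1 (delta_mx ord0 k) ord0 k) m0.
have cX k : C1_along D k (fun x => h x * rmul mu1 x ord0 k)
    (fun x => dh k x * rmul mu1 x ord0 k + h x * rmul mu1 (delta_mx ord0 k) ord0 k).
  by apply: C1_alongM; [exact: hC|exact: C1_along_rmul].
move=> /(_ _ _) <-.
- apply: eq_Rintegral => z _; rewrite big_split /= -[X in _ + X]mulr_sumr trace_rmul /= mulr0 addr0.
  by apply: eq_bigr => k _; rewrite mulrC.
- by split=> k x Dx; case: (cX k) => h1 h2 h3; [exact: h1|exact: h2|exact: h3].
- move=> x _; under eq_bigr do rewrite mulrCA.
  by rewrite -mulr_sumr dot_rmul /= mulr0.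
Qed.

(** The common shape of the real and the imaginary part of the formula: two Wronskian pairs joined
    by the sign [s], and a tangential derivative with coefficient [t], which integrates to 0. *)
Lemma green_real (f1 g1 f2 g2 h : R4n -> R) (dh : 'I_(n * 4) -> R4n -> R) (s t : R) :
  Ck_on 2 D f1 -> Ck_on 2 D g1 -> Ck_on 2 D f2 -> Ck_on 2 D g2 ->
  (forall k, C1_along D k h (dh k)) ->
  let lap f x := (1 - esq x) * reduced_laplacian f x in
  \int[V]_(x in eball (r ^+ 2))
    (((f1 x * lap g1 x - g1 x * lap f1 x) + s * (f2 x * lap g2 x - g2 x * lap f2 x)) *
     ((1 - esq x) ^+ (2 * n + 2))^-1) =
  2 * sphere_area R n * \int[sigma]_(z in S)
    ((2^-1 * (radial_wronskian f1 g1 (r *: z) + s * radial_wronskian f2 g2 (r *: z) +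
        t * tangential dh (r *: z))) *
     (r ^+ (4 * n - 2) / (1 - r ^+ 2) ^+ (2 * n))).
Proof.
move=> hf1 hg1 hf2 hg2 hC lap.
have F1 := C1_flux_field hf1 hg1; have F2 := C1_flux_field hf2 hg2.
pose X k x := flux_field f1 g1 k x + s * flux_field f2 g2 k x.
pose X' k x := dflux_field f1 g1 k x + s * dflux_field f2 g2 k x.
have along f g k : C1_field D (flux_field f g) (dflux_field f g) ->
    C1_along D k (flux_field f g k) (dflux_field f g k).
  by move=> [c1 c2 c3]; split=> x Dx; [exact: c1|exact: c2|exact: c3].
have CX k : C1_along D k (X k) (fun x => dflux_field f1 g1 k x +
    (0 * flux_field f2 g2 k x + s * dflux_field f2 g2 k x)).
  apply: C1_alongD; first exact: along.
  by apply: C1_alongM; [exact: C1_along_cst|exact: along].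
have C1X : C1_field D X X'.
  have XE k : X' k = (fun x => dflux_field f1 g1 k x +
    (0 * flux_field f2 g2 k x + s * dflux_field f2 g2 k x)).
    by apply/funext => x; rewrite mul0r add0r.
  by split=> k x Dx; rewrite ?XE; case: (CX k) => h1 h2 h3; [exact: h1|exact: h2|exact: h3].
have rzE z : S z -> esq (r *: z) = r ^+ 2 by move=> Sz; rewrite esqZ Sz mulr1.
have D1 x : D x -> esq x < 1 by [].
pose c := r ^+ (4 * n - 2) / (1 - r ^+ 2) ^+ (2 * n).
pose A x := radial_wronskian f1 g1 x + s * radial_wronskian f2 g2 x.
have cW f g x : Ck_on 2 D f -> Ck_on 2 D g -> D x -> {for x, continuous (radial_wronskian f g)}.
  move=> hf hg Dx; apply: for_continuous_sum => k; apply: for_continuousM.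
    exact: for_continuous_coord.
  by apply: for_continuousB; apply: for_continuousM;
    first [exact: Ck_on_continuous hf Dx|exact: Ck_on_continuous hg Dx|
    exact: Ck_on_continuous (Ck_on_partial k hg) Dx|exact: Ck_on_continuous (Ck_on_partial k hf) Dx].
have cA x : D x -> {for x, continuous A}.
  move=> Dx; apply: for_continuousD; first exact: cW.
  by apply: for_continuousM; [exact: for_continuous_cst|exact: cW].
have cT x : D x -> {for x, continuous (tangential dh)}.
  move=> Dx; apply: for_continuous_sum => k; apply: for_continuousM.
    by case: (@C1_along_rmul R n k mu1 k) => h1 _ _; exact: h1.
  by case: (hC k) => _ h2 _; exact: h2.
have iA := sphere_integrable cA; have iT := sphere_integrable cT.
have mS := @measurable_esphere R (n * 4).
transitivity (\int[V]_(x in eball (r ^+ 2)) \sum_k X' k x).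
  apply: eq_Rintegral => x; rewrite inE => xr; have Dx : D x by apply: rD; exact: ltW.
  have -> : \sum_k X' k x =
      weight x * (f1 x * reduced_laplacian g1 x - g1 x * reduced_laplacian f1 x) +
      s * (weight x * (f2 x * reduced_laplacian g2 x - g2 x * reduced_laplacian f2 x)).
    rewrite sumr_lincomb; congr (_ + _ * _); exact: flux_field_divergence.
  have nz : 1 - esq x != 0 by rewrite gt_eqF// subr_gt0.
  by rewrite /lap /weight addn2 !exprS; field; rewrite ?expf_neq0 nz.
rewrite (ball_flux C1X).
rewrite [in RHS](eq_Rintegral _ (g := fun z : R4n => (2^-1 * c) * A (r *: z) +
    (2^-1 * c * t) * tangential dh (r *: z))); last first.
  by move=> z _; rewrite -/c /A; ring.
rewrite RintegralD//; try exact: integrable_EFinZ.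
rewrite !RintegralZl// (integral_tangential_eq0 hC) mulr0 addr0.
rewrite [in LHS](eq_Rintegral _ (g := fun z : R4n => ((1 - r ^+ 2) ^+ (2 * n))^-1 * A (r *: z))).
  rewrite RintegralZl// /c; field; apply/expf_neq0.
  by rewrite gt_eqF// subr_gt0 expr_lt1// ltW.
move=> z; rewrite inE => Sz; rewrite /X.
have zD : esq (r *: z) < 1 by apply: D1; apply: rD; rewrite rzE.
transitivity (\sum_k ((r *: z) ord0 k * flux_field f1 g1 k (r *: z) +
    s * ((r *: z) ord0 k * flux_field f2 g2 k (r *: z)))).
  by apply: eq_bigr => k _; rewrite mulrDr [_ * (s * _)]mulrCA.
rewrite sumr_lincomb /A mulrDr [in RHS]mulrCA.
by congr (_ + _ * _); rewrite flux_field_radial// rzE.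
Qed.

End green_formula.

(** * Complex-valued functions *)

Section radial_fields.
Variables (R : realType) (n : nat).
Local Notation R4n := 'rV[R]_(n * 4).

(** The contribution of one quaternionic coordinate, [p] and [q] being the derivatives of the real
    and the imaginary part and [c] one half. The sign [(-1) ^+ false] is kept to match
    [Rfield_formula] literally. *)
Let Rfield_term0 (c x0 x1 x2 x3 p0 p1 p2 p3 q0 q1 q2 q3 : R) :
  Complex x0 x1 * (Complex c 0 * (Complex p0 q0 - Complex 0 1 * Complex p1 q1)) +
  Complex x2 (- x3) * (Complex c 0 * (Complex p2 q2 + Complex 0 1 * Complex p3 q3)) =
  Complex
    (c * (x0 * p0 + x1 * p1 + x2 * p2 + x3 * p3 +
      (-1) ^+ false * (qc (Ordinal (isT : 0 < 4)%N) (Quat x0 x1 x2 x3 * qe R mu1) * q0 +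
        qc (Ordinal (isT : 1 < 4)%N) (Quat x0 x1 x2 x3 * qe R mu1) * q1 +
        qc (Ordinal (isT : 2 < 4)%N) (Quat x0 x1 x2 x3 * qe R mu1) * q2 +
        qc (Ordinal (isT : 3 < 4)%N) (Quat x0 x1 x2 x3 * qe R mu1) * q3)))
    (c * (x0 * q0 + x1 * q1 + x2 * q2 + x3 * q3 -
      (-1) ^+ false * (qc (Ordinal (isT : 0 < 4)%N) (Quat x0 x1 x2 x3 * qe R mu1) * p0 +
        qc (Ordinal (isT : 1 < 4)%N) (Quat x0 x1 x2 x3 * qe R mu1) * p1 +
        qc (Ordinal (isT : 2 < 4)%N) (Quat x0 x1 x2 x3 * qe R mu1) * p2 +
        qc (Ordinal (isT : 3 < 4)%N) (Quat x0 x1 x2 x3 * qe R mu1) * p3))).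
Proof. by simpc; congr Complex; rewrite /qc /=; ring. Qed.

Let Rfield_term1 (c x0 x1 x2 x3 p0 p1 p2 p3 q0 q1 q2 q3 : R) :
  Complex (- x2) (- x3) * (Complex c 0 * (- Complex p2 q2 + Complex 0 1 * Complex p3 q3)) +
  Complex x0 (- x1) * (Complex c 0 * (Complex p0 q0 + Complex 0 1 * Complex p1 q1)) =
  Complex
    (c * (x0 * p0 + x1 * p1 + x2 * p2 + x3 * p3 +
      (-1) ^+ true * (qc (Ordinal (isT : 0 < 4)%N) (Quat x0 x1 x2 x3 * qe R mu1) * q0 +
        qc (Ordinal (isT : 1 < 4)%N) (Quat x0 x1 x2 x3 * qe R mu1) * q1 +
        qc (Ordinal (isT : 2 < 4)%N) (Quat x0 x1 x2 x3 * qe R mu1) * q2 +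
        qc (Ordinal (isT : 3 < 4)%N) (Quat x0 x1 x2 x3 * qe R mu1) * q3)))
    (c * (x0 * q0 + x1 * q1 + x2 * q2 + x3 * q3 -
      (-1) ^+ true * (qc (Ordinal (isT : 0 < 4)%N) (Quat x0 x1 x2 x3 * qe R mu1) * p0 +
        qc (Ordinal (isT : 1 < 4)%N) (Quat x0 x1 x2 x3 * qe R mu1) * p1 +
        qc (Ordinal (isT : 2 < 4)%N) (Quat x0 x1 x2 x3 * qe R mu1) * p2 +
        qc (Ordinal (isT : 3 < 4)%N) (Quat x0 x1 x2 x3 * qe R mu1) * p3))).
Proof. by simpc; congr Complex; rewrite /qc /=; ring. Qed.

Lemma Complex_sum (I : finType) (F G : I -> R) :
  \sum_i Complex (F i) (G i) = Complex (\sum_i F i) (\sum_i G i).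
Proof.
by elim/big_ind3: _ => // ? ? ? ? ? ? -> ->.
Qed.

Lemma half_complex : (2^-1 : R[i]) = Complex 2^-1 0.
Proof.
apply: (mulfI (_ : 2 != 0 :> R[i])); first by rewrite pnatr_eq0.
rewrite mulfV ?pnatr_eq0//.
have -> : (2 : R[i]) = Complex 2 0.
  by rewrite [LHS](_ : _ = Complex (1 + 1) (0 + 0))// addr0.
by simpc; rewrite mulfV// pnatr_eq0.
Qed.

Definition euler (h : R4n -> R) (x : R4n) : R := \sum_k x ord0 k * partial k h x.

Lemma ixE l (k : 'I_4) : @ix n l k = mxvec_index l k.
Proof. by rewrite /ix inord_val. Qed.

(** Half of [(E - (-1)^b i T) f], split into real and imaginary parts. *)
Definition Rfield_formula (b : bool) (f : R4n -> R[i]) (x : R4n) : R[i] :=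
  let f1 y := complex.Re (f y) in let f2 y := complex.Im (f y) in
  let t h := tangential (fun k => partial k h) x in
  Complex (2^-1 * (euler f1 x + (-1) ^+ b * t f2))
          (2^-1 * (euler f2 x - (-1) ^+ b * t f1)).

Lemma RfieldE b f x : Rfield b f x = Rfield_formula b f x.
Proof.
have E : Rfield_formula b f x = \sum_l Complex
    (2^-1 * (\sum_k x ord0 (mxvec_index l k) *
        partial (mxvec_index l k) (fun y => complex.Re (f y)) x +
      (-1) ^+ b * \sum_k qc k (toH x l ord0 * qe R mu1) *
        partial (mxvec_index l k) (fun y => complex.Im (f y)) x))
    (2^-1 * (\sum_k x ord0 (mxvec_index l k) *
        partial (mxvec_index l k) (fun y => complex.Im (f y)) x -
      (-1) ^+ b * \sum_k qc k (toH x l ord0 * qe R mu1) *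
        partial (mxvec_index l k) (fun y => complex.Re (f y)) x)).
  rewrite Complex_sum /Rfield_formula /euler /tangential !sum_mxvec_index.
  rewrite -!mulr_sumr !big_split /= sumrN -!mulr_sumr.
  congr (Complex (_ * (_ + _ * _)) (_ * (_ - _ * _)));
    by do 2 (apply: eq_bigr => ? _); rewrite rmulE.
rewrite E /Rfield big_split_ord /= -big_split /=; apply: eq_bigr => l _.
have sl : fintype.split (lshift n l) = inl l := unsplitK (inl l).
have sr : fintype.split (rshift n l) = inr l := unsplitK (inr l).
rewrite /zcoord /nabla sl sr /cpartial !sum_ord4 -!ixE mxE /xc /= half_complex.
by case: b {E}; [exact: Rfield_term1|exact: Rfield_term0].
Qed.

End radial_fields.

Section complex_parts.
Variables (R : realType) (n : nat).
Local Notation R4n := 'rV[R]_(n * 4).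
Implicit Types (f g : R4n -> R) (x : R4n).

Lemma radial_wronskianE f g x :
  radial_wronskian f g x = f x * euler g x - g x * euler f x.
Proof.
by rewrite /radial_wronskian /euler !mulr_sumr -sumrB; apply: eq_bigr => k _;
  rewrite /wronskian; ring.
Qed.

Definition tangential_deriv f x : R := tangential (fun k => partial k f) x.

Lemma tangentialD (F G : 'I_(n * 4) -> R4n -> R) x :
  tangential (fun k y => F k y + G k y) x = tangential F x + tangential G x.
Proof. by rewrite /tangential -big_split; apply: eq_bigr => k _; rewrite mulrDr. Qed.

Lemma tangentialB (F G : 'I_(n * 4) -> R4n -> R) x :
  tangential (fun k y => F k y - G k y) x = tangential F x - tangential G x.
Proof. by rewrite /tangential -sumrB; apply: eq_bigr => k _; rewrite mulrBr. Qed.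

Lemma tangentialM f g x :
  tangential (fun k y => partial k f y * g y + f y * partial k g y) x =
  tangential_deriv f x * g x + f x * tangential_deriv g x.
Proof.
rewrite tangentialD /tangential_deriv /tangential mulr_suml mulr_sumr.
by congr (_ + _); apply: eq_bigr => k _; ring.
Qed.

Lemma mobius_laplacian_parts (F : R4n -> R[i]) x : cC2_on (eball 1) F -> esq x < 1 ->
  mobius_laplacian F x =
  Complex ((1 - esq x) * reduced_laplacian (fun y => complex.Re (F y)) x)
          ((1 - esq x) * reduced_laplacian (fun y => complex.Im (F y)) x).
Proof.
move=> [F1 F2] x1; rewrite -(mobius_laplacianE (@eball_open R _ 1) F1 x1 x1).
rewrite -(mobius_laplacianE (@eball_open R _ 1) F2 x1 x1).
exact: Complex_sum.
Qed.

Lemma Complex_eta (F : R4n -> R[i]) x :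
  F x = Complex (complex.Re (F x)) (complex.Im (F x)).
Proof. by case: (F x). Qed.

Let bulk_parts (u1 u2 v1 v2 a1 a2 b1 b2 w : R) :
  (Complex u1 u2 * Complex a1 a2 - Complex v1 v2 * Complex b1 b2) * Complex w 0 =
  Complex (((u1 * a1 - v1 * b1) + -1 * (u2 * a2 - v2 * b2)) * w)
          (((u1 * a2 - v2 * b1) + 1 * (u2 * a1 - v1 * b2)) * w).
Proof. by simpc; congr Complex; ring. Qed.

Lemma green_bulk_parts (u v : R4n -> R[i]) x :
  cC2_on (eball 1) u -> cC2_on (eball 1) v -> esq x < 1 ->
  let u1 y := complex.Re (u y) in let u2 y := complex.Im (u y) in
  let v1 y := complex.Re (v y) in let v2 y := complex.Im (v y) in
  let lap f y := (1 - esq y) * reduced_laplacian f y in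
  (u x * mobius_laplacian v x - v x * mobius_laplacian u x) *
    Complex ((1 - hnorm (toH x) ^+ 2) ^- (2 * n + 2)) 0 =
  Complex
   (((u1 x * lap v1 x - v1 x * lap u1 x) + -1 * (u2 x * lap v2 x - v2 x * lap u2 x)) *
     ((1 - esq x) ^+ (2 * n + 2))^-1)
   (((u1 x * lap v2 x - v2 x * lap u1 x) + 1 * (u2 x * lap v1 x - v1 x * lap u2 x)) *
     ((1 - esq x) ^+ (2 * n + 2))^-1).
Proof.
move=> hu hv x1 u1 u2 v1 v2 lap.
rewrite (mobius_laplacian_parts hu x1) (mobius_laplacian_parts hv x1).
rewrite /hnorm esq_toH sqr_sqrtr ?esq_ge0// (Complex_eta u) (Complex_eta v).
exact: bulk_parts.
Qed.

Let boundary_parts (u1 u2 v1 v2 eu1 eu2 ev1 ev2 tu1 tu2 tv1 tv2 h w : R) :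
  (Complex u1 u2 * Complex (h * (ev1 + (-1) ^+ false * tv2)) (h * (ev2 - (-1) ^+ false * tv1)) -
   Complex v1 v2 * Complex (h * (eu1 + (-1) ^+ true * tu2)) (h * (eu2 - (-1) ^+ true * tu1))) *
    Complex w 0 =
  Complex
   ((h * ((u1 * ev1 - v1 * eu1) + -1 * (u2 * ev2 - v2 * eu2) +
     1 * ((tu1 * v2 + u1 * tv2) + (tu2 * v1 + u2 * tv1)))) * w)
   ((h * ((u1 * ev2 - v2 * eu1) + 1 * (u2 * ev1 - v1 * eu2) +
     -1 * ((tu1 * v1 + u1 * tv1) - (tu2 * v2 + u2 * tv2)))) * w).
Proof. by simpc; congr Complex; ring. Qed.

(** The opposite signs of [T] in [Rfield false] and [Rfield true] join [u T v] and [v T u] into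
    [T (u v)]; the two tangential terms are the derivatives of the imaginary and of the real part of
    [u v]. *)
Lemma green_boundary_parts (u v : R4n -> R[i]) x (w : R) :
  let u1 y := complex.Re (u y) in let u2 y := complex.Im (u y) in
  let v1 y := complex.Re (v y) in let v2 y := complex.Im (v y) in
  let dM f g k y := partial k f y * g y + f y * partial k g y in
  (u x * Rfield false v x - v x * Rfield true u x) * Complex w 0 =
  Complex
   ((2^-1 * (radial_wronskian u1 v1 x + -1 * radial_wronskian u2 v2 x +
     1 * tangential (fun k y => dM u1 v2 k y + dM u2 v1 k y) x)) * w)
   ((2^-1 * (radial_wronskian u1 v2 x + 1 * radial_wronskian u2 v1 x +
     -1 * tangential (fun k y => dM u1 v1 k y - dM u2 v2 k y) x)) * w).
Proof.
move=> u1 u2 v1 v2 dM; rewrite tangentialD tangentialB !tangentialM !radial_wronskianE.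
rewrite !RfieldE (Complex_eta u) (Complex_eta v).
exact: boundary_parts.
Qed.

End complex_parts.

Local Open Scope complex_scope.

Theorem proposition5p1 (R : realType) (n : nat) (hn : (0 < n)%N)
    (sigma : {measure set 'rV[R]_(n * 4) -> \bar R})
    (sigma_inv : SpSp1_invariant sigma)
    (sigma1 : sigma (qsphere R n) = 1%E)
    (u v : 'rV[R]_(n * 4) -> R[i])
    (hu : cC2_on (qball R n 1) u) (hv : cC2_on (qball R n 1) v)
    (r : R) (r_gt0 : 0 < r) (r_lt1 : r < 1) :
  cintegral (lebesgue_rV R (n * 4)) (qball R n r)
    (fun q => (u q * mobius_laplacian v q - v q * mobius_laplacian u q)
              * ((1 - hnorm (toH q) ^+ 2) ^- (2 * n + 2))%:C)
  = 2 * (sphere_area R n)%:C *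
    cintegral sigma (qsphere R n)
      (fun zeta =>
         (u (r *: zeta) * Rfield false v (r *: zeta)
          - v (r *: zeta) * Rfield true u (r *: zeta))
         * (r ^+ (4 * n - 2) / (1 - r ^+ 2) ^+ (2 * n))%:C).
Proof.
have hu1 := hu; have hv1 := hv; rewrite qball_eball// expr1n in hu1 hv1.
have r0 : 0 <= r := ltW r_gt0.
have trans := sphere_transitive sigma_inv.
have mass : sigma (@esphere R (n * 4)) = 1%E by rewrite -qsphere_esphere.
have r2 : r ^+ 2 < 1 by rewrite expr_lt1.
pose u1 y := complex.Re (u y); pose u2 y := complex.Im (u y).
pose v1 y := complex.Re (v y); pose v2 y := complex.Im (v y).
have [hu1r hu1i] := hu1; have [hv1r hv1i] := hv1.
pose dM (f g : 'rV[R]_(n * 4) -> R) k y := partial k f y * g y + f y * partial k g y.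
have hM f g k : Ck_on 2 (eball 1) f -> Ck_on 2 (eball 1) g ->
    C1_along (eball 1) k (fun y => f y * g y) (dM f g k).
  by move=> hf hg; apply: C1_alongM; [exact: C1_along_Ck hf|exact: C1_along_Ck hg].
(* The pairs and the sign [s] are those of the real and the imaginary part of a product. As
   [- i T (u v)] has real part [T (Im (u v))] and imaginary part [- T (Re (u v))], the sign [t] is 1
   here and -1 in [im_part]. *)
have re_part := green_real hn mass trans r_gt0 r_lt1 (-1) 1 hu1r hv1r hu1i hv1i
  (fun k => C1_alongD (hM _ _ k hu1r hv1i) (hM _ _ k hu1i hv1r)).
have im_part := green_real hn mass trans r_gt0 r_lt1 1 (-1) hu1r hv1i hu1i hv1r
  (fun k => C1_alongB (hM _ _ k hu1r hv1r) (hM _ _ k hu1i hv1i)).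
have twoarea a b : 2 * (sphere_area R n)%:C * Complex a b =
    Complex (2 * sphere_area R n * a) (2 * sphere_area R n * b).
  rewrite [X in X * _ * _](_ : _ = Complex 2 0); last first.
    by rewrite [LHS](_ : _ = Complex (1 + 1) (0 + 0))// addr0.
  by simpc.
rewrite /cintegral twoarea qball_eball// qsphere_esphere.
have D1 x : x \in eball (r ^+ 2) -> esq x < 1 by rewrite inE => /lt_trans; exact.
congr Complex.
- refine (etrans _ (etrans re_part _)); last congr (_ * _).
    by apply: eq_Rintegral => x /D1 x1; rewrite (green_bulk_parts hu1 hv1 x1).
  by apply: eq_Rintegral => z _; rewrite green_boundary_parts.
- refine (etrans _ (etrans im_part _)); last congr (_ * _).
    by apply: eq_Rintegral => x /D1 x1; rewrite (green_bulk_parts hu1 hv1 x1).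
  by apply: eq_Rintegral => z _; rewrite green_boundary_parts.
Qed.
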